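(* Let $n,m\in\mathbb{N}$ with $m\ge 2$ and let $S_1,\dots,S_m\subseteq[n]$. There is a deterministic parallel algorithm with work $\tilde O\big(n+m+\sum_{i=1}^m|S_i|\big)$ and depth $\tilde O(\sqrt n)$ that computes a vector $\chi\in\{-1,1\}^n$ such that for every $i\in[m]$, $\big(\sum_{j\in S_i}\chi_j\big)^2=O(|S_i|\log^2 m)$.
   Context: Work-depth model of parallel computation: work is the total number of computational steps, depth is the longest chain of sequentially dependent steps. $\tilde O(x)$ denotes $x\cdot\operatorname{poly}(\log(nm))$. The $O(\cdot)$ hides an absolute constant. *)

(* Defs.v *)
From HB Require Import structures.
From mathcomp Require Import all_boot all_order all_algebra.
From mathcomp Require Import boolp reals exp.

Set Implicit Arguments.
Unset Strict Implicit.
Unset Printing Implicit Defensive.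

Import Order.TTheory GRing.Theory Num.Theory.

(* A fork-join random-access machine with work and depth accounting: a while
   language over integer words, with thread-private registers, a shared memory
   and a parallel loop.  A program is one finite piece of syntax, the same for
   all input sizes.  The shared memory is split into arrays whose names are
   literals of the program, so a program has finitely many of them. *)

Definition loc : Type := (nat * nat)%type. (* (array name, index) *)

Record state : Type := State { reg : nat -> int; heap : loc -> int }.

Definition set_reg (s : state) (x : nat) (v : int) : state :=
  State (fun y => if y == x then v else reg s y) (heap s).

Definition set_heap (s : state) (l : loc) (v : int) : state :=
  State (reg s) (fun l' => if l' == l then v else heap s l').

Inductive binop : Type := OAdd | OSub | OMul | ODiv | OMod | OLeq | OEq.

Inductive expr : Type :=
| Const of int
| Var of nat
| Get of nat & expr
| Op of binop & expr & expr.

Inductive com : Type :=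
| Skip
| Assign of nat & expr
| Store of nat & expr & expr
| Seq of com & com
| If of expr & com & com
| While of expr & com
| ParFor of nat & expr & com.

Definition binop_val (o : binop) (u v : int) : int :=
  match o with
  | OAdd => (u + v)%R
  | OSub => (u - v)%R
  | OMul => (u * v)%R
  | ODiv => (u %/ v)%Z
  | OMod => (u %% v)%Z
  | OLeq => Posz (u <= v)%R
  | OEq => Posz (u == v)
  end.

(* Arithmetic has unit cost, hence words must be bounded: a value of absolute
   value above B makes the computation fail. *)
Definition word (B : nat) (v : int) : option int :=
  if (`|v| <= B)%N then Some v else None.

Fixpoint eval (B : nat) (s : state) (e : expr) : option int :=
  match e with
  | Const v => word B v
  | Var x => word B (reg s x)
  | Get a e1 =>
      if eval B s e1 is Some (Posz k) then word B (heap s (a, k)) else None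
  | Op o e1 e2 =>
      match eval B s e1, eval B s e2 with
      | Some u, Some v => word B (binop_val o u v)
      | _, _ => None
      end
  end.

Fixpoint expr_cost (e : expr) : nat :=
  match e with
  | Const _ | Var _ => 1
  | Get _ e1 => (expr_cost e1).+1
  | Op _ e1 e2 => (expr_cost e1 + expr_cost e2).+1
  end.

Fixpoint expr_reads (B : nat) (s : state) (e : expr) : seq loc :=
  match e with
  | Const _ | Var _ => [::]
  | Get a e1 =>
      expr_reads B s e1 ++
      (if eval B s e1 is Some (Posz k) then [:: (a, k)] else [::])
  | Op _ e1 e2 => expr_reads B s e1 ++ expr_reads B s e2
  end.

Record effect : Type :=
  Effect { work : nat; depth : nat; reads : seq loc; writes : seq loc }.

Definition eff_eval (B : nat) (s : state) (e : expr) : effect :=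
  Effect (expr_cost e).+1 (expr_cost e).+1 (expr_reads B s e) [::].

Definition eff_store (B : nat) (s : state) (l : loc) (e1 e2 : expr) : effect :=
  Effect (expr_cost e1 + expr_cost e2).+1 (expr_cost e1 + expr_cost e2).+1
    (expr_reads B s e1 ++ expr_reads B s e2) [:: l].

Definition eff_seq (t1 t2 : effect) : effect :=
  Effect (work t1 + work t2) (depth t1 + depth t2)
    (reads t1 ++ reads t2) (writes t1 ++ writes t2).

Definition eff_par (k : nat) (t : 'I_k -> effect) : effect :=
  Effect (\sum_(i < k) (work (t i)).+1) (\max_(i < k) (depth (t i)).+1)
    (flatten [seq reads (t i) | i <- enum 'I_k])
    (flatten [seq writes (t i) | i <- enum 'I_k]).

(* A cell written by one thread is neither read nor written by another one;
   concurrent reads are allowed. *)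
Definition race_free (k : nat) (t : 'I_k -> effect) : Prop :=
  forall (i j : 'I_k) (l : loc), i != j ->
    l \in writes (t i) -> l \notin reads (t j) ++ writes (t j).

(* exec B c s s' t: from state s, the command c terminates without failure in
   state s' with effect t.  A parallel loop over x < k runs its k bodies from
   the state at the fork, each with its own copy of the registers; at the join
   the writes are merged and the copies of the registers are discarded. *)
Inductive exec (B : nat) : com -> state -> state -> effect -> Prop :=
| Exec_skip s : exec B Skip s s (Effect 1 1 [::] [::])
| Exec_assign x e s v :
    eval B s e = Some v ->
    exec B (Assign x e) s (set_reg s x v) (eff_eval B s e)
| Exec_store a e1 e2 s k v :
    eval B s e1 = Some (Posz k) -> eval B s e2 = Some v ->
    exec B (Store a e1 e2) s (set_heap s (a, k) v) (eff_store B s (a, k) e1 e2)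
| Exec_seq c1 c2 s s1 s2 t1 t2 :
    exec B c1 s s1 t1 -> exec B c2 s1 s2 t2 ->
    exec B (Seq c1 c2) s s2 (eff_seq t1 t2)
| Exec_if e c1 c2 s s' t v :
    eval B s e = Some v -> exec B (if v != 0%R then c1 else c2) s s' t ->
    exec B (If e c1 c2) s s' (eff_seq (eff_eval B s e) t)
| Exec_while_stop e c s :
    eval B s e = Some 0%R -> exec B (While e c) s s (eff_eval B s e)
| Exec_while_step e c s s1 s2 t1 t2 v :
    eval B s e = Some v -> v != 0%R ->
    exec B c s s1 t1 -> exec B (While e c) s1 s2 t2 ->
    exec B (While e c) s s2 (eff_seq (eff_eval B s e) (eff_seq t1 t2))
| Exec_par x e c s s' k (f : 'I_k -> state) (t : 'I_k -> effect) :
    eval B s e = Some (Posz k) ->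
    (forall i : 'I_k, exec B c (set_reg s x (Posz i)) (f i) (t i)) ->
    race_free t ->
    reg s' = reg s ->
    (forall (i : 'I_k) (l : loc),
        l \in writes (t i) -> heap s' l = heap (f i) l) ->
    (forall l : loc,
        (forall i : 'I_k, l \notin writes (t i)) -> heap s' l = heap s l) ->
    exec B (ParFor x e c) s s' (eff_seq (eff_eval B s e) (eff_par t)).

Lemma exec_deterministic (B : nat) (c : com) (s s1 s2 : state)
    (t1 t2 : effect) :
  exec B c s s1 t1 -> exec B c s s2 t2 -> s1 = s2 /\ t1 = t2.
Proof.
move=> H; elim: H s2 t2 => {c s s1 t1}.
- by move=> s s2 t2 H; inversion H.
- by move=> x e s v Hv s2 t2 H; inversion H; subst; split; congruence.
- by move=> a e1 e2 s k v H1 H2 s2 t2 H; inversion H; subst; split; congruence.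
- move=> c1 c2 s sa sb ta tb _ IH1 _ IH2 s2 t2 H.
  inversion H as [| | |? ? ? s1 ? t1' t2' Ha Hb| | | |]; subst.
  have [E1 E2] := IH1 _ _ Ha; subst.
  by have [E1 E2] := IH2 _ _ Hb; subst.
- move=> e c1 c2 s s' t v Hv _ IH s2 t2 H.
  inversion H as [| | | |? ? ? ? ? t' v' Hv' Hc| | |]; subst.
  have E : v' = v by congruence.
  by subst v'; have [E1 E2] := IH _ _ Hc; subst.
- move=> e c s Hv s2 t2 H.
  inversion H as [| | | | | |? ? ? ? ? ? ? v' Hv' Hn|]; subst => //.
  have E : v' = 0%R by congruence.
  by rewrite E eqxx in Hn.
- move=> e c s sa sb ta tb v Hv Hn _ IH1 _ IH2 s2 t2 H.
  inversion H as [| | | | |? ? ? Hv'|? ? ? s1 ? t1' t2' v' Hv' Hn' Ha Hb|]; subst.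
    have E : v = 0%R by congruence.
    by rewrite E eqxx in Hn.
  have [E1 E2] := IH1 _ _ Ha; subst.
  by have [E1 E2] := IH2 _ _ Hb; subst.
- move=> x e c s s' k f t Hk _ IH _ Hr Hw Hu s2 t2 H.
  inversion H as [| | | | | | |x' e' c' s0 s0' k' f' t' Hk' He' Hf' Hr' Hw' Hu'].
  subst.
  have E : k' = k by congruence.
  subst k'.
  have Ef : f' = f by apply: funext => i; have [-> _] := IH i _ _ (He' i).
  have Et : t' = t by apply: funext => i; have [_ ->] := IH i _ _ (He' i).
  subst f' t'; split=> //.
  case: s' s2 Hr Hw Hu Hr' Hw' Hu' {H} => [r h] [r' h'] /= -> Hw Hu -> Hw' Hu'.
  congr State; apply: funext => l.
  have [[i Hi]|Hn] := pselect (exists i : 'I_k, l \in writes (t i)).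
    by rewrite (Hw i) ?(Hw' i).
  have Hl i : l \notin writes (t i) by apply/negP => Hi; apply: Hn; exists i.
  by rewrite Hu ?Hu'.
Qed.

(* The lists of elements of the sets, each in arbitrary order without
   repetition; the elements of [n] are numbered from 0. *)
Definition lists_of (n m : nat) (S : 'I_m -> {set 'I_n})
    (sets : seq (seq nat)) : Prop :=
  size sets = m /\
  forall i : 'I_m, perm_eq (nth [::] sets i) [seq val j | j <- enum (S i)].

(* Array 0 holds the m + 1 offsets of the lists in their concatenation, which
   is in array 1; registers 0 and 1 hold n and m; everything else is 0. *)
Definition input_state (n : nat) (sets : seq (seq nat)) : state :=
  State
    (fun x => match x with
              | 0 => Posz n
              | 1 => Posz (size sets)
              | _ => 0%R
              end)
    (fun l => match l.1 with
              | 0 => Posz (nth 0 (0 :: scanl addn 0 (shape sets)) l.2)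
              | 1 => Posz (nth 0 (flatten sets) l.2)
              | _ => 0%R
              end).

Definition output (n : nat) (s : state) (j : 'I_n) : int := heap s (2, val j).

(* Words of O(log(nm)) bits; the successors keep n and m representable when
   n = 0. *)
Definition word_bound (K n m : nat) : nat := (n.+1 * m.+1) ^ K.

(* Main.v *)
(* Cut [n] into b ~ sqrt n blocks of b elements.  Inside a block the elements are
   coloured one after the other, all blocks in parallel, by a derandomized
   multiplicative weights rule: the set i carries two weights, multiplied by
   1 + e/L and 1 - e/L when its discrepancy moves by e, and the next sign is the
   one that does not increase the total weight.  As 1 + x >= exp(x - 2x^2) for
   x >= -1/2, a final weight <= 4mb that started at b bounds the discrepancy of
   the set on the block by L ln(4m) + 2(sum e^2)/L; L ~ sqrt(c/log m) gives the
   square O(c log m) when the set has c elements in the block.  A second run of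
   the same rule colours the blocks, the coefficients now being these block
   discrepancies and L ~ sqrt |S_i|: the sum of their squares is
   O(|S_i| log m), whence O(sqrt |S_i| log m) in total.  Both runs have b
   sequential steps of logarithmic depth.

   The weights are integers, updated by a division rounded down plus 1, so that
   they dominate the exact product; this adds at most 2m to the total weight at
   each of the b steps, no more than the initial total 2mb.  Coefficients with
   2|e| > L break the hypothesis x >= -1/2 and are replaced by 0; since
   |e| <= 2e^2/L for them, what they add is again bounded by (sum e^2)/L.

   A step has to visit the sets containing an element, so the incidence lists
   must be transposed without sorting.  Each element has a binary tree over the
   set indices, stored sparsely in zero-initialized memory; its nodes count the
   sets below them containing the element and are filled level by level, which
   also yields the rank of each set in the list of the element. *)

Require Import Defs.
From HB Require Import structures.
From mathcomp Require Import all_boot all_order all_algebra.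
From mathcomp Require Import boolp reals sequences exp.
From mathcomp Require Import zify ring lra.

Set Implicit Arguments.
Unset Strict Implicit.
Unset Printing Implicit Defensive.

Import Order.TTheory GRing.Theory Num.Theory.

(** * Reasoning about programs *)

(** One run of the greedy rule over all of [n] would even give the square O(|S_i| log m), but in n
    sequential steps; the second logarithm is the price of depth sqrt n. The machine fails on large
    words and on races, so results, word size, race freedom and costs are proved together. Registers
    and cells stay within [M = Z ^ 3] with [Z = 8 (n + 1) (m + 1)]. Only values inside an
    expression, such as addresses, may be larger, and they are at most [M] to the power of its cost;
    no expression costs more than 50, whence [K = 450 = 3 * 3 * 50]. Race freedom comes from giving
    each thread cells that it alone may write and that no other thread reads. The machine has no
    logarithm: the height [ell] of the trees, with [2 ^ (ell - 1) <= m < 2 ^ ell], replaces log m.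
    In the final constant, 403 = 3 + 4 * 100: [ln (4 m) <= 3 ell], the squared block discrepancies
    of a set add up to at most [100 ell |S_i|], and they enter with factor 2 from the greedy bound
    and 2 from the truncated coefficients. *)

Fixpoint den (s : state) (e : expr) : int :=
  match e with
  | Const v => v
  | Var x => reg s x
  | Get a e1 => heap s (a, `|den s e1|%N)
  | Op o e1 e2 => binop_val o (den s e1) (den s e2)
  end.

(** Literals are limited to 8 because leaves are estimated by [M] and only [8 <= M] is assumed; a
    negative address would make the machine fail. *)
Fixpoint ok (Rd : loc -> Prop) (s : state) (e : expr) : Prop :=
  match e with
  | Const v => `|v| <= 8
  | Var _ => True
  | Get a e1 => ok Rd s e1 /\ exists2 k, den s e1 = Posz k & Rd (a, k)
  | Op _ e1 e2 => ok Rd s e1 /\ ok Rd s e2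
  end.

(* Registers assigned outside parallel loops; the private copies of the
   registers are discarded at a join. *)
Fixpoint mods (c : com) : seq nat :=
  match c with
  | Assign x _ => [:: x]
  | Seq c1 c2 | If _ c1 c2 => mods c1 ++ mods c2
  | While _ c1 => mods c1
  | _ => [::]
  end.

Lemma absz_modz_le (u v : int) : `|(u %% v)%Z| <= `|u| + `|v|.
Proof.
have [->|v0] := eqVneq v 0%R; first by rewrite modz0 leq_addr.
have := ltz_mod u v0; have := modz_ge0 u v0.
move: (u %% v)%Z => x; lia.
Qed.

(** With both bounds at least 2 the product also dominates the sum, so one bound serves all
    operators, including the remainder modulo 0. *)
Lemma absz_binop_le (o : binop) (u v : int) (a b : nat) :
  2 <= a -> 2 <= b -> `|u| <= a -> `|v| <= b -> `|binop_val o u v| <= a * b.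
Proof.
move=> a2 b2 ua vb; have ab : a + b <= a * b by nia.
have a_ab : a <= a * b by apply: leq_pmulr; lia.
case: o => /=.
- by lia.
- by lia.
- by rewrite abszM; apply: leq_mul.
- exact: leq_trans (lez_div u v) (leq_trans ua a_ab).
- by apply: leq_trans (absz_modz_le u v) _; lia.
- by case: (u <= v)%R => /=; nia.
- by case: (u == v) => /=; nia.
Qed.

(* Kept folded: the arithmetic tactics would expand the power. *)
Definition fits (B M : nat) : Prop := M ^ 50 <= B.

(** * A program logic with footprints, word bounds and costs *)

Section Logic.

Variables B M : nat.
Hypotheses (M_ge8 : 8 <= M) (B_ge : fits B M).

Definition small (s : state) : Prop :=
  (forall x, `|reg s x| <= M) /\ (forall l, `|heap s l| <= M).

(** Bounds multiply where costs add: a node costs one more than its operands together, so the cost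
    can serve as the exponent. *)
Lemma den_le Rd s e : small s -> ok Rd s e -> `|den s e| <= M ^ expr_cost e.
Proof.
move=> [sr sh]; have M1 n : 0 < n -> M <= M ^ n.
  by case: n => // n _; rewrite expnS leq_pmulr // expn_gt0; lia.
have M2 n : 0 < n -> 2 <= M ^ n by move=> /M1; lia.
have cost_gt0 e' : 0 < expr_cost e' by case: e'.
elim: e => [v|x|a e1 _|o e1 IH1 e2 IH2] /=.
- by rewrite expn1; lia.
- by rewrite expn1.
- by move=> _; apply: leq_trans (sh _) (M1 _ _).
- move=> [/IH1 h1 /IH2 h2]; rewrite expnS expnD.
  apply: leq_trans (absz_binop_le o (M2 _ _) (M2 _ _) h1 h2) _ => //.
  by apply: leq_pmull; lia.
Qed.

(** This removes word checks from all later arguments: evaluation may be replaced by the total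
    function [den]. *)
Lemma evalE Rd s e : small s -> ok Rd s e -> expr_cost e <= 50 ->
  eval B s e = Some (den s e) /\ (forall l, l \in expr_reads B s e -> Rd l).
Proof.
move=> sm; have wordE e' : ok Rd s e' -> expr_cost e' <= 50 ->
    word B (den s e') = Some (den s e').
  move=> oke ce; rewrite /word ifT //.
  apply: leq_trans (den_le sm oke) (leq_trans _ B_ge).
  by rewrite leq_pexp2l //; lia.
elim: e => [v|x|a e1 IH|o e1 IH1 e2 IH2] oke ce.
- by split=> //=; rewrite (wordE (Const v)).
- by split=> //=; rewrite (wordE (Var x)).
- have [ok1 [k Ek Rk]] := oke.
  have [E1 R1] := IH ok1 (ltnW ce).
  rewrite /= E1 Ek; split.
    by have := wordE (Get a e1) oke ce; rewrite /= Ek.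
  move=> l; rewrite mem_cat => /orP[/R1 //|].
  by rewrite inE => /eqP ->.
- have [ok1 ok2] := oke; move: (ce) => /= ce'.
  have [E1 R1] := IH1 ok1 ltac:(lia); have [E2 R2] := IH2 ok2 ltac:(lia).
  rewrite /= E1 E2; split; first exact: (wordE (Op o e1 e2)).
  by move=> l; rewrite mem_cat => /orP[/R1|/R2].
Qed.

(* From s, c terminates in a state satisfying Q together with its work and depth;
   everything it reads is in Rd and everything it writes is in Wr. *)
Definition wp (Rd Wr : loc -> Prop) (s : state) (c : com)
    (Q : state -> nat -> nat -> Prop) : Prop :=
  small s -> exists s' t, [/\ exec B c s s' t, small s',
    forall l, l \in reads t -> Rd l, forall l, l \in writes t -> Wr l
    & Q s' (work t) (depth t)].

Lemma exec_heap c s s' t l :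
  exec B c s s' t -> l \notin writes t -> heap s' l = heap s l.
Proof.
move=> H; elim: H => {c s s' t}.
- by [].
- by [].
- by move=> a e1 e2 s k v _ _ /=; rewrite inE => /negPf ->.
- move=> c1 c2 s s1 s2 t1 t2 _ IH1 _ IH2 /=.
  by rewrite mem_cat negb_or => /andP[/IH1 <- /IH2].
- by move=> e c1 c2 s s' t v _ _ IH /= /IH.
- by [].
- move=> e c s s1 s2 t1 t2 v _ _ _ IH1 _ IH2 /=.
  by rewrite mem_cat negb_or => /andP[/IH1 <- /IH2].
- move=> x e c s s' k f t _ _ _ _ _ _ Hu /= nl; apply: Hu => i.
  apply: contra nl => li; apply/flattenP; exists (writes (t i)) => //.
  by apply/mapP; exists i => //; rewrite mem_enum.
Qed.

Lemma exec_reg c s s' t x :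
  exec B c s s' t -> x \notin mods c -> reg s' x = reg s x.
Proof.
move=> H; elim: H => {c s s' t} //.
- by move=> y e s v _ /=; rewrite inE => /negPf ->.
- move=> c1 c2 s s1 s2 t1 t2 _ IH1 _ IH2 /=.
  by rewrite mem_cat negb_or => /andP[/IH1 <- /IH2].
- move=> e c1 c2 s s' t v _ _ IH /=.
  rewrite mem_cat negb_or => /andP[h1 h2]; apply: IH.
  by case: (v != 0)%R.
- by move=> e c s s1 s2 t1 t2 v _ _ _ IH1 _ IH2 h; rewrite IH2 // IH1.
- by move=> y e c s s' k f t _ _ _ _ -> _ _ _.
Qed.

(** Consequence and frame rule in one: cells outside the write footprint and registers not assigned
    keep their values, so specifications need not mention them. *)
Lemma wp_use Rd0 Wr0 Q0 (Rd Wr : loc -> Prop) s c (Q : state -> nat -> nat -> Prop) :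
  wp Rd0 Wr0 s c Q0 ->
  (forall l, Rd0 l -> Rd l) -> (forall l, Wr0 l -> Wr l) ->
  (forall s' w d, small s' -> Q0 s' w d ->
     (forall l, ~ Wr0 l -> heap s' l = heap s l) ->
     (forall x, x \notin mods c -> reg s' x = reg s x) -> Q s' w d) ->
  wp Rd Wr s c Q.
Proof.
move=> H hR hW hQ sm; have [s' [t [ex sm' rt wt q]]] := H sm.
exists s', t; split=> // [l /rt /hR //|l /wt /hW //|].
apply: hQ => //.
- by move=> l nl; apply: (exec_heap ex); apply/negP => /wt.
- by move=> x; apply: exec_reg ex.
Qed.

Lemma wp_mono Rd Wr s c (Q0 Q : state -> nat -> nat -> Prop) :
  wp Rd Wr s c Q0 -> (forall s' w d, Q0 s' w d -> Q s' w d) -> wp Rd Wr s c Q.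
Proof. by move=> H hQ; apply: (wp_use H) => // s' w d _ /hQ. Qed.

Lemma wp_small Rd Wr s c Q : (small s -> wp Rd Wr s c Q) -> wp Rd Wr s c Q.
Proof. by move=> H sm; apply: H. Qed.

Lemma wp_skip Rd Wr s (Q : state -> nat -> nat -> Prop) :
  Q s 1 1 -> wp Rd Wr s Skip Q.
Proof.
by move=> q sm; exists s, (Effect 1 1 [::] [::]); split=> //; constructor.
Qed.

Lemma wp_assign Rd Wr s x e (Q : state -> nat -> nat -> Prop) :
  expr_cost e <= 50 -> ok Rd s e -> `|den s e| <= M ->
  Q (set_reg s x (den s e)) (expr_cost e).+1 (expr_cost e).+1 ->
  wp Rd Wr s (Assign x e) Q.
Proof.
move=> ce oke le q sm; have [E R] := evalE sm oke ce.
exists (set_reg s x (den s e)), (eff_eval B s e); split=> //.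
- by constructor.
- by case: sm => sr sh; split=> // y /=; case: ifP.
Qed.

Lemma wp_store Rd (Wr : loc -> Prop) s a e1 e2 k (Q : state -> nat -> nat -> Prop) :
  expr_cost e1 <= 50 -> expr_cost e2 <= 50 -> ok Rd s e1 -> ok Rd s e2 ->
  den s e1 = Posz k -> Wr (a, k) -> `|den s e2| <= M ->
  Q (set_heap s (a, k) (den s e2)) (expr_cost e1 + expr_cost e2).+1
    (expr_cost e1 + expr_cost e2).+1 ->
  wp Rd Wr s (Store a e1 e2) Q.
Proof.
move=> c1 c2 ok1 ok2 Ek wk le q sm.
have [E1 R1] := evalE sm ok1 c1; have [E2 R2] := evalE sm ok2 c2.
exists (set_heap s (a, k) (den s e2)), (eff_store B s (a, k) e1 e2); split=> //.
- by constructor; rewrite // E1 Ek.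
- by case: sm => sr sh; split=> // y /=; case: ifP.
- by move=> l /=; rewrite mem_cat => /orP[/R1|/R2].
- by move=> l /=; rewrite inE => /eqP ->.
Qed.

Lemma wp_seq Rd Wr s c1 c2 (Q : state -> nat -> nat -> Prop) :
  wp Rd Wr s c1 (fun s1 w1 d1 =>
    wp Rd Wr s1 c2 (fun s2 w2 d2 => Q s2 (w1 + w2) (d1 + d2))) ->
  wp Rd Wr s (Seq c1 c2) Q.
Proof.
move=> H sm; have [s1 [t1 [ex1 sm1 r1 w1 H1]]] := H sm.
have [s2 [t2 [ex2 sm2 r2 w2 q]]] := H1 sm1.
exists s2, (eff_seq t1 t2); split=> //.
- exact: Exec_seq ex1 ex2.
- by move=> l /=; rewrite mem_cat => /orP[/r1|/r2].
- by move=> l /=; rewrite mem_cat => /orP[/w1|/w2].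
Qed.

Lemma wp_if Rd Wr s e c1 c2 (Q : state -> nat -> nat -> Prop) :
  expr_cost e <= 50 -> ok Rd s e ->
  (den s e != 0%R -> wp Rd Wr s c1 (fun s' w d =>
     Q s' ((expr_cost e).+1 + w) ((expr_cost e).+1 + d))) ->
  (den s e = 0%R -> wp Rd Wr s c2 (fun s' w d =>
     Q s' ((expr_cost e).+1 + w) ((expr_cost e).+1 + d))) ->
  wp Rd Wr s (If e c1 c2) Q.
Proof.
move=> ce oke H1 H2 sm; have [E R] := evalE sm oke ce.
have [E0|n0] := eqVneq (den s e) 0%R.
  have [s' [t [ex sm' r w q]]] := H2 E0 sm.
  exists s', (eff_seq (eff_eval B s e) t); split=> //.
    by apply: Exec_if E _; rewrite E0 eqxx.
  by move=> l /=; rewrite mem_cat => /orP[/R|/r].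
have [s' [t [ex sm' r w q]]] := H1 n0 sm.
exists s', (eff_seq (eff_eval B s e) t); split=> //.
  by apply: Exec_if E _; rewrite n0.
by move=> l /=; rewrite mem_cat => /orP[/R|/r].
Qed.

(** The work bound depends on the round because rounds visit elements lying in different numbers of
    sets; for the depth a uniform bound is enough. *)
Lemma wp_while Rd Wr s e c (I : nat -> state -> Prop) N (wc : nat -> nat) dc :
  expr_cost e <= 50 ->
  (forall k s1, k <= N -> I k s1 -> ok Rd s1 e) ->
  (forall k s1, k < N -> I k s1 -> den s1 e != 0%R /\
     wp Rd Wr s1 c (fun s2 w d => [/\ I k.+1 s2, w <= wc k & d <= dc])) ->
  (forall s1, I N s1 -> den s1 e = 0%R) -> I 0 s ->
  wp Rd Wr s (While e c) (fun s' w d =>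
    [/\ I N s', w <= \sum_(k < N) (wc k + (expr_cost e).+1) + (expr_cost e).+1
      & d <= N * (dc + (expr_cost e).+1) + (expr_cost e).+1]).
Proof.
move=> ce oke step stop I0.
(* Induction on the number j of rounds left when the loop is entered in round k. *)
suff H j k s1 : j + k = N -> I k s1 -> wp Rd Wr s1 (While e c) (fun s' w d =>
    [/\ I N s', w <= \sum_(i < j) (wc (k + i) + (expr_cost e).+1) + (expr_cost e).+1
      & d <= j * (dc + (expr_cost e).+1) + (expr_cost e).+1]).
  exact: (H N 0 s (addn0 N) I0).
elim: j k s1 => [|j IH] k s1 jk Ik sm.
  move: jk; rewrite add0n => kN; subst k.
  have [E R] := evalE sm (oke _ _ (leqnn _) Ik) ce.
  exists s1, (eff_eval B s1 e); split=> //.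
    by constructor; rewrite E stop.
  by rewrite big_ord0 mul0n /=.
have kN : k < N by lia.
have [n0 H] := step _ _ kN Ik.
have [E R] := evalE sm (oke _ _ (ltnW kN) Ik) ce.
have [s2 [t2 [ex2 sm2 r2 w2 [Ik2 wc2 dc2]]]] := H sm.
have jk' : j + k.+1 = N by lia.
have [s3 [t3 [ex3 sm3 r3 w3 [IN3 wc3 dc3]]]] := IH k.+1 s2 jk' Ik2 sm2.
exists s3, (eff_seq (eff_eval B s1 e) (eff_seq t2 t3)); split=> //.
- exact: Exec_while_step E n0 ex2 ex3.
- by move=> l /=; rewrite !mem_cat => /orP[/R|/orP[/r2|/r3]].
- by move=> l /=; rewrite mem_cat => /orP[/w2|/w3].
split=> //=; last by rewrite mulSn; lia.
rewrite big_ord_recl addn0.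
have -> : \sum_(i < j) (wc (k + lift ord0 i) + (expr_cost e).+1) =
    \sum_(i < j) (wc (k.+1 + i) + (expr_cost e).+1).
  by apply: eq_bigr => i _; rewrite lift0 (addnS k).
by lia.
Qed.

(* own i are the cells that the thread i may write; restricting the other threads'
   reads to cells they own alone or nobody owns gives race freedom. *)
Lemma wp_par Rd (Wr : loc -> Prop) s x e c k (own : nat -> loc -> Prop)
    (Q : nat -> state -> Prop) (wb : nat -> nat) db :
  expr_cost e <= 50 -> ok Rd s e -> den s e = Posz k -> k <= M ->
  (forall i l, i < k -> own i l -> Wr l) ->
  (forall i j l, i < k -> j < k -> own i l -> own j l -> i = j) ->
  (forall i, i < k ->
     wp (fun l => Rd l /\ forall j, j < k -> own j l -> j = i) (own i)
        (set_reg s x (Posz i)) c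
        (fun s' w d => [/\ Q i s', w <= wb i & d <= db])) ->
  wp Rd Wr s (ParFor x e c) (fun s' w d =>
    [/\ reg s' = reg s,
        forall i, i < k -> exists2 s1, Q i s1 &
          forall l, own i l -> heap s' l = heap s1 l,
        forall l, (forall i, i < k -> ~ own i l) -> heap s' l = heap s l,
        w <= (expr_cost e).+1 + \sum_(i < k) (wb i).+1
      & d <= (expr_cost e).+1 + db.+1]).
Proof.
move=> ce oke Ek kM hW disj body sm; have [E R] := evalE sm oke ce.
have smi i : i < k -> small (set_reg s x (Posz i)).
  by case: sm => sr sh ik; split=> //= y; case: ifP => // _ /=; lia.
have /boolp.choice[F HF] : forall i : 'I_k, exists st : state * effect,
    [/\ exec B c (set_reg s x (Posz i)) st.1 st.2, small st.1,
      forall l, l \in reads st.2 -> Rd l /\ forall j, j < k -> own j l -> j = i,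
      forall l, l \in writes st.2 -> own i l
    & [/\ Q i st.1, work st.2 <= wb i & depth st.2 <= db]].
  move=> i; have [s' [t H]] := body i (ltn_ord i) (smi i (ltn_ord i)).
  by exists (s', t).
(* The merged memory: a cell takes its value from its owner, who is unique by [disj]. *)
pose h l := if pselect (exists i : 'I_k, own i l) is left P
            then heap (F (sval (cid P))).1 l else heap s l.
have hown (i : 'I_k) l : own i l -> h l = heap (F i).1 l.
  rewrite /h => oi; case: pselect => [P|[]]; last by exists i.
  case: (cid P) => j /= oj.
  by rewrite (val_inj (disj _ _ _ (ltn_ord j) (ltn_ord i) oj oi)).
have hnot l : (forall i, i < k -> ~ own i l) -> h l = heap s l.
  by rewrite /h => no; case: pselect => // -[i oi]; case: (no i (ltn_ord i)).
exists (State (reg s) h), (eff_seq (eff_eval B s e) (eff_par (fun i => (F i).2))).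
split.
- apply: (@Exec_par _ _ _ _ _ _ k (fun i => (F i).1)) => //.
  + by rewrite E Ek.
  + by move=> i; have [] := HF i.
  + move=> i j l ij li; have [_ _ _ /(_ l li) oi _] := HF i.
    have [_ _ rj wj _] := HF j.
    apply/negP; rewrite mem_cat => /orP[/rj[_ /(_ i (ltn_ord i) oi)]|/wj oj].
      by move/val_inj => e'; rewrite e' eqxx in ij.
    by rewrite (val_inj (disj _ _ _ (ltn_ord i) (ltn_ord j) oi oj)) eqxx in ij.
  + by move=> i l li /=; apply: hown; have [_ _ _ /(_ l li)] := HF i.
  (* A cell may be owned without being written; its owner has then left it as it was at the fork. *)
  + move=> l nl /=; rewrite /h; case: pselect => // P.
    case: (cid P) => j /= oj; have [ex _ _ _ _] := HF j.
    by rewrite (exec_heap ex (nl j)).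
- case: sm => sr sh; split=> //= l; rewrite /h; case: pselect => [P|//].
  by have [_ [_ shF] _ _ _] := HF (sval (cid P)).
- move=> l /=; rewrite mem_cat => /orP[/R //|].
  move=> /flattenP[_ /mapP[i _ ->] li].
  by have [_ _ /(_ l li)[]] := HF i.
- move=> l /= /flattenP[_ /mapP[i _ ->] li].
  by have [_ _ _ /(_ l li) oi _] := HF i; apply: hW oi.
- split=> //=.
  + move=> i ik; have [_ _ _ _ [q _ _]] := HF (Ordinal ik).
    by exists (F (Ordinal ik)).1 => // l oi; apply: (hown (Ordinal ik)).
  + rewrite leq_add2l; apply: leq_sum => i _; rewrite ltnS.
    by have [_ _ _ _ []] := HF i.
  + rewrite leq_add2l; apply/bigmax_leqP => i _; rewrite ltnS.
    by have [_ _ _ _ []] := HF i.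
Qed.

End Logic.

(** * Incidence lists and counting trees *)

Section Incidence.

Variable sets : seq (seq nat).
Let m := size sets.

Definition inS (i j : nat) : bool := j \in nth [::] sets i.

Definition sel (j : nat) : seq nat := [seq i <- iota 0 (size sets) | inS i j].

(* The node v at height h of the tree of the element j covers the set indices
   [v 2^h, (v + 1) 2^h). *)
Definition node_count (h j v : nat) : nat :=
  count (fun i => (i %/ 2 ^ h == v) && inS i j) (iota 0 (size sets)).

(** The position of i among the sets of its node that contain j: always 0 at the leaves, and the
    position in the whole list of j at the root. *)
Definition node_rank (h i j : nat) : nat :=
  count (fun i' => (i' %/ 2 ^ h == i %/ 2 ^ h) && inS i' j) (iota 0 i).

Definition offset (i : nat) : nat := sumn (take i (shape sets)).

Lemma inS_lt i j : inS i j -> i < m.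
Proof.
by rewrite /inS; case: (ltnP i m) => // mi; rewrite nth_default.
Qed.

Lemma mem_sel i j : (i \in sel j) = inS i j.
Proof.
rewrite mem_filter mem_iota /= add0n; case: (boolP (inS i j)) => //= /inS_lt.
by [].
Qed.

Lemma sel_uniq j : uniq (sel j).
Proof. by rewrite filter_uniq // iota_uniq. Qed.

Lemma node_count0 j v : node_count 0 j v = inS v j.
Proof.
rewrite /node_count.
rewrite (@eq_count _ _ (fun i => pred1 v i && inS v j)); last first.
  by move=> i /=; rewrite divn1; case: eqP => // ->.
case: (boolP (inS v j)) => [vj|nvj]; last first.
  by rewrite (@eq_count _ _ pred0) ?count_pred0 // => i; rewrite andbF.
rewrite (@eq_count _ _ (pred1 v)); last by move=> i; rewrite andbT.
by rewrite count_uniq_mem ?iota_uniq // mem_iota /= add0n (inS_lt vj).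
Qed.

Lemma node_rank0 i j : node_rank 0 i j = 0.
Proof.
apply/eqP; rewrite -leqn0 leqNgt -has_count; apply/hasPn => k.
by rewrite mem_iota /= !divn1 => /ltn_eqF ->.
Qed.

Lemma node_countS h j v :
  node_count h.+1 j v = node_count h j (v * 2) + node_count h j (v * 2).+1.
Proof.
rewrite /node_count -count_predUI [X in _ = _ + X](@eq_count _ _ pred0) => [|i /=].
  rewrite count_pred0 addn0; apply: eq_count => i /=; rewrite expnSr divnMA.
  by rewrite -andb_orl; congr andb; move: (i %/ 2 ^ h) => x; lia.
by move: (i %/ 2 ^ h) => x; case: (inS i j); lia.
Qed.

(** Passing to the parent, a left child keeps its ranks and a right child is preceded by all the
    sets of its left sibling. *)
Lemma node_rankS h i j : i < m ->
  node_rank h.+1 i j = node_rank h i j +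
    (if odd (i %/ 2 ^ h) then node_count h j (i %/ 2 ^ h).-1 else 0).
Proof.
move=> im; have -> : (if odd (i %/ 2 ^ h) then node_count h j (i %/ 2 ^ h).-1 else 0)
    = count (fun i' => odd (i %/ 2 ^ h) && (i' %/ 2 ^ h == (i %/ 2 ^ h).-1)
                       && inS i' j) (iota 0 i).
  case: (boolP (odd _)) => [od|_]; last first.
    by rewrite (@eq_count _ _ pred0) ?count_pred0.
  (* The sets of the left sibling all have indices below i, so counting up to m or up to i is the
     same. *)
  rewrite /node_count -/m -(subnKC (ltnW im)) iotaD count_cat add0n.
  rewrite [X in _ + X](_ : _ = 0) ?addn0 //.
  apply/eqP; rewrite -leqn0 leqNgt -has_count; apply/hasPn => k.
  rewrite mem_iota => /andP[ik _]; rewrite negb_and; apply/orP; left.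
  have := leq_div2r (2 ^ h) ik; move: (i %/ 2 ^ h) (k %/ 2 ^ h) od => x y; lia.
rewrite /node_rank -count_predUI [X in _ = _ + X](@eq_count _ _ pred0) => [|k /=].
  rewrite count_pred0 addn0; apply: eq_in_count => k; rewrite mem_iota => /andP[_ ki] /=.
  rewrite expnSr !divnMA -andb_orl; congr andb.
  have := leq_div2r (2 ^ h) (ltnW ki); move: (i %/ 2 ^ h) (k %/ 2 ^ h) => x y; lia.
by move: (i %/ 2 ^ h) (k %/ 2 ^ h) => x y; case: (inS k j); lia.
Qed.

(** Of two sets in one node the smaller is counted in the rank of the larger, so a node has at most
    one representative. *)
Lemma node_rank_inj h i k j : inS i j -> inS k j ->
  i %/ 2 ^ h = k %/ 2 ^ h -> node_rank h i j = 0 -> node_rank h k j = 0 -> i = k.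
Proof.
wlog ik : i k / i <= k.
  move=> W ij kj e ri rk; case: (leqP i k) => [|/ltnW] le; first exact: W.
  by apply/esym; apply: W.
move=> ij kj e _ /eqP; rewrite -leqn0 leqNgt -has_count => /hasPn H.
case: ltngtP ik => // ik _; have := H i.
by rewrite mem_iota ik e eqxx ij => /(_ isT).
Qed.

(** The least set of a nonempty node represents it. *)
Lemma node_rank_ex h j v : 0 < node_count h j v ->
  exists i, [/\ inS i j, i %/ 2 ^ h = v & node_rank h i j = 0].
Proof.
rewrite /node_count -has_count => /hasP[i0 _ /andP[/eqP i0v i0j]].
have exP : exists i, (i %/ 2 ^ h == v) && inS i j by exists i0; rewrite i0v eqxx.
case: (ex_minnP exP) => i /andP[/eqP iv ij] imin; exists i; split=> //.
apply/eqP; rewrite -leqn0 leqNgt -has_count; apply/hasPn => k.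
rewrite mem_iota /= add0n => ki; apply/negP; rewrite iv => /imin.
by rewrite leqNgt ki.
Qed.

Lemma node_count_root h j : m <= 2 ^ h -> node_count h j 0 = size (sel j).
Proof.
move=> mh; rewrite size_filter; apply: eq_in_count => i.
rewrite mem_iota /= => im; rewrite divn_small ?eqxx //.
by apply: leq_trans mh; exact: im.
Qed.

(** At the root all quotients are 0 and the node condition is void; cutting [sel j] at i leaves
    exactly the counted sets in front. *)
Lemma node_rank_root h i j : m <= 2 ^ h -> inS i j ->
  node_rank h i j = index i (sel j).
Proof.
move=> mh ij; have im := inS_lt ij.
rewrite /sel -/m -(subnKC (ltnW im)) iotaD filter_cat add0n.
rewrite index_cat mem_filter mem_iota ltnn !andbF.
have -> : m - i = (m - i).-1.+1 by lia.
rewrite /= ij /= eqxx addn0 size_filter; apply: eq_in_count => k.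
rewrite mem_iota /= add0n => ki.
by rewrite !divn_small ?eqxx // (leq_trans _ mh) // (ltn_trans ki).
Qed.

Lemma offsetS i : offset i.+1 = offset i + size (nth [::] sets i).
Proof.
rewrite /offset; case: (ltnP i (size sets)) => im; last first.
  by rewrite !take_oversize ?size_map ?(leqW im) // nth_default // addn0.
by rewrite (take_nth 0) ?size_map // sumn_rcons (nth_map [::]).
Qed.

Lemma offset0 : offset 0 = 0.
Proof. by rewrite /offset take0. Qed.

Lemma nth_offset i : i <= m ->
  nth 0 (0 :: scanl addn 0 (shape sets)) i = offset i.
Proof.
case: i => [|i] im; first by rewrite offset0.
rewrite /= nth_scanl ?size_map //.
by rewrite /offset sumnE foldlE /= big_cons add0n.
Qed.

Lemma nth_flatten_offset i r : i < m -> r < size (nth [::] sets i) ->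
  nth 0 (flatten sets) (offset i + r) = nth 0 (nth [::] sets i) r.
Proof.
rewrite /offset /m; elim: sets i => [|s ss IH] [|i] //= im rs.
  by rewrite add0n nth_cat rs.
by rewrite nth_cat -addnA ltnNge leq_addr /= addKn IH.
Qed.

End Incidence.

(** * The greedy rule *)

Definition incr (a : int) (L : nat) (w : int) : int := ((a * w) %/ Posz L)%Z.

Definition step (a : int) (L : nat) (w : int) : int := (w + incr a L w + 1)%R.

Definition sign_of (d : int) : int := if (d <= 0)%R then 1%R else (- 1)%R.

(** Rounding down a number and its opposite can only lose. Hence the changes of the total weight for
    the two signs, surcharges aside, add up to at most 0. *)
Lemma incrN_le (a : int) (L : nat) (w : int) : 0 < L ->
  (incr a L w + incr (- a) L w <= 0)%R.
Proof.
move=> L0; rewrite /incr mulNr; set x := (a * w)%R.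
have := lez_floor x (_ : Posz L != 0)%R; have := lez_floor (- x)%R (_ : Posz L != 0)%R.
move=> /(_ ltac:(lia)) h1 /(_ ltac:(lia)) h2.
have L1 : (0 < Posz L)%R by lia.
by rewrite -(pmulr_rle0 _ L1) mulrC; nia.
Qed.

Lemma step_ge (a : int) (L : nat) (w : int) : 0 < L ->
  (w * (Posz L + a) <= step a L w * Posz L)%R.
Proof.
move=> L0; rewrite /step /incr.
have := divz_eq (a * w)%R (Posz L).
have := ltz_mod (a * w)%R (_ : Posz L != 0)%R => /(_ ltac:(lia)).
rewrite gtr0_norm ?ltz_nat //.
move: ((a * w) %/ L)%Z ((a * w) %% L)%Z => q r; nia.
Qed.

(* u i g: the set i meets the group g; e i kk x: its coefficient at the step x of
   the block kk; L i kk: the inverse of its learning rate there. *)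
Section Greedy.

Variables (m b : nat) (u : nat -> nat -> bool).
Variable e : nat -> nat -> nat -> int.
Variable L : nat -> nat -> nat.

(** The change of the total weight under the sign +1, without the surcharge of 1 per updated
    weight. *)
Definition score (kk : nat) (w : (nat -> int) * (nat -> int)) (x : nat) : int :=
  (\sum_(0 <= i < m | u i (kk * b + x)) (incr (e i kk x) (L i kk) (w.1 i)
                              + incr (- e i kk x) (L i kk) (w.2 i)))%R.

Fixpoint weights (kk x : nat) : (nat -> int) * (nat -> int) :=
  if x is y.+1 then
    let w := weights kk y in
    let g := kk * b + y in
    let a i := (sign_of (score kk w y) * e i kk y)%R in
    (fun i => if u i g then step (a i) (L i kk) (w.1 i) else w.1 i,
     fun i => if u i g then step (- a i) (L i kk) (w.2 i) else w.2 i)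
  else (fun _ => Posz b, fun _ => Posz b).

Definition greedy_sign (kk x : nat) : int :=
  sign_of (score kk (weights kk x) x).

Lemma greedy_signP kk x : greedy_sign kk x = 1%R \/ greedy_sign kk x = (- 1)%R.
Proof. by rewrite /greedy_sign /sign_of; case: ifP => _; [left|right]. Qed.

Definition coef (kk i y : nat) : int := ((u i (kk * b + y))%:R * e i kk y)%R.

Hypothesis L_gt0 : forall i kk, 0 < L i kk.

(** A step adds the change for the chosen sign, which is at most 0, and a surcharge of 2 for each
    set that is touched. *)
Lemma potential_le kk x :
  (\sum_(0 <= i < m) ((weights kk x).1 i + (weights kk x).2 i)
    <= Posz (2 * m * b + 2 * m * x))%R.
Proof.
elim: x => [|x IH].
  rewrite /= sumr_const_nat subn0 -mulr_natl; nia.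
set g := kk * b + x; set w := weights kk x.
have -> : (\sum_(0 <= i < m) ((weights kk x.+1).1 i + (weights kk x.+1).2 i)
   = \sum_(0 <= i < m) (w.1 i + w.2 i) +
     \sum_(0 <= i < m | u i g) (incr (greedy_sign kk x * e i kk x) (L i kk) (w.1 i)
        + incr (- (greedy_sign kk x * e i kk x)) (L i kk) (w.2 i) + 2))%R.
  rewrite [X in _ = (_ + X)%R]big_mkcond -big_split; apply: eq_bigr => i _ /=.
  rewrite -/w -/g -/(greedy_sign kk x).
  by case: (u i g); rewrite /step; ring.
have cnt2 : (\sum_(0 <= i < m | u i g) 2 <= Posz (2 * m))%R.
  rewrite big_mkcond; apply: le_trans (_ : \sum_(0 <= i < m) 2 <= _)%R.
    by apply: ler_sum => i _; case: (u i g).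
  by rewrite sumr_const_nat subn0 -mulr_natl; lia.
suff sc : (\sum_(0 <= i < m | u i g) (incr (greedy_sign kk x * e i kk x) (L i kk) (w.1 i)
        + incr (- (greedy_sign kk x * e i kk x)) (L i kk) (w.2 i)) <= 0)%R.
  rewrite [X in (_ + X <= _)%R]big_split /=.
  by apply: le_trans (lerD IH (lerD sc cnt2)) _; lia.
rewrite /greedy_sign -/w -/g /sign_of; case: ifP => sg.
  by move: sg; rewrite /score; under [in X in _ -> X]eq_bigr do rewrite mul1r.
have: (\sum_(0 <= i < m | u i g) ((incr (e i kk x) (L i kk) (w.1 i)
         + incr (- e i kk x) (L i kk) (w.2 i)) +
     (incr (- 1 * e i kk x) (L i kk) (w.1 i)
        + incr (- (- 1 * e i kk x)) (L i kk) (w.2 i))) <= 0)%R.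
  apply: sumr_le0 => i _; rewrite !mulN1r.
  by rewrite addrACA -[0%R]addr0 lerD // incrN_le.
rewrite big_split; set X := (X in (_ + X <= 0)%R -> _) => h.
have s0 : (0 < score kk w x)%R by rewrite ltNge sg.
rewrite -/X; apply: le_trans h.
by rewrite lerDr; exact: ltW s0.
Qed.

Hypothesis e_le : forall i kk x, `|e i kk x|%N * 2 <= L i kk.

Lemma step_gt0 (a : int) (l : nat) (w : int) : 0 < l -> `|a| * 2 <= l ->
  (0 < w)%R -> (0 < step a l w)%R.
Proof. by move=> l0 al w0; have := step_ge a w l0; nia. Qed.

Lemma weights_gt0 kk x i : 0 < b ->
  (0 < (weights kk x).1 i)%R /\ (0 < (weights kk x).2 i)%R.
Proof.
move=> b0; elim: x => [|x [IH1 IH2]] /=; first by rewrite ltz_nat.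
rewrite -/(greedy_sign kk x); have al := e_le i kk x.
by case: ifP => _ //; split; apply: step_gt0 => //; case: (greedy_signP kk x) => ->; lia.
Qed.

(** All weights are positive, so each is at most their total. *)
Lemma weights_le kk x i : 0 < b -> i < m -> x <= b ->
  ((weights kk x).1 i <= Posz (4 * m * b))%R /\ ((weights kk x).2 i <= Posz (4 * m * b))%R.
Proof.
move=> b0 im xb; have := potential_le kk x.
rewrite big_mkord (bigD1 (Ordinal im)) //=.
have : (0 <= \sum_(j < m | j != Ordinal im) ((weights kk x).1 j + (weights kk x).2 j))%R.
  by apply: sumr_ge0 => j _; have := weights_gt0 kk x j b0; lia.
have mxb : m * x <= m * b by rewrite leq_mul2l xb orbT.
set r := (X in (0 <= X)%R -> _) => r0 h; have [p1 p2] := weights_gt0 kk x i b0.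
move: h; rewrite -/r; move: (weights kk x).1 (weights kk x).2 r r0 p1 p2 => f g r.
move: (f i) (g i) => fi gi; lia.
Qed.

(** * From integer weights to a real discrepancy bound *)

Section Real.

Variable R : realType.
Local Open Scope ring_scope.

Lemma expR_quadratic_le (x : R) : - 2^-1 <= x -> expR (x - 2 * x ^+ 2) <= 1 + x.
Proof.
move=> x2; set y := x - 2 * x ^+ 2.
have ny : 1 - y <= expR (- y) by have := expR_ge1Dx (- y).
have y1 : 0 < 1 - y by rewrite /y; nra.
have: expR y * expR (- y) = 1 by rewrite -expRD subrr expR0.
have e0 := expR_gt0 y.
have: 1 <= (1 + x) * (1 - y).
  rewrite /y (_ : _ * _ = 1 + x ^+ 2 * (1 + 2 * x)); last by ring.
  by rewrite lerDl mulr_ge0 ?sqr_ge0 //; lra.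
nra.
Qed.

Lemma prod_exp_le (x : nat -> R) (k : nat) :
  (forall y, - 2^-1 <= x y) ->
  expR (\sum_(0 <= y < k) (x y - 2 * x y ^+ 2)) <= \prod_(0 <= y < k) (1 + x y).
Proof.
move=> hx; elim: k => [|k IH]; first by rewrite !big_geq // expR0.
rewrite !big_nat_recr //= expRD.
by apply: ler_pM; rewrite ?expR_ge0 // expR_quadratic_le.
Qed.

Lemma factor_ge kk i (s : bool) (y : nat) :
  - 2^-1 <= (-1) ^+ s * (greedy_sign kk y * (u i (kk * b + y))%:R
              * e i kk y)%:~R / (L i kk)%:R :> R.
Proof.
have Lp : 0 < (L i kk)%:R :> R by rewrite ltr0n.
rewrite ler_pdivlMr //; set v := (_ * _ * _).
have v_le : (`|v| * 2 <= L i kk)%N.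
  have := e_le i kk y; rewrite /v.
  by case: (greedy_signP kk y) => ->; case: (u i _); lia.
have : (- Posz (L i kk))%:~R <= (2 * ((-1) ^+ s * v))%:~R :> R.
  by rewrite ler_int; case: s; rewrite ?expr0 ?expr1; lia.
rewrite rmorphN !rmorphM rmorph_sign /= -pmulrn.
by move=> h; rewrite -(ler_pM2l (_ : 0 < 2 :> R)) // mulrA mulrN divff ?pnatr_eq0 // mulN1r.
Qed.

(** The flag s picks one of the two weights of the set and the matching sign of the discrepancy;
    [key] is where the rounding of [step] is absorbed. *)
Lemma prod_weight_le kk i (s : bool) (x : nat) : (0 < b)%N ->
  b%:R * \prod_(0 <= y < x) (1 + (-1) ^+ s *
      (greedy_sign kk y * (u i (kk * b + y))%:R * e i kk y)%:~R
        / (L i kk)%:R)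
  <= (if s then (weights kk x).2 i else (weights kk x).1 i)%:~R :> R.
Proof.
move=> b0; elim: x => [|x IH].
  by rewrite big_geq // mulr1; case: s.
rewrite big_nat_recr //= mulrA -/(greedy_sign kk x).
set g := (kk * b + x)%N.
have Lp : 0 < (L i kk)%:R :> R by rewrite ltr0n.
have key (c w : int) : w%:~R * (1 + c%:~R / (L i kk)%:R) <= (step c (L i kk) w)%:~R :> R.
  have := step_ge c w (L_gt0 i kk); rewrite -(ler_int R) !rmorphM rmorphD /=.
  rewrite -ler_pdivrMr // => h; apply: le_trans h.
  by rewrite le_eqVlt; apply/orP; left; apply/eqP; field; rewrite gt_eqF.
have {}w_ge0 : 0 <= 1 + (-1) ^+ s * (greedy_sign kk x * (u i g)%:R * e i kk x)%:~R
    / (L i kk)%:R :> R by have := factor_ge kk i s x; rewrite -/g; lra.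
apply: le_trans (ler_wpM2r w_ge0 IH) _.
case: (boolP (u i g)) => ug; last by rewrite mulr0 mul0r rmorph0 mulr0 mul0r addr0 mulr1; case: ifP.
case: s {IH w_ge0} => /=; rewrite ?expr0 ?expr1 mulr1 ?mul1r ?mulN1r.
  by rewrite -rmorphN key.
exact: key.
Qed.

Lemma greedy_disc kk i : (i < m)%N -> (0 < b)%N ->
  `|(\sum_(0 <= y < b) greedy_sign kk y * coef kk i y)%:~R|
    <= (L i kk)%:R * ln (4 * m)%:R
       + 2 * (\sum_(0 <= y < b) coef kk i y ^+ 2)%:~R / (L i kk)%:R :> R.
Proof.
move=> im b0; pose f := coef kk i; have Lp : 0 < (L i kk)%:R :> R by rewrite ltr0n.
have main (s : bool) : (-1) ^+ s * (\sum_(0 <= y < b) greedy_sign kk y * f y)%:~R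
    <= (L i kk)%:R * ln (4 * m)%:R
       + 2 * (\sum_(0 <= y < b) f y ^+ 2)%:~R / (L i kk)%:R :> R.
  pose x y : R := (-1) ^+ s * (greedy_sign kk y * (u i (kk * b + y))%:R
                     * e i kk y)%:~R / (L i kk)%:R.
  have x_ge y : - 2^-1 <= x y by exact: factor_ge.
  (* The initial weight b cancels against the final bound [4 m b]; only [4 m] enters the
     logarithm. *)
  have prod_le : \prod_(0 <= y < b) (1 + x y) <= (4 * m)%:R.
    rewrite -(ler_pM2l (_ : 0 < b%:R :> R)) ?ltr0n //.
    apply: le_trans (prod_weight_le kk i s b b0) _.
    have := weights_le kk b0 im (leqnn b).
    rewrite -!(ler_int R) -natrM mulnC pmulrn => -[h1 h2].
    by case: ifP.
  have := le_trans (prod_exp_le b x_ge) prod_le.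
  rewrite -[X in _ <= X](@lnK R); last by rewrite posrE ltr0n; lia.
  rewrite ler_expR big_split /=.
  have -> : \sum_(0 <= y < b) x y = (-1) ^+ s * (\sum_(0 <= y < b) greedy_sign kk y * f y)%:~R / (L i kk)%:R.
    rewrite rmorph_sum mulr_sumr mulr_suml; apply: eq_bigr => y _.
    by rewrite /x /f /coef mulrA.
  have -> : \sum_(0 <= y < b) - (2 * x y ^+ 2) = - (2 * (\sum_(0 <= y < b) f y ^+ 2)%:~R / (L i kk)%:R ^+ 2).
    rewrite rmorph_sum mulr_sumr mulr_suml -sumrN; apply: eq_bigr => y _.
    rewrite /x /f /coef; congr (- _); rewrite -mulrA !exprMn -exprVn sqrr_sign mul1r.
    rewrite -rmorphXn -mulrA exprMn.
    have -> : greedy_sign kk y ^+ 2 = 1 by case: (greedy_signP kk y) => ->.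
    by rewrite mul1r mulrA -exprMn exprVn.
  rewrite lerBlDr ler_pdivrMr // => h; apply: le_trans h _.
  by rewrite le_eqVlt; apply/orP; left; apply/eqP; field; rewrite gt_eqF.
have := main true; have := main false; rewrite expr0 expr1 mul1r mulN1r.
by move=> h1 h2; rewrite ler_norml h1 lerNl h2.
Qed.

End Real.
End Greedy.

(** * The program *)

(* Registers: 0 n, 1 m, 2 b, 3 row width Z, 4 height of the trees, 5 its power of
   two, 6 set i, 7 element j, 8 position in a list, 9 block, 10 group, 11 element
   within the group, 12 sign, 13 rate L, 14 coefficient, 15 number of blocks,
   16 size of a group, 17 el (see rate), 18-20 and 22 stride, thread, length and
   row of reduce, 21 scratch.
   Arrays: 0-1 input, 2 output, 3 counting trees, 4 ranks, 5 transposed lists,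
   6 rank of an element within its set and block, 7 sizes of the sets in the
   blocks, 8 sizes of the sets, 9 all zero; arr d 0-5 belong to the stage d: two
   weights, block discrepancies, two arrays to reduce, signs.
   A matrix entry (x, y) is the cell x * Z + y. *)
Definition Lit (k : nat) : expr := Const (Posz k).
Notation V := Var.
Declare Scope expr_scope.
Delimit Scope expr_scope with X.
Arguments Op _ _%X _%X.
Notation "x + y" := (Op OAdd x y) : expr_scope.
Notation "x - y" := (Op OSub x y) : expr_scope.
Notation "x * y" := (Op OMul x y) : expr_scope.
Notation "x / y" := (Op ODiv x y) : expr_scope.
Notation "x %% y" := (Op OMod x y) : expr_scope.
Notation "x <= y" := (Op OLeq x y) : expr_scope.
Arguments Get _ _%X.
Arguments Assign _ _%X.
Arguments Store _ _%X _%X.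
Arguments If _%X _ _.
Arguments While _%X _.
Arguments ParFor _ _%X _.
Notation "c1 ;; c2" := (Seq c1 c2) (at level 90, right associativity).

(** * Parallel summation of a row *)

Definition reduce (arr : nat) : com :=
  Assign 18 (Lit 1) ;;
  While (Lit 1 + V 18 <= V 20)
    (ParFor 19 (V 20 / (Lit 2 * V 18) + Lit 1)
       (Store arr (V 22 * V 3 + Lit 2 * V 18 * V 19)
          (Get arr (V 22 * V 3 + Lit 2 * V 18 * V 19)
           + Get arr (V 22 * V 3 + Lit 2 * V 18 * V 19 + V 18))) ;;
     Assign 18 (Lit 2 * V 18)).

(** N is the exact number of rounds of a loop that doubles from 1 while it stays below c. *)
Lemma pow2_bracket (c : nat) :
  exists2 N, c <= 2 ^ N & forall k, k < N -> 2 ^ k < c.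
Proof.
have exP : exists N, c <= 2 ^ N by exists c; apply: ltnW; apply: ltn_expl.
case: (ex_minnP exP) => N cN Nmin; exists N => // k kN.
by rewrite ltnNge; apply/negP => /Nmin; rewrite leqNgt kN.
Qed.

(** Every partial sum formed by the tree summation obeys the same word bound as the sum of the
    absolute values. *)
Lemma sum_block_le (x : nat -> int) len a c :
  (forall r, len <= r -> x r = 0%R) ->
  `|(\sum_(a <= r < c) x r)%R| <= \sum_(0 <= r < len) `|x r|.
Proof.
move=> x0; apply: leq_trans (_ : \sum_(a <= r < c) `|x r| <= _).
  elim/big_ind2: _ => // u1 u2 v1 v2 h1 h2; lia.
apply: leq_trans (_ : \sum_(0 <= r < maxn c len) `|x r| <= _).
  have mc : maxn c len >= c by lia.
  case: (leqP a c) => ac; last by rewrite big_geq // ltnW.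
  rewrite [leqRHS](@big_cat_nat _ _ _ c) //=; apply: leq_trans (leq_addr _ _).
  by rewrite [leqRHS](@big_cat_nat _ _ _ a) //= leq_addl.
rewrite (@big_cat_nat _ _ _ len) ?leq_maxr //= [X in _ + X]big1_seq ?addn0 //.
by move=> r /andP[_]; rewrite mem_index_iota => /andP[lr _]; rewrite x0.
Qed.

(** The bound [M] on registers and cells. The largest values are sums of weight changes, at most
    [16 m^2 b^3], which is [O(Z^2)]; the third power absorbs the constant. *)
Definition cap (Z : nat) : nat := Z ^ 3.

Definition log_bound (Z Lam : nat) : Prop := Z < 2 ^ Lam.

Section Program.

Variables B Z : nat.
Local Notation M := (cap Z).
Hypotheses (Z_ge8 : 8 <= Z) (B_ge : fits B M).

Lemma Z_le_M : Z <= M.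
Proof. rewrite /cap; by rewrite -{1}(expn1 Z) leq_pexp2l //; lia. Qed.

Lemma M_ge8 : 8 <= M.
Proof. exact: leq_trans Z_ge8 Z_le_M. Qed.

Local Notation wp := (wp B M).
Local Notation wpW I N wc dc := (@wp_while B M M_ge8 B_ge _ _ _ _ _ I N wc dc).
Local Notation wpP k own Q wb db :=
  (@wp_par B M M_ge8 B_ge _ _ _ _ _ _ k own Q wb db).
Local Notation wpA := (@wp_assign B M M_ge8 B_ge).
Local Notation wpS k := (@wp_store B M M_ge8 B_ge _ _ _ _ _ _ k).

Lemma M_gt0 : 0 < M.
Proof. exact: leq_trans M_ge8. Qed.

Hint Resolve M_ge8 M_gt0 : core.

Variable Lam : nat.
Hypothesis Z_lt : log_bound Z Lam.

Lemma pow2_bracket_le (c : nat) : c <= Z ->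
  exists N, [/\ c <= 2 ^ N, forall k, k < N -> 2 ^ k < c & N <= Lam].
Proof.
move=> cZ; have [N cN Nlt] := pow2_bracket c; exists N; split=> //.
rewrite leqNgt; apply/negP => /Nlt; rewrite ltnNge (leq_trans cZ) //.
exact: ltnW Z_lt.
Qed.

Definition row_cell (arr row : nat) (l : loc) : Prop :=
  l.1 = arr /\ l.2 %/ Z = row.

Lemma row_divE row c : c < Z -> (row * Z + c) %/ Z = row.
Proof. by move=> cZ; rewrite divnMDl ?divn_small ?addn0 //; lia. Qed.

(** The summation works in place and reads past the length, where the row is zero; as the stride
    stays below [len], it never passes [2 * len], hence [2 * len < Z]. *)
Lemma wp_reduce s arr row len (x : nat -> int) :
  reg s 3 = Posz Z -> reg s 22 = Posz row -> reg s 20 = Posz len ->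
  2 * len < Z ->
  (forall r, r < Z -> heap s (arr, row * Z + r) = x r) ->
  (forall r, len <= r -> x r = 0%R) ->
  \sum_(0 <= r < len) `|x r| <= M ->
  wp (row_cell arr row) (row_cell arr row) s (reduce arr) (fun s' w d =>
    [/\ heap s' (arr, row * Z) = (\sum_(0 <= r < len) x r)%R,
        w <= 200 * Lam.+1 * len.+1 & d <= 200 * Lam.+1]).
Proof.
move=> r3 r22 r20 lenZ hx x0 xM.
have [N [lenN Nlt NLam]] : exists N, [/\ len <= 2 ^ N,
    forall k, k < N -> 2 ^ k < len & N <= Lam] by apply: pow2_bracket_le; lia.
apply: wp_seq; apply: wpA => //=.
(* After k rounds the multiples of [2 ^ k] hold the sums of their blocks of [2 ^ k] entries; the
   other cells hold stale values. *)
set I := fun k s1 =>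
  [/\ [/\ reg s1 3 = Posz Z, reg s1 22 = Posz row, reg s1 20 = Posz len &
       reg s1 18 = Posz (2 ^ k)] &
      forall q, 2 ^ k * q < Z -> heap s1 (arr, row * Z + 2 ^ k * q)
         = (\sum_(2 ^ k * q <= r < 2 ^ k * q.+1) x r)%R].
apply: wp_mono.
  apply: (wpW I N (fun k => 41 * len + 140) 140) => //=.
  - move=> k s1 kN [[e3 e22 e20 e18] hq]; split.
      by rewrite e18 e20 /=; have := Nlt k kN; lia.
    set P := 2 ^ k; have P0 : 0 < P by rewrite expn_gt0.
    have Plen : P < len by apply: Nlt.
    pose K := len %/ (2 * P) + 1.
    have KL : K <= len by rewrite /K addn1 ltn_Pdiv //; lia.
    have len_lt q : K <= q -> len <= 2 * P * q.
      move=> qK; apply: ltnW; apply: leq_trans (ltn_ceil len (_ : 0 < 2 * P)) _; first by lia.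
      by rewrite -addn1 -/K mulnC leq_mul2l qK orbT.
    have thr_le q : q < K -> 2 * P * q <= len.
      rewrite /K addn1 ltnS (mulnC _ q) => qK; apply: leq_trans (leq_divM len (2 * P)).
      by rewrite leq_mul2r qK orbT.
    have KE : K = len %/ (2 * P) + 1 by [].
    clearbody K.
    (* A thread also reads an odd multiple of P; since only even multiples are written, this is no
       race. *)
    have odd_cell q q' : 2 * P * q' != 2 * P * q + P.
      apply/eqP => e; have : P * (2 * q') = P * (2 * q + 1) by lia.
      by move/eqP; rewrite eqn_pmul2l //; lia.
    apply: wp_seq; apply: wp_mono.
      apply: (wpP K
        (fun q l => l = (arr, row * Z + 2 * P * q))
        (fun q s2 => heap s2 (arr, row * Z + 2 * P * q) =
            (heap s1 (arr, (row * Z + 2 * P * q)%N) + heap s1 (arr, (row * Z + 2 * P * q + P)%N))%R)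
        (fun _ => 40) 40) => //=.
    1-6: rewrite ?e3 ?e22 ?e20 ?e18 -/P /=.
    + by rewrite -PoszM divz_nat KE.
    + by apply: leq_trans Z_le_M; lia.
    + move=> q l qK ->; split=> //=; rewrite row_divE //.
      by have := thr_le q qK; lia.
    + move=> q1 q2 l q1K q2K -> [] /addnI /eqP.
      by rewrite eqn_pmul2l ?muln_gt0 // => /eqP.
    + move=> q qK.
      have qP := thr_le q qK.
      have cell1 : row_cell arr row (arr, row * Z + 2 * P * q).
        by split; rewrite //= row_divE //; lia.
      have cell2 : row_cell arr row (arr, row * Z + 2 * P * q + P).
        by split; rewrite //= -addnA row_divE //; lia.
      have h1 := hq (2 * q); have h2 := hq (2 * q).+1.
      apply: (wpS (row * Z + 2 * P * q)); rewrite //= ?e3 ?e22 ?e20 ?e18 -/P //=.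
      * split; split=> //.
          exists (row * Z + 2 * P * q) => //; split=> // j jK [] /addnI /eqP.
          by rewrite eqn_pmul2l ?muln_gt0 // => /eqP.
        exists (row * Z + 2 * P * q + P) => //; split=> // j jK [].
        by rewrite -addnA => /addnI/eqP; rewrite eq_sym (negPf (odd_cell _ _)).
      * have -> : row * Z + 2 * P * q = row * Z + P * (2 * q) by lia.
        have -> : row * Z + P * (2 * q) + P = row * Z + P * (2 * q).+1 by lia.
        rewrite h1 ?h2; [|lia|lia].
        rewrite -big_cat_nat /=; [|nia|nia].
        by apply: leq_trans (sum_block_le _ _ x0) xM.
      * by split=> //; rewrite eqxx.
    + move=> s2 w d [er hth hun hw hd]; apply: wpA => //=; rewrite ?er ?e18 -/P //=.
        by have := Z_le_M; lia.
      split=> //; last first.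
      * by move: hd; lia.
      * by move: hw; rewrite sum_nat_const card_ord; lia.
      split; first by rewrite /= er e3 e22 e20 expnS -/P.
      move=> q; rewrite expnS -/P /= => qZ; case: (ltnP q K) => qK.
        have [s3 e1 e2] := hth q qK; rewrite e2 // e1.
        have qP := thr_le q qK.
        have h1 := hq (2 * q); have h2 := hq (2 * q).+1.
        have -> : row * Z + 2 * P * q = row * Z + P * (2 * q) by lia.
        have -> : row * Z + P * (2 * q) + P = row * Z + P * (2 * q).+1 by lia.
        rewrite h1 ?h2; [|lia|lia].
        rewrite -big_cat_nat /=; [|nia|nia].
        by congr bigop; congr index_iota; lia.
      (* No thread reaches this cell, but its block lies beyond the length and both sums are 0. *)
      have lenq := len_lt q qK.
      rewrite hun; last first.
        move=> q' q'K [] /addnI /eqP; rewrite eqn_pmul2l ?muln_gt0 // => /eqP; lia.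
      have -> : row * Z + 2 * P * q = row * Z + P * (2 * q) by lia.
      rewrite hq; last by lia.
      rewrite !big_nat !big1 // => r /andP[h _]; apply: x0; lia.
  - move=> s1 [[_ _ e20 e18] _]; rewrite e20 e18 /=.
    by have := lenN; lia.
  - split=> // q; rewrite expn0 mul1n => qZ /=.
    by rewrite hx // mul1n big_nat1.
  move=> s' w d [[_ hq] hw hd]; split.
  - have := hq 0; rewrite muln0 addn0 muln1 => ->; last by lia.
    rewrite (@big_cat_nat _ _ _ len) //= [X in (_ + X)%R]big1_seq ?addr0 //.
    by move=> r /andP[_]; rewrite mem_index_iota => /andP[h _]; apply: x0.
  - have : w <= N * (150 + 41 * len) + 8.
      by apply: leq_trans hw _; rewrite sum_nat_const card_ord leq_add ?leq_mul //=; lia.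
    have : N * (150 + 41 * len) <= Lam * (150 + 41 * len) by rewrite leq_mul2r NLam orbT.
    by move=> h1 h2; apply: leq_trans (_ : 2 + (Lam * (150 + 41 * len) + 8) <= _); [lia|nia].
  - by have : N * 150 <= Lam * 150 by [rewrite leq_mul2r NLam orbT]; move: hd => /=; lia.
Qed.

End Program.

(** * Parallel loops over the incidences of sets and elements *)

Lemma ok_weak (Rd Rd' : loc -> Prop) s e :
  (forall l, Rd l -> Rd' l) -> ok Rd s e -> ok Rd' s e.
Proof.
move=> h; elim: e => //= [a e1 IH [/IH o1 [k Ek /h hk]]|o e1 IH1 e2 IH2 [/IH1 ? /IH2 ?]].
  by split=> //; exists k.
by [].
Qed.

(** The number of sets containing the element in register 7 is the count at the root of its tree:
    level register 4, node 0. *)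
Definition for_sets (c : com) : com :=
  ParFor 8 (Get 3 ((V 4 * V 3 + V 7) * V 3))
    (Assign 6 (Get 5 (V 7 * V 3 + V 8)) ;; c).

Definition for_entries (c : com) : com :=
  ParFor 6 (V 1) (ParFor 8 (Get 0 (V 6 + Lit 1) - Get 0 (V 6))
    (Assign 7 (Get 1 (Get 0 (V 6) + V 8)) ;; c)).

Definition any (_ : loc) : Prop := True.

Section Loops.

Variables B Z : nat.
Local Notation M := (cap Z).
Hypotheses (Z_ge8 : 8 <= Z) (B_ge : fits B M).
Local Notation wp := (wp B M).
Local Notation M_ge8 := (M_ge8 Z_ge8).
Local Notation Z_le_M := (Z_le_M Z_ge8).
Local Notation wpP k own Q wb db :=
  (@wp_par B M M_ge8 B_ge _ _ _ _ _ _ k own Q wb db).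
Local Notation wpA := (@wp_assign B M M_ge8 B_ge).

(** Ownership is indexed by the entries of the list and not by their positions, so that later
    disjointness arguments speak of sets and elements; this needs a list without repetition. *)
Lemma wp_parlist (Rd Wr : loc -> Prop) s rr x e e2 c (lst : seq nat)
    (own : nat -> loc -> Prop) (Q : nat -> state -> Prop) wb db :
  uniq lst -> expr_cost e <= 50 -> expr_cost e2 <= 50 ->
  ok Rd s e -> den s e = Posz (size lst) -> size lst <= M ->
  (forall y l, y \in lst -> own y l -> Wr l) ->
  (forall y y' l, y \in lst -> y' \in lst -> own y l -> own y' l -> y = y') ->
  (forall r, r < size lst ->
     [/\ ok (fun l => Rd l /\ forall y, y \in lst -> ~ own y l)
            (set_reg s rr (Posz r)) e2,
         den (set_reg s rr (Posz r)) e2 = Posz (nth 0 lst r) &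
         nth 0 lst r <= M]) ->
  (forall r y, r < size lst -> y = nth 0 lst r -> y \in lst ->
     wp (fun l => Rd l /\ forall y', y' \in lst -> own y' l -> y' = y) (own y)
        (set_reg (set_reg s rr (Posz r)) x (Posz y)) c
        (fun s' w d => [/\ Q y s', w <= wb & d <= db])) ->
  wp Rd Wr s (ParFor rr e (Assign x e2 ;; c)) (fun s' w d =>
    [/\ reg s' = reg s,
        forall y, y \in lst -> exists2 s1, Q y s1 &
          forall l, own y l -> heap s' l = heap s1 l,
        forall l, (forall y, y \in lst -> ~ own y l) -> heap s' l = heap s l,
        w <= (expr_cost e).+1 + size lst * (wb + (expr_cost e2).+2)
      & d <= (expr_cost e).+1 + (db + (expr_cost e2).+2)]).
Proof.
move=> ulst ce ce2 oke Ee sM hW disj he2 body.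
apply: wp_mono.
  apply: (wpP (size lst) (fun r => own (nth 0 lst r)) (fun r => Q (nth 0 lst r))
    (fun _ => wb + (expr_cost e2).+1) (db + (expr_cost e2).+1)) => //.
  - by move=> r l rs; apply: hW; apply: mem_nth.
  - move=> r r' l rs rs' o o'; apply/eqP; rewrite -(nth_uniq 0 rs rs' ulst).
    by apply/eqP; apply: disj o o'; apply: mem_nth.
  - move=> r rs; have [ok2 d2 n2] := he2 r rs.
    apply: wp_seq; apply: wpA; rewrite ?d2 //.
      apply: ok_weak ok2 => l [Rl no]; split=> // r' r's o.
      by case: (no (nth 0 lst r')) => //; apply: mem_nth.
    apply: (wp_use (body r _ rs erefl (mem_nth 0 rs))) => //.
      move=> l [Rl own1]; split=> // r' r's o'.
      apply/eqP; rewrite -(nth_uniq 0 r's rs ulst); apply/eqP.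
      by apply: own1 => //; apply: mem_nth.
    by move=> s' w d _ [q hw hd] _ _; split=> //; lia.
move=> s' w d [er hth hun hw hd]; split=> //.
- by move=> y ylst; have := hth (index y lst); rewrite index_mem nth_index //; apply.
- move=> l no; apply: hun => r rs; apply: no; exact: mem_nth.
- by move: hw; rewrite sum_nat_const card_ord -[(wb + _).+1]addnS.
- by move: hd; rewrite -[(db + _).+1]addnS.
Qed.

Variable sets : seq (seq nat).
Local Notation m := (size sets).

Hypotheses (sets_uniq : forall i, uniq (nth [::] sets i)).
Hypotheses (sets_lt : forall i j, inS sets i j -> j < Z).
Hypotheses (sets_size : forall i, size (nth [::] sets i) <= Z).
Hypothesis m_lt : m < Z.

Definition linked (ell : nat) (s : state) : Prop :=
  [/\ reg s 3 = Posz Z, reg s 4 = Posz ell,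
      forall j, j < Z -> heap s (3, (ell * Z + j) * Z) = Posz (size (sel sets j)) &
      forall j r, j < Z -> r < size (sel sets j) ->
        heap s (5, j * Z + r) = Posz (nth 0 (sel sets j) r)].

Lemma size_sel_le j : size (sel sets j) <= m.
Proof. by rewrite size_filter (leq_trans (count_size _ _)) // size_iota. Qed.

Lemma wp_for_sets ell (Rd Wr : loc -> Prop) s c j
    (own : nat -> loc -> Prop) (Q : nat -> state -> Prop) wb db :
  linked ell s -> reg s 7 = Posz j -> j < Z ->
  (forall l, l.1 = 3 \/ l.1 = 5 -> Rd l) ->
  (forall i l, own i l -> l.1 != 3 /\ l.1 != 5) ->
  (forall i l, inS sets i j -> own i l -> Wr l) ->
  (forall i i' l, inS sets i j -> inS sets i' j -> own i l -> own i' l -> i = i') ->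
  (forall r i, r < size (sel sets j) -> i = nth 0 (sel sets j) r -> inS sets i j ->
     wp (fun l => Rd l /\ forall i', inS sets i' j -> own i' l -> i' = i) (own i)
        (set_reg (set_reg s 8 (Posz r)) 6 (Posz i)) c
        (fun s' w d => [/\ Q i s', w <= wb & d <= db])) ->
  wp Rd Wr s (for_sets c) (fun s' w d =>
    [/\ reg s' = reg s,
        forall i, inS sets i j -> exists2 s1, Q i s1 &
          forall l, own i l -> heap s' l = heap s1 l,
        forall l, (forall i, inS sets i j -> ~ own i l) -> heap s' l = heap s l,
        w <= 10 + size (sel sets j) * (wb + 10)
      & d <= 20 + db]).
Proof.
move=> [r3 r4 hc hl] r7 jZ hR hown hW disj body.
have memE i : (i \in sel sets j) = inS sets i j by exact: mem_sel.
have sM := leq_trans (size_sel_le j) (leq_trans (ltnW m_lt) Z_le_M).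
apply: wp_mono.
  apply: (@wp_parlist Rd Wr s 8 6 _ _ c (sel sets j) own Q wb db) => //=.
  - exact: sel_uniq.
  - split=> //; rewrite r4 r3 r7; exists ((ell * Z + j) * Z) => //.
    by apply: hR; left.
  - by rewrite r4 r3 r7 -!PoszM /= hc.
  - by move=> i l; rewrite memE; apply: hW.
  - by move=> i i' l; rewrite !memE; apply: disj.
  - move=> r rs; rewrite r3 r7 /= hl //; split=> //.
      split=> //; exists (j * Z + r) => //; split; first by apply: hR; right.
      by move=> y _ /hown[].
    have := mem_nth 0 rs; rewrite memE => /inS_lt h.
    by apply: leq_trans (ltnW (ltn_trans h m_lt)) Z_le_M.
  - move=> r y rs ey; rewrite memE => yj.
    apply: (wp_use (body r y rs ey yj)) => //.
    by move=> l [Rl o1]; split=> // y'; rewrite memE; apply: o1.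
move=> s' w d [er hth hun hw hd]; split=> //.
- by move=> i; rewrite -memE; apply: hth.
- by move=> l no; apply: hun => i; rewrite memE; apply: no.
- by move: hw => /= hw; lia.
- by move: hd => /= hd; lia.
Qed.

Definition has_input (s : state) : Prop :=
  [/\ reg s 1 = Posz m,
      forall i, i <= m -> heap s (0, i) = Posz (offset sets i) &
      forall i r, i < m -> r < size (nth [::] sets i) ->
        heap s (1, offset sets i + r) = Posz (nth 0 (nth [::] sets i) r)].

(** Each incidence has its own cells; the outer thread of a set owns those of all its elements, and
    the two nested loops are race free for the same reason. *)
Lemma wp_for_entries s c (own : nat -> nat -> loc -> Prop)
    (Q : nat -> nat -> state -> Prop) wb db :
  has_input s ->
  (forall i j l, own i j l -> l.1 != 0 /\ l.1 != 1) ->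
  (forall i j i' j' l, inS sets i j -> inS sets i' j' ->
     own i j l -> own i' j' l -> i = i' /\ j = j') ->
  (forall i j r, inS sets i j ->
     wp (fun l => forall i' j', inS sets i' j' -> own i' j' l -> i' = i /\ j' = j)
        (own i j)
        (set_reg (set_reg (set_reg s 6 (Posz i)) 8 (Posz r)) 7 (Posz j)) c
        (fun s' w d => [/\ Q i j s', w <= wb & d <= db])) ->
  wp any any s (for_entries c) (fun s' w d =>
    [/\ reg s' = reg s,
        forall i j, inS sets i j -> exists2 s1, Q i j s1 &
          forall l, own i j l -> heap s' l = heap s1 l,
        forall l, (forall i j, inS sets i j -> ~ own i j l) -> heap s' l = heap s l,
        w <= 20 * m.+1 + sumn (shape sets) * (wb + 10)
      & d <= 30 + db]).
Proof.
move=> [r1 h0 h1] hown disj body.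
apply: wp_mono.
  apply: (wpP m (fun i l => exists2 j, inS sets i j & own i j l)
    (fun i s2 => forall j, inS sets i j -> exists2 s1, Q i j s1 &
          forall l, own i j l -> heap s2 l = heap s1 l)
    (fun i => 12 + size (nth [::] sets i) * (wb + 8)) (20 + db)) => //=.
  - exact: leq_trans (ltnW m_lt) Z_le_M.
  - move=> i i' l _ _ [j ij o] [j' ij' o'].
    by have [] := disj _ _ _ _ _ ij ij' o o'.
  - move=> i im.
    have h0' k l : k <= m -> l = (0, k) -> any l /\
        (forall i', i' < m -> (exists2 j, inS sets i' j & own i' j l) -> i' = i).
      by move=> km ->; split=> // i' _ [j _ /hown[]].
    apply: wp_mono.
      apply: (@wp_parlist _ _ _ 8 7 _ _ c (nth [::] sets i) (own i) (Q i) wb db) => //=.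
      + split; split=> //.
          by exists (i + 1) => //; apply: (h0' (i + 1)) => //; rewrite addn1.
        by exists i => //; apply: (h0' i) => //; apply: ltnW.
      + by rewrite !h0 ?addn1 //=; [rewrite offsetS; lia|apply: ltnW].
      + exact: leq_trans (sets_size i) Z_le_M.
      + by move=> j l ij o; exists j.
      + move=> j j' l ij ij' o o'.
        by have [] := disj _ _ _ _ _ (ij : inS sets i j) ij' o o'.
      + move=> r rs; rewrite h0 /=; last exact: ltnW.
        rewrite h1 //; split=> //.
          split; first split=> //.
            split=> //; exists i => //; split; first by apply: (h0' i) => //; apply: ltnW.
            by move=> y _ /hown[].
          exists (offset sets i + r) => //; split.
            by split=> // i' _ [j _ /hown[]].
          by move=> y _ /hown[].
        by apply: leq_trans Z_le_M; apply/ltnW/(@sets_lt i); apply: mem_nth.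
      + move=> r j rs ej ij; apply: (wp_use (body i j r ij)) => //.
        move=> l o; split; first by split=> // i' _ [j' ij' o']; have [] := o i' j' ij' o'.
        by move=> j' ij' o'; have [] := o i j' ij' o'.
    move=> s' w d [er hth _ hw hd]; split=> //; first by move: hw => /=; lia.
    by move: hd => /=; lia.
move=> s' w d [er hth hun hw hd]; split=> //.
- move=> i j ij; have [s2 hs2 e2] := hth i (inS_lt ij).
  have [s1 q e1] := hs2 j ij; exists s1 => // l o.
  by rewrite e2 ?e1 //; exists j.
- by move=> l no; apply: hun => i im [j ij]; apply: no.
- apply: leq_trans hw _; rewrite /=.
  rewrite (eq_bigr (fun i : 'I_m => 13 + size (nth [::] sets i) * (wb + 8))) //.
  rewrite big_split sum_nat_const card_ord -big_distrl /=.
  have -> : \sum_(i < m) size (nth [::] sets i) = sumn (shape sets).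
    by rewrite sumnE big_map (big_nth [::]) big_mkord.
  by nia.
- by move: hd => /=; lia.
Qed.

End Loops.

(* The sets i with rank 0 in their node are its representatives: they write the
   count of the parent, so that each node is written once. *)
Definition up_level : com :=
  Assign 21 (V 6 / (Lit 2 * V 5)) ;;
  (If ((V 6 / V 5) %% Lit 2)
     (Store 4 (V 6 * V 3 + V 7)
        (Get 4 (V 6 * V 3 + V 7) + Get 3 ((V 4 * V 3 + V 7) * V 3 + V 21 * Lit 2)))
     Skip ;;
   If (Get 4 (V 6 * V 3 + V 7)) Skip
     (Store 3 (((V 4 + Lit 1) * V 3 + V 7) * V 3 + V 21)
        (Get 3 ((V 4 * V 3 + V 7) * V 3 + V 21 * Lit 2)
         + Get 3 ((V 4 * V 3 + V 7) * V 3 + V 21 * Lit 2 + Lit 1)))).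

(** Row-major addresses determine row and column; race freedom on the matrices rests on this. *)
Lemma idx_inj Z a b a' b' : b < Z -> b' < Z ->
  a * Z + b = a' * Z + b' -> a = a' /\ b = b'.
Proof.
move=> bZ b'Z e; have Z0 : 0 < Z by lia.
split; first by have := congr1 (divn^~ Z) e; rewrite !divnMDl // !divn_small // !addn0.
by have := congr1 (modn^~ Z) e; rewrite !modnMDl !modn_small.
Qed.

Definition natE := (=^~ PoszM, =^~ PoszD).

(** * Transposing the incidence lists level by level *)

Section Transpose.

Variables B Z : nat.
Local Notation M := (cap Z).
Hypotheses (Z_ge8 : 8 <= Z) (B_ge : fits B M).
Local Notation wp := (wp B M).
Local Notation M_ge8 := (M_ge8 Z_ge8).
Local Notation Z_le_M := (Z_le_M Z_ge8).
Local Notation wpA := (@wp_assign B M M_ge8 B_ge).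
Local Notation wpS k := (@wp_store B M M_ge8 B_ge _ _ _ _ _ _ k).
Local Notation wpIf := (@wp_if B M M_ge8 B_ge).

Variable sets : seq (seq nat).
Local Notation m := (size sets).

Hypotheses (sets_uniq : forall i, uniq (nth [::] sets i)).
Hypotheses (sets_lt : forall i j, inS sets i j -> j < Z).
Hypotheses (sets_size : forall i, size (nth [::] sets i) <= Z).
Hypothesis m_lt : 2 * m < Z.

(** Zeros above the current level make empty nodes correct although nobody writes them. The leaves
    are kept in the invariant because they form the incidence matrix, which the first stage reads as
    its coefficients. *)
Definition level_heap (h : nat) (s : state) : Prop :=
  [/\ forall j v, j < Z -> v < Z ->
        heap s (3, (h * Z + j) * Z + v) = Posz (node_count sets h j v),
      forall h' j v, h < h' -> j < Z -> v < Z -> heap s (3, (h' * Z + j) * Z + v) = 0%R,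
      forall j v, j < Z -> v < Z -> heap s (3, j * Z + v) = Posz (inS sets v j) &
      forall i j, inS sets i j -> heap s (4, i * Z + j) = Posz (node_rank sets h i j)].

Definition level_own (h i j : nat) (l : loc) : Prop :=
  l = (4, i * Z + j) \/
  (l = (3, ((h + 1) * Z + j) * Z + i %/ 2 ^ h.+1) /\ node_rank sets h.+1 i j = 0).

Lemma node_count_le h j v : node_count sets h j v <= m.
Proof. by rewrite /node_count (leq_trans (count_size _ _)) // size_iota. Qed.

Lemma node_rank_le h i j : node_rank sets h i j <= i.
Proof. by rewrite /node_rank (leq_trans (count_size _ _)) // size_iota. Qed.

Lemma wp_up_level_thread h i j r s :
  level_heap h s -> reg s 3 = Posz Z -> reg s 4 = Posz h -> reg s 5 = Posz (2 ^ h) ->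
  inS sets i j ->
  wp (fun l => forall i' j', inS sets i' j' -> level_own h i' j' l -> i' = i /\ j' = j)
     (level_own h i j)
     (set_reg (set_reg (set_reg s 6 (Posz i)) 8 (Posz r)) 7 (Posz j)) up_level
     (fun s' w d => [/\
       heap s' (4, i * Z + j) = Posz (node_rank sets h.+1 i j) /\
       (node_rank sets h.+1 i j = 0 ->
        heap s' (3, ((h + 1) * Z + j) * Z + i %/ 2 ^ h.+1)
          = Posz (node_count sets h.+1 j (i %/ 2 ^ h.+1))),
       w <= 100 & d <= 100]).
Proof.
move=> [hc _ _ hr] r3 r4 r5 ij.
have im := inS_lt ij; have jZ := sets_lt ij; have ZM := Z_le_M.
set u := i %/ 2 ^ h.+1.
have uE : u = i %/ 2 ^ h %/ 2 by rewrite /u expnSr divnMA.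
have ui : u * 2 <= i %/ 2 ^ h by rewrite uE leq_divM.
have vi : i %/ 2 ^ h <= i by exact: leq_div.
have rd4 i' j' : inS sets i' j' -> level_own h i' j' (4, i * Z + j) -> i' = i /\ j' = j.
  move=> i'j' [[] e|[] //].
  by have [-> ->] := idx_inj jZ (sets_lt i'j') e.
(* Tree cells of level h can be read freely: the only tree cells with owners are those of level
   [h + 1], so this hypothesis is contradictory. *)
have rd3 c i' j' : c < Z -> inS sets i' j' ->
    level_own h i' j' (3, (h * Z + j) * Z + c) -> i' = i /\ j' = j.
  move=> cZ i'j' [//|[[] e _]].
  have i'm := inS_lt i'j'; have := leq_div i' (2 ^ h.+1) => le.
  have i'Z : i' %/ 2 ^ h.+1 < Z by lia.
  have [e' _] := idx_inj cZ i'Z e.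
  by have [e2 _] := idx_inj jZ (sets_lt i'j') e'; lia.
have rkS := node_rankS h j im.
have cS := node_countS sets h j u.
have rk_lt := node_rank_le h.+1 i j.
have c_lt := node_count_le h.+1 j u.
have rk_lt0 := node_rank_le h i j.
pose s0 := set_reg (set_reg (set_reg s 6 (Posz i)) 8 (Posz r)) 7 (Posz j).
apply: wp_seq; apply: wpA; rewrite //= r5.
  by rewrite -PoszM -expnS divz_nat -/u /=; lia.
rewrite -PoszM -expnS divz_nat -/u.
(* The second conditional is reached from both branches of the first, with the rank already lifted
   to level [h + 1]. *)
have last_part s2 : reg s2 = reg (set_reg s0 21 (Posz u)) ->
    (forall l, l.1 = 3 -> heap s2 l = heap s l) ->
    heap s2 (4, i * Z + j) = Posz (node_rank sets h.+1 i j) ->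
  wp (fun l => forall i' j', inS sets i' j' -> level_own h i' j' l -> i' = i /\ j' = j)
     (level_own h i j) s2
     (If (Get 4 (V 6 * V 3 + V 7)) Skip
     (Store 3 (((V 4 + Lit 1) * V 3 + V 7) * V 3 + V 21)
        (Get 3 ((V 4 * V 3 + V 7) * V 3 + V 21 * Lit 2)
         + Get 3 ((V 4 * V 3 + V 7) * V 3 + V 21 * Lit 2 + Lit 1))))
     (fun s' w d => [/\
       heap s' (4, i * Z + j) = Posz (node_rank sets h.+1 i j) /\
       (node_rank sets h.+1 i j = 0 ->
        heap s' (3, ((h + 1) * Z + j) * Z + i %/ 2 ^ h.+1)
          = Posz (node_count sets h.+1 j (i %/ 2 ^ h.+1))),
       w <= 50 & d <= 50]).
  move=> er e3 e4; have e3' k : heap s2 (3, k) = heap s (3, k) by apply: e3.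
  apply: wpIf => //=.
  - by rewrite er /= r3; split=> //; exists (i * Z + j).
  - rewrite er /= r3 e4 => n0; apply: wp_skip; split=> //; split=> // rk0.
    by rewrite rk0 in n0.
  - rewrite er /= r3 e4 => -[rk0].
    apply: (wpS (((h + 1) * Z + j) * Z + u)); rewrite //= ?er /= ?r3 ?r4.
    + split; split=> //.
        by exists ((h * Z + j) * Z + u * 2) => // i' j'; apply: rd3; lia.
      exists ((h * Z + j) * Z + (u * 2).+1) => [|i' j']; last by apply: rd3; lia.
      by rewrite addnS -[(_ + u * 2).+1]addn1.
    + by rewrite -PoszD addn1.
    + by right.
    + rewrite ?natE /= -!addnA ?addn1 !e3' !hc; try lia.
    rewrite ?natE -/u eqxx; split=> //; split=> // _.
    by rewrite -addnA addn1 /= !e3' !hc ?cS //; lia.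
have cE : heap s (3, (h * Z + j) * Z + u * 2) = Posz (node_count sets h j (u * 2)).
  by apply: hc => //; lia.
(* For a right child the left sibling is the node [2 u], which is the cell that is added to the
   rank. *)
have vE : i %/ 2 ^ h = u * 2 + odd (i %/ 2 ^ h) by rewrite uE -{1}(odd_double_half (i %/ 2 ^ h)) -divn2; lia.
apply: wp_seq; apply: wpIf => //=.
- rewrite r5 divz_nat modz_nat modn2 eqz_nat eqb0 negbK => od.
  rewrite od in vE rkS; rewrite vE addn1 in rkS.
  apply: (wpS (i * Z + j)); rewrite //= ?r3 ?r4.
  + split; split=> //; first by exists (i * Z + j).
    by exists ((h * Z + j) * Z + u * 2) => // i' j'; apply: rd3; lia.
  + by [].
  + by left.
  + by rewrite ?natE /= hr // cE; have := node_count_le h j (u * 2); lia.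
  rewrite ?natE /=.
  apply: (wp_use (last_part _ _ _ _)) => //=.
  + by case=> [a k] /= ->.
  + by rewrite eqxx hr // cE rkS.
  by move=> s' w d _ [hs hw hd] _ _; split=> //; lia.
rewrite r5 divz_nat modz_nat modn2 => -[] od.
have {}od : odd (i %/ 2 ^ h) = false by case: odd od.
apply: wp_skip.
apply: (wp_use (last_part _ _ _ _)) => //=.
+ by rewrite hr // rkS od addn0.
by move=> s' w d _ [hs hw hd] _ _; split=> //; lia.
Qed.

End Transpose.

Definition transpose : com :=
  for_entries (Store 3 (V 7 * V 3 + V 6) (Lit 1)) ;;
  (Assign 4 (Lit 0) ;; (Assign 5 (Lit 1) ;;
  (While (V 5 <= V 1) (for_entries up_level ;;
     (Assign 4 (V 4 + Lit 1) ;; Assign 5 (Lit 2 * V 5))) ;;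
  for_entries (Store 5 (V 7 * V 3 + Get 4 (V 6 * V 3 + V 7)) (V 6))))).

Section Transpose.

Variables B Z : nat.
Local Notation M := (cap Z).
Hypotheses (Z_ge8 : 8 <= Z) (B_ge : fits B M).
Local Notation wp := (wp B M).
Local Notation M_ge8 := (M_ge8 Z_ge8).
Local Notation Z_le_M := (Z_le_M Z_ge8).
Local Notation wpA := (@wp_assign B M M_ge8 B_ge).
Local Notation wpS k := (@wp_store B M M_ge8 B_ge _ _ _ _ _ _ k).
Local Notation wpW I N wc dc := (@wp_while B M M_ge8 B_ge _ _ _ _ _ I N wc dc).

Variable sets : seq (seq nat).
Local Notation m := (size sets).

Hypotheses (sets_uniq : forall i, uniq (nth [::] sets i)).
Hypotheses (sets_lt : forall i j, inS sets i j -> j < Z).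
Hypotheses (sets_size : forall i, size (nth [::] sets i) <= Z).
Hypothesis m_lt : 2 * m < Z.

Variable Lam : nat.
Hypothesis Z_lt : log_bound Z Lam.

Let m_ltZ : m < Z. Proof. by lia. Qed.

Local Notation wpE s c own Q wb db :=
  (@wp_for_entries B Z Z_ge8 B_ge sets sets_uniq sets_lt sets_size m_ltZ s c own Q wb db).

Lemma node_count_gt0 h i j : inS sets i j -> 0 < node_count sets h j (i %/ 2 ^ h).
Proof.
move=> ij; rewrite /node_count -has_count; apply/hasP; exists i; last by rewrite eqxx.
by rewrite mem_iota /= add0n; apply: inS_lt ij.
Qed.

Lemma has_input_frame s s' : reg s' 1 = reg s 1 ->
  (forall l, l.1 <= 1 -> heap s' l = heap s l) -> has_input sets s -> has_input sets s'.
Proof.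
move=> e1 eh [h1 h2 h3]; split; first by rewrite e1.
- by move=> i im; rewrite eh // h2.
- by move=> i r im rs; rewrite eh // h3.
Qed.

(** A node of the new level is written by its unique representative if it is nonempty; these are
    exactly the nodes whose count is not 0. *)
Lemma wp_up_pass h s :
  level_heap Z sets h s -> has_input sets s ->
  reg s 3 = Posz Z -> reg s 4 = Posz h -> reg s 5 = Posz (2 ^ h) ->
  wp any any s (for_entries up_level) (fun s' w d =>
    [/\ level_heap Z sets h.+1 s', reg s' = reg s,
        forall l, l.1 \notin [:: 3; 4] -> heap s' l = heap s l,
        w <= 20 * m.+1 + sumn (shape sets) * 110 & d <= 130]).
Proof.
move=> lh hi r3 r4 r5; have [hc hz h0 hr] := lh.
apply: wp_mono.
  apply: (wpE s up_level (level_own Z sets h) (fun i j s' =>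
      heap s' (4, i * Z + j) = Posz (node_rank sets h.+1 i j) /\
       (node_rank sets h.+1 i j = 0 ->
        heap s' (3, ((h + 1) * Z + j) * Z + i %/ 2 ^ h.+1)
          = Posz (node_count sets h.+1 j (i %/ 2 ^ h.+1)))) 100 100) => //.
  - by move=> i j l [->|[-> _]].
  - move=> i j i' j' l ij i'j' [->|[-> rk]] [|[]] //.
    + by case=> e; apply: idx_inj (sets_lt ij) (sets_lt i'j') e.
    + move=> [e] rk'; have := leq_div i (2 ^ h.+1); have := leq_div i' (2 ^ h.+1).
      have im := inS_lt ij; have i'm := inS_lt i'j' => le le'.
      have lt : i %/ 2 ^ h.+1 < Z by lia.
      have lt' : i' %/ 2 ^ h.+1 < Z by lia.
      have [e1 e2] := idx_inj lt lt' e.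
      have [_ ej] := idx_inj (sets_lt ij) (sets_lt i'j') e1; subst j'.
      by split=> //; apply: node_rank_inj ij i'j' e2 rk rk'.
  - by move=> i j r ij; apply: wp_up_level_thread.
move=> s' w d [er hth hun hw hd]; split=> //.
- split.
  + move=> j v jZ vZ.
    have [c0|] := posnP (node_count sets h.+1 j v).
      rewrite c0 hun ?hz ?addn1 //.
      move=> i j' ij' [//|[[]]]; rewrite !addn1 => e rk.
      have := leq_div i (2 ^ h.+1); have im := inS_lt ij' => le.
      have lt : i %/ 2 ^ h.+1 < Z by lia.
      have [e1 e2] := idx_inj vZ lt e.
      have [_ ej] := idx_inj jZ (sets_lt ij') e1; subst j' v.
      by have := node_count_gt0 h.+1 ij'; rewrite c0.
    move=> /node_rank_ex[i [ij <- rk]].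
    have [s1 [_ e1] e2] := hth i j ij.
    by rewrite e2 -?(e1 rk) ?addn1 //; right; rewrite addn1.
  + move=> h' j v hh' jZ vZ; rewrite hun; first by apply: hz => //; exact: ltnW.
    move=> i j' ij' [//|[[] e rk]].
    have := leq_div i (2 ^ h.+1); have im := inS_lt ij' => le.
    have lt : i %/ 2 ^ h.+1 < Z by lia.
    have [e1 e2] := idx_inj vZ lt e.
    by have [e3 _] := idx_inj jZ (sets_lt ij') e1; lia.
  + move=> j v jZ vZ; rewrite hun ?h0 //.
    move=> i j' ij' [//|[[] e rk]].
    have := leq_div i (2 ^ h.+1); have im := inS_lt ij' => le.
    have lt : i %/ 2 ^ h.+1 < Z by lia.
    have [e1 e2] := idx_inj vZ lt e.
    by have [e3 _] := @idx_inj Z 0 j (h + 1) j' jZ (sets_lt ij') e1; lia.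
  + move=> i j ij; have [s1 [e1 _] e2] := hth i j ij.
    by rewrite e2 ?e1 //; left.
- move=> l nl; apply: hun => i j _ [e|[e _]]; by rewrite e in nl.
Qed.

(** Both bounds on the height are exported: [m < 2 ^ ell] makes [ell] large enough for the
    discrepancy estimate, and [2 ^ k <= m] below it keeps it [O(log m)]. *)
Lemma wp_transpose s :
  has_input sets s -> reg s 3 = Posz Z ->
  (forall l, l.1 \in [:: 3; 4; 5] -> heap s l = 0%R) ->
  wp any any s transpose (fun s' w d => exists ell,
    [/\ linked Z sets ell s',
        m < 2 ^ ell /\ (forall k, k < ell -> 2 ^ k <= m),
        forall j v, j < Z -> v < Z -> heap s' (3, j * Z + v) = Posz (inS sets v j),
        forall l, l.1 \notin [:: 3; 4; 5] -> heap s' l = heap s l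
      & w <= 1000 * Lam.+1 * (m.+1 + sumn (shape sets)) /\ d <= 1000 * Lam.+1]).
Proof.
move=> hi r3 hz.
apply: wp_seq; apply: wp_mono.
  apply: (wpE s _ (fun i j l => l = (3, j * Z + i))
    (fun i j s1 => heap s1 (3, j * Z + i) = 1%R) 20 20) => //.
  - by move=> i j l ->.
  - move=> i j i' j' l ij i'j' -> [e].
    have im := inS_lt ij; have i'm := inS_lt i'j'.
    by have [-> ->] := idx_inj (ltn_trans im m_ltZ) (ltn_trans i'm m_ltZ) e.
  - move=> i j r ij; apply: (wpS (j * Z + i)); rewrite //= ?r3 //=.
    + by have := Z_le_M; lia.
    + by split=> //; rewrite eqxx.
move=> s1 w1 d1 [er1 hth1 hun1 hw1 hd1].
have lh1 : level_heap Z sets 0 s1.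
  have lv0 j v : j < Z -> v < Z -> heap s1 (3, j * Z + v) = Posz (inS sets v j).
    move=> jZ vZ; case: (boolP (inS sets v j)) => [vj|nvj].
      by have [s2 e1 e2] := hth1 v j vj; rewrite e2.
    rewrite hun1 ?hz // => i' j' i'j' [e].
    have [ej ei] := idx_inj vZ (ltn_trans (inS_lt i'j') m_ltZ) e.
    by rewrite ej ei i'j' in nvj.
  split=> //.
  - by move=> j v jZ vZ; rewrite mul0n add0n lv0 // node_count0.
  - move=> h' j v h'0 jZ vZ; rewrite hun1 ?hz // => i' j' i'j' [e].
    have [e1 _] := idx_inj vZ (ltn_trans (inS_lt i'j') m_ltZ) e.
    have [e2 _] := @idx_inj Z h' j 0 j' jZ (sets_lt i'j') e1.
    by rewrite e2 in h'0.
  - by move=> i j ij; rewrite node_rank0 hun1 ?hz // => i' j' _.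
have hi1 : has_input sets s1.
  apply: has_input_frame hi; rewrite ?er1 // => l l1; apply: hun1 => i j _ e.
  by rewrite e in l1.
(* The loop runs while [2 ^ h <= m], so its end is bracketed by [m + 1] rather than m. *)
have [ell [mell ell_lt ellLam]] : exists N, [/\ m.+1 <= 2 ^ N,
    forall k, k < N -> 2 ^ k < m.+1 & N <= Lam].
  by apply: (pow2_bracket_le Z_lt).
apply: wp_seq; apply: wpA => //=.
apply: wp_seq; apply: wpA => //=; first by have := Z_le_M; lia.
set s2 := set_reg _ _ _.
pose I k s3 := [/\ level_heap Z sets k s3, has_input sets s3,
  [/\ reg s3 3 = Posz Z, reg s3 4 = Posz k & reg s3 5 = Posz (2 ^ k)] &
  forall l, l.1 \notin [:: 3; 4] -> heap s3 l = heap s1 l].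
apply: wp_seq; apply: wp_mono.
  apply: (wpW I ell (fun _ => 20 * m.+1 + sumn (shape sets) * 110 + 20) 160) => //=.
  - move=> k s3 kell [lh3 hi3 [e3 e4 e5] hf3]; have [e1 _ _] := hi3.
    split; first by rewrite e1 e5 lez_nat (ell_lt k kell : 2 ^ k <= m).
    apply: wp_seq; apply: wp_mono; first exact: wp_up_pass lh3 hi3 e3 e4 e5.
    move=> s4 w4 d4 [lh4 er4 hf4 hw4 hd4].
    have km : 2 ^ k <= m by exact: ell_lt.
    have kZ : k < Z by apply: leq_ltn_trans m_ltZ; apply: leq_trans km; apply: ltnW; apply: ltn_expl.
    apply: wp_seq; apply: wpA; rewrite //= er4 e4.
      by have := Z_le_M; rewrite /=; lia.
    apply: wpA; rewrite //= er4 e5.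
      by have := Z_le_M; rewrite natE /=; lia.
    split; last by move: hd4; lia.
      split=> //.
      + apply: has_input_frame hi3; rewrite /= ?er4 // => l l1; apply: hf4.
        by case: l l1 => [[|[|a]] x].
      + by rewrite /= er4 e3 !natE expnS addn1.
      + by move=> l nl; rewrite /= hf4 // hf3.
    by move: hw4; lia.
  - move=> s3 [_ [e1 _ _] [_ _ e5] _]; rewrite e1 e5 lez_nat leqNgt.
    by rewrite mell.
  - split=> //; first by rewrite /= er1 r3.
move=> s3 w3 d3 [[[hc3 hz3 h03 hr3] hi3 [e3 e4 e5] hf3] hw3 hd3].
have rkE i j : inS sets i j -> node_rank sets ell i j = index i (sel sets j).
  by move=> ij; apply: node_rank_root => //; apply: ltnW.
apply: wp_mono.
  apply: (wpE s3 _ (fun i j l => l = (5, j * Z + index i (sel sets j)))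
    (fun i j s1 => heap s1 (5, j * Z + index i (sel sets j)) = Posz i) 20 20) => //.
  - by move=> i j l ->.
  - move=> i j i' j' l ij i'j' -> [e].
    have lt i0 j0 : inS sets i0 j0 -> index i0 (sel sets j0) < Z.
      by move=> ij0; rewrite -rkE //; have := node_rank_le sets ell i0 j0;
         have := inS_lt ij0; lia.
    have [ej ei] := idx_inj (lt _ _ ij) (lt _ _ i'j') e; subst j'; split=> //.
    rewrite -(nth_index 0 (_ : i \in sel sets j)) ?mem_sel // ei nth_index //.
    by rewrite mem_sel.
  - move=> i j r ij; have im := inS_lt ij.
    apply: (wpS (j * Z + index i (sel sets j))); rewrite //= ?e3 ?natE /= ?hr3 ?rkE //.
    + by split=> //; split=> //; exists (i * Z + j).
    + by have := Z_le_M; lia.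
    + by split=> //; rewrite eqxx.
move=> s4 w4 d4 [er4 hth4 hun4 hw4 hd4]; exists ell; split.
- split; rewrite ?er4 //.
  + move=> j jZ; rewrite hun4 => [|i j' _ //].
    by rewrite -[(ell * Z + j) * Z]addn0 hc3 // ?node_count_root //; [apply: ltnW|lia].
  + move=> j r jZ rs; have := mem_nth 0 rs; rewrite mem_sel => ij.
    have [s5 e6 e7] := hth4 _ _ ij.
    by move: e6 e7; rewrite index_uniq ?sel_uniq // => e6 e7; rewrite e7.
- by [].
- by move=> j v jZ vZ; rewrite hun4 ?h03 // => i j' _.
- move=> l nl; rewrite hun4 => [|i j _ e]; last by rewrite e in nl.
  rewrite hf3 => [|]; last by apply: contra nl; rewrite !inE => /orP[->|->]; rewrite ?orbT.
  by apply: hun1 => i j _ e; rewrite e in nl.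
- move: hw3 hd3 hw1 hd1 hw4 hd4; rewrite sum_nat_const card_ord /=.
  set N := sumn (shape sets) => hw3 hd3 hw1 hd1 hw4 hd4.
  have h1 : ell * (20 * m.+1 + N * 110 + 30) <= Lam * (20 * m.+1 + N * 110 + 30).
    by rewrite leq_mul2r ellLam orbT.
  have h2 : ell * 200 <= Lam * 200 by rewrite leq_mul2r ellLam orbT.
  split; last by lia.
  have h3 : w3 <= Lam * (20 * m.+1 + N * 110 + 30) + 10.
    apply: leq_trans hw3 _; apply: leq_add => //.
    by apply: leq_trans h1; rewrite leq_mul2l; apply/orP; right; lia.
  nia.
Qed.

End Transpose.

(** * Learning rates and truncated coefficients *)

Definition arr (d k : nat) : nat := d * 10 + k.
Arguments arr : simpl never.

Definition get_rate (aC : nat) : com :=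
  Assign 13 (Lit 2) ;;
  While (V 13 * V 13 * V 17 <= Get aC (V 9 * V 3 + V 6)) (Assign 13 (Lit 2 * V 13)).

(** Register 14 keeps the full coefficient, which enters the recorded discrepancy; register 21 holds
    the truncated one, which drives the weights. The two comparisons are factors 0 or 1 testing
    [2 |a| <= L]. *)
Definition get_coef (aC aCoef : nat) : com :=
  get_rate aC ;; (Assign 14 (Get aCoef (V 10 * V 3 + V 6)) ;;
  Assign 21 (V 14 * (Lit 2 * V 14 <= V 13) * (Lit 0 - Lit 2 * V 14 <= V 13))).

(** Adding register 2 undoes the shift of the stored weights by b. A skipped set leaves the zero of
    fresh memory in the row to be summed. *)
Definition score_body (d aRep aC aCoef : nat) : com :=
  If (Get aRep (V 6 * V 3 + V 7)) Skip
    (get_coef aC aCoef ;;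
     Store (arr d 3) (V 7 * V 3 + V 8)
       ((V 21 * (Get (arr d 0) (V 9 * V 3 + V 6) + V 2)) / V 13
        + (Lit 0 - V 21 * (Get (arr d 1) (V 9 * V 3 + V 6) + V 2)) / V 13)).

Definition update_body (d aRep aC aCoef : nat) : com :=
  If (Get aRep (V 6 * V 3 + V 7)) Skip
    (get_coef aC aCoef ;;
     (Store (arr d 0) (V 9 * V 3 + V 6)
       (Get (arr d 0) (V 9 * V 3 + V 6)
        + (V 12 * V 21 * (Get (arr d 0) (V 9 * V 3 + V 6) + V 2)) / V 13 + Lit 1) ;;
     (Store (arr d 1) (V 9 * V 3 + V 6)
       (Get (arr d 1) (V 9 * V 3 + V 6)
        + (Lit 0 - V 12 * V 21 * (Get (arr d 1) (V 9 * V 3 + V 6) + V 2)) / V 13 + Lit 1) ;;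
     Store (arr d 2) (V 9 * V 3 + V 6)
       (Get (arr d 2) (V 9 * V 3 + V 6) + V 12 * V 14)))).

(* rate el c is the least L >= 2 that is a power of two with L^2 el > c. *)
Definition rate_exp (el c : nat) : nat :=
  find (fun N => c < (2 * 2 ^ N) ^ 2 * el) (iota 0 c.+1).

Definition rate (el c : nat) : nat := 2 * 2 ^ rate_exp el c.

Definition truncate (L : nat) (a : int) : int := if `|a| * 2 <= L then a else 0%R.

(** The search range of [rate_exp] is long enough: the exponent c already passes the test, as
    [c < 2 ^ c]. *)
Lemma rate_gt (el c : nat) : 0 < el -> c < rate el c ^ 2 * el.
Proof.
move=> el0; rewrite /rate /rate_exp; set p := fun N => _; set s := iota _ _.
have hs : has p s.
  apply/hasP; exists c; first by rewrite /s mem_iota add0n leqnn.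
  rewrite /p; have : c < 2 ^ c := ltn_expl c (isT : 1 < 2).
  by move: (2 ^ c) => x; nia.
have f_lt : find p s < c.+1 by rewrite -[c.+1](size_iota 0) -has_find.
by have := nth_find 0 hs; rewrite nth_iota // add0n.
Qed.

Lemma rate_exp_le (el c k : nat) : k < rate_exp el c -> (2 * 2 ^ k) ^ 2 * el <= c.
Proof.
move=> kN; have := before_find 0 kN; rewrite nth_iota ?add0n; first by lia.
by apply: leq_trans kN _; rewrite -[c.+1 in X in _ <= X](size_iota 0) find_size.
Qed.

(** By minimality: either no doubling took place, or [L / 2] failed the test, and [L ^ 2] is four
    times its square. *)
Lemma rate_sq (el c : nat) : rate el c = 2 \/ rate el c ^ 2 * el <= 4 * c.
Proof.
rewrite /rate; case E : (rate_exp el c) => [|N]; first by left; rewrite expn0.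
have := @rate_exp_le el c N; rewrite E => /(_ (leqnn _)) h; right.
by rewrite (expnS 2 N) (expnMn 2 (2 * 2 ^ N)) -mulnA leq_mul2l.
Qed.

Lemma rate_ge2 el c : 2 <= rate el c.
Proof. by rewrite /rate leq_pmulr // expn_gt0. Qed.

Section Stage.

Variables B Z : nat.
Local Notation M := (cap Z).
Hypotheses (Z_ge8 : 8 <= Z) (B_ge : fits B M).
Local Notation wp := (wp B M).
Local Notation M_ge8 := (M_ge8 Z_ge8).
Local Notation Z_le_M := (Z_le_M Z_ge8).
Local Notation wpA := (@wp_assign B M M_ge8 B_ge).
Local Notation wpS k := (@wp_store B M M_ge8 B_ge _ _ _ _ _ _ k).
Local Notation wpW I N wc dc := (@wp_while B M M_ge8 B_ge _ _ _ _ _ I N wc dc).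
Local Notation wpIf := (@wp_if B M M_ge8 B_ge).

Variable Lam : nat.
Hypothesis Z_lt : log_bound Z Lam.

Lemma wp_get_rate (Rd Wr : loc -> Prop) s aC kk i el c :
  reg s 3 = Posz Z -> reg s 6 = Posz i -> reg s 9 = Posz kk -> reg s 17 = Posz el ->
  heap s (aC, kk * Z + i) = Posz c -> 0 < el -> c < Z -> 4 * Z <= M ->
  Rd (aC, kk * Z + i) ->
  wp Rd Wr s (get_rate aC) (fun s' w d =>
    [/\ heap s' = heap s, reg s' 13 = Posz (rate el c),
        forall x, x != 13 -> reg s' x = reg s x,
        w <= 25 * Lam.+1 & d <= 25 * Lam.+1]).
Proof.
move=> r3 r6 r9 r17 hc el0 cZ ZM rd.
(* A round k that is executed has [(2 * 2 ^ k) ^ 2 * el <= c < Z < 2 ^ Lam]. *)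
have NLam : rate_exp el c <= Lam.
  rewrite leqNgt; apply/negP => /rate_exp_le h.
  by have := Z_lt; rewrite /log_bound; move: (2 ^ Lam) h => x; rewrite -mulnn; nia.
apply: (@wp_use _ _ Rd (fun _ => False) (fun s' w d =>
    [/\ reg s' 13 = Posz (rate el c), w <= 25 * Lam.+1 & d <= 25 * Lam.+1])) => //;
  last first.
- move=> s' w d _ [q1 q2 q3] hf hr; split=> //.
    by apply: funext => l; apply: hf.
  by move=> x x13; apply: hr; rewrite /= !inE negb_or x13.
apply: wp_seq; apply: wpA => //=; first by have := Z_le_M; lia.
apply: wp_mono.
  apply: (wpW (fun k s1 => [/\ reg s1 13 = Posz (2 * 2 ^ k),
      forall x, x != 13 -> reg s1 x = reg s x & heap s1 = heap s])
    (rate_exp el c) (fun _ => 5) 5) => //=.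
  - move=> k s1 _ [_ e1 e2]; split=> //; split=> //; rewrite !e1 // r3 r6 r9.
    by exists (kk * Z + i).
  - move=> k s1 kN [e0 e1 e2]; rewrite e0 !e1 // r3 r6 r9 r17 e2 /= hc.
    have le := rate_exp_le kN.
    split.
      by rewrite -!PoszM lez_nat mulnn le.
    apply: wpA; rewrite //= e0 -!PoszM /=.
      by apply: leq_trans ZM; move: (2 ^ k) le => x; rewrite -mulnn; nia.
    by split=> //; split=> //=; [rewrite -expnS|move=> x x13; rewrite (negPf x13) e1].
  - move=> s1 [e0 e1 e2]; rewrite e0 !e1 // r3 r6 r9 r17 e2 /= hc.
    by rewrite -!PoszM lez_nat leqNgt mulnn -/(rate el c) (rate_gt c el0).
  - by split=> // x /negPf ->.
move=> s' w d [[e0 _ _]]; rewrite sum_nat_const card_ord /= => hw hd.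
have : rate_exp el c * 20 <= Lam * 20 by rewrite leq_mul2r NLam orbT.
by split=> //; lia.
Qed.

Lemma wp_get_coef (Rd Wr : loc -> Prop) s aC aCoef kk g i el c a :
  reg s 3 = Posz Z -> reg s 6 = Posz i -> reg s 9 = Posz kk -> reg s 10 = Posz g ->
  reg s 17 = Posz el ->
  heap s (aC, kk * Z + i) = Posz c -> heap s (aCoef, g * Z + i) = a ->
  0 < el -> c < Z -> 4 * Z <= M ->
  Rd (aC, kk * Z + i) -> Rd (aCoef, g * Z + i) ->
  wp Rd Wr s (get_coef aC aCoef) (fun s' w d =>
    [/\ heap s' = heap s,
        [/\ reg s' 13 = Posz (rate el c), reg s' 14 = a &
            reg s' 21 = truncate (rate el c) a],
        forall x, x \notin [:: 13; 14; 21] -> reg s' x = reg s x,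
        w <= 25 * Lam.+1 + 40 & d <= 25 * Lam.+1 + 40]).
Proof.
move=> r3 r6 r9 r10 r17 hc ha el0 cZ ZM rc ra.
apply: wp_small => -[_ sh]; have aM : `|a| <= M by rewrite -ha.
apply: wp_seq; apply: wp_mono.
  exact: (@wp_get_rate Rd Wr s aC kk i el c).
move=> s1 w1 d1 [e1 e13 er hw1 hd1].
have tE : (a * Posz (2 * a <= Posz (rate el c))%R
     * Posz (0 - 2 * a <= Posz (rate el c))%R)%R = truncate (rate el c) a.
  rewrite /truncate; move: (rate el c) => L.
  by case: leqP; case: lerP; case: lerP => //=; lia.
apply: wp_seq; apply: wpA; rewrite //= ?er // ?r10 ?r3 ?r6 ?e1 ?ha //.
  by split=> //; exists (g * Z + i).
apply: wpA; rewrite //= ?e13 ?natE /= ?ha ?tE //.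
  by rewrite /truncate; case: ifP => _; lia.
split; rewrite /= ?e13 //.
- by move=> x; rewrite !inE !negb_or => /and3P[/negPf x13 /negPf -> /negPf ->];
    rewrite er ?x13.
- by lia.
- by lia.
Qed.

End Stage.

Lemma arr_eq d a c : (arr d a == arr d c) = (a == c).
Proof. by rewrite /arr eqn_add2l. Qed.

Lemma arr_min d k : arr d 0 <= arr d k.
Proof. by rewrite /arr leq_add2l. Qed.

Lemma absz_shift_le (w x : int) (p q b M : nat) : `|w| <= p -> `|x| <= q ->
  p + q + b < M -> absz (w + x + 1 - Posz b)%R <= M.
Proof. by lia. Qed.

Lemma absz_add_le (w x : int) (p q M : nat) : `|w| <= p -> `|x| <= q ->
  p + q <= M -> absz (w + x)%R <= M.
Proof. by lia. Qed.

Ltac ok_split := repeat match goal with |- _ /\ _ => split end; try done.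

(** * One set at one element: score and update *)

Section Thread.

Variables B Z : nat.
Local Notation M := (cap Z).
Hypotheses (Z_ge8 : 8 <= Z) (B_ge : fits B M).
Local Notation wp := (wp B M).
Local Notation M_ge8 := (M_ge8 Z_ge8).
Local Notation Z_le_M := (Z_le_M Z_ge8).
Local Notation wpA := (@wp_assign B M M_ge8 B_ge).
Local Notation wpS k := (@wp_store B M M_ge8 B_ge _ _ _ _ _ _ k).
Local Notation wpIf := (@wp_if B M M_ge8 B_ge).

Variable Lam : nat.
Hypothesis Z_lt : log_bound Z Lam.

Variables (d aRep aC aCoef b el kk g i j : nat) (rep c W0 : nat) (a w1 w2 : int).

Let e := truncate (rate el c) a.
Let L := rate el c.

(* What a thread handling the set i at the element j can read; stored weights
   are shifted by b so that fresh memory encodes the initial weight b. *)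
Definition thread_state (s : state) : Prop :=
  [/\ [/\ reg s 2 = Posz b, reg s 3 = Posz Z, reg s 6 = Posz i & reg s 7 = Posz j],
      [/\ reg s 9 = Posz kk, reg s 10 = Posz g & reg s 17 = Posz el],
      [/\ heap s (aRep, i * Z + j) = Posz rep, heap s (aC, kk * Z + i) = Posz c &
          heap s (aCoef, g * Z + i) = a] &
      heap s (arr d 0, kk * Z + i) = (w1 - Posz b)%R /\
      heap s (arr d 1, kk * Z + i) = (w2 - Posz b)%R].

Hypotheses (el_gt0 : 0 < el) (c_lt : c < Z) (Z4_le : 4 * Z <= M).
Hypotheses (a_le : `|a| <= b) (w1_le : `|w1| <= W0) (w2_le : `|w2| <= W0).
Hypotheses (b_gt0 : 0 < b) (b_le : b <= W0) (W0_le : 4 * (b * W0) <= M).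

Lemma e_le : `|e| <= b.
Proof. by rewrite /e /truncate; case: ifP. Qed.

Lemma incr_le (x y : int) : `|x| <= b -> `|y| <= W0 -> `|incr x L y| <= b * W0.
Proof.
move=> xb yW; apply: leq_trans (lez_div _ _) _.
by rewrite abszM leq_mul.
Qed.

Definition contrib : int := (incr e L w1 + incr (- e) L w2)%R.

Lemma contrib_le : `|contrib| <= 2 * (b * W0).
Proof.
have := incr_le e_le w1_le.
have := @incr_le (- e)%R w2 _ w2_le; rewrite abszN => /(_ e_le) h2 h1.
by apply: absz_add_le h1 h2 _; rewrite mul2n addnn.
Qed.

Lemma wp_score_body (Rd Wr : loc -> Prop) s r :
  thread_state s -> reg s 8 = Posz r ->
  (forall l, l \in [:: (aRep, i * Z + j); (aC, kk * Z + i); (aCoef, g * Z + i);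
     (arr d 0, kk * Z + i); (arr d 1, kk * Z + i)] -> Rd l) ->
  Wr (arr d 3, j * Z + r) ->
  wp Rd Wr s (score_body d aRep aC aCoef) (fun s' w' d' =>
    [/\ heap s' (arr d 3, j * Z + r) =
          (if rep == 0 then contrib else heap s (arr d 3, j * Z + r)),
        w' <= 25 * Lam.+1 + 140 & d' <= 25 * Lam.+1 + 140]).
Proof.
move=> [[r2 r3 r6 r7] [r9 r10 r17] [hrep hc ha] [hP hM]] r8 hR hW.
have inR l : l \in [:: (aRep, i * Z + j); (aC, kk * Z + i); (aCoef, g * Z + i);
     (arr d 0, kk * Z + i); (arr d 1, kk * Z + i)] -> Rd l by exact: hR.
apply: wpIf => //=; rewrite r3 r6 r7.
- by split=> //; exists (i * Z + j) => //; apply: inR; rewrite !inE eqxx.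
- rewrite ?natE /= hrep => n0; apply: wp_skip; split; try by clear; lia.
  by case: (eqVneq rep 0) n0 => [->|].
rewrite ?natE /= hrep => -[rep0].
apply: wp_seq; apply: wp_mono.
  apply: (@wp_get_coef B Z Z_ge8 B_ge Lam Z_lt Rd Wr s aC aCoef kk g i el c a) => //;
    by apply: inR; rewrite !inE eqxx ?orbT.
move=> s1 w d1 [e1 [e13 e14 e21'] er hw hd].
have e21 : reg s1 21 = e by exact: e21'.
have cE : (((e * (w1 - Posz b + Posz b))%R %/ Posz L)%Z
     + ((0 - e * (w2 - Posz b + Posz b))%R %/ Posz L)%Z)%R = contrib.
  by rewrite /contrib /incr !subrK sub0r -mulNr.
apply: (wpS (j * Z + r)); rewrite //= ?e13 ?e21 ?er // ?r2 ?r3 ?r6 ?r7 ?r8 ?r9 //.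
- ok_split.
  + by exists (kk * Z + i) => //; apply: inR; rewrite !inE eqxx ?orbT.
  + by exists (kk * Z + i) => //; apply: inR; rewrite !inE eqxx ?orbT.
- by rewrite ?natE /= e1 hP hM cE; have := contrib_le; lia.
rewrite ?natE /= e1 hP hM cE eqxx; split=> //; first by rewrite rep0.
- by lia.
- by lia.
Qed.

(** A set has a single pair of weights for a whole group, so access to them is claimed only under
    [rep = 0]; the threads at its other elements of the group must not touch them. *)
Lemma wp_update_body (Rd Wr : loc -> Prop) s (sg sm : int) :
  thread_state s -> reg s 12 = sg -> (sg = 1 \/ sg = - 1)%R ->
  heap s (arr d 2, kk * Z + i) = sm -> `|sm| <= b * W0 ->
  (forall l, l \in [:: (aRep, i * Z + j); (aC, kk * Z + i); (aCoef, g * Z + i)] ->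
     Rd l) ->
  (rep = 0 -> forall k, k < 3 -> Rd (arr d k, kk * Z + i)) ->
  (rep = 0 -> forall k, k < 3 -> Wr (arr d k, kk * Z + i)) ->
  wp Rd Wr s (update_body d aRep aC aCoef) (fun s' w' d' =>
    [/\ rep = 0 -> [/\ heap s' (arr d 0, kk * Z + i) = (step (sg * e) L w1 - Posz b)%R,
          heap s' (arr d 1, kk * Z + i) = (step (- (sg * e)) L w2 - Posz b)%R &
          heap s' (arr d 2, kk * Z + i) = (sm + sg * a)%R],
        w' <= 25 * Lam.+1 + 200 & d' <= 25 * Lam.+1 + 200]).
Proof.
move=> [[r2 r3 r6 r7] [r9 r10 r17] [hrep hc ha] [hP hM]] r12 sgP hS sm_le inR inR3 hW.
have sge_le : absz (sg * e)%R <= b.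
  by rewrite abszM; have := e_le; case: sgP => ->; rewrite mul1n.
have sge_le' : absz (- (sg * e))%R <= b by rewrite abszN.
have i1 := incr_le sge_le w1_le; have i2 := incr_le sge_le' w2_le.
have bW : W0 <= b * W0 by rewrite leq_pmull.
have sumM : W0 + b * W0 + b < M.
  move: W0_le b_le b_gt0 bW; clear; move: (b * W0) => x; lia.
apply: wpIf => //=; rewrite r3 r6 r7.
- by split=> //; exists (i * Z + j) => //; apply: inR; rewrite !inE eqxx.
- rewrite ?natE /= hrep => n0; apply: wp_skip; split; [move=> rep0|clear; lia|clear; lia].
  by move: n0; rewrite rep0 eqxx.
rewrite ?natE /= hrep => -[rep0].
apply: wp_seq; apply: wp_mono.
  apply: (@wp_get_coef B Z Z_ge8 B_ge Lam Z_lt Rd Wr s aC aCoef kk g i el c a) => //;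
    by apply: inR; rewrite !inE eqxx ?orbT.
move=> s1 w d1 [e1 [e13 e14 e21'] er hw hd].
have e21 : reg s1 21 = e by exact: e21'.
have E1 : (w1 - Posz b + ((sg * e * (w1 - Posz b + Posz b))%R %/ Posz (rate el c))%Z + 1
   = step (sg * e) L w1 - Posz b)%R by rewrite subrK /step /incr -/L; ring.
have E2 : (w2 - Posz b + ((0 - sg * e * (w2 - Posz b + Posz b))%R %/ Posz (rate el c))%Z + 1
   = step (- (sg * e)) L w2 - Posz b)%R by rewrite subrK sub0r /step /incr -/L mulNr; ring.
have B1 : absz (step (sg * e) L w1 - Posz b)%R <= M.
  exact: absz_shift_le w1_le i1 sumM.
have B2 : absz (step (- (sg * e)) L w2 - Posz b)%R <= M.
  exact: absz_shift_le w2_le i2 sumM.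
apply: wp_seq; apply: (wpS (kk * Z + i));
  rewrite //= ?e13 ?e21 ?er // ?r2 ?r3 ?r6 ?r9 ?r12 ?natE /= ?e1 ?hP ?E1 //.
- by ok_split; exists (kk * Z + i) => //; apply: inR3.
- by apply: hW.
apply: wp_seq; apply: (wpS (kk * Z + i));
  rewrite //= ?e13 ?e21 ?er // ?r2 ?r3 ?r6 ?r9 ?r12 ?natE /= ?xpair_eqE ?arr_eq /= ?e1 ?hM ?E2 //.
- by ok_split; exists (kk * Z + i) => //; apply: inR3.
- by apply: hW.
apply: (wpS (kk * Z + i));
  rewrite //= ?e13 ?e14 ?e21 ?er // ?r2 ?r3 ?r6 ?r9 ?r12 ?natE /= ?xpair_eqE ?arr_eq /= ?e1 ?hS //.
- by ok_split; exists (kk * Z + i) => //; apply: inR3.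
- by apply: hW.
- have : absz (sg * a)%R <= b by rewrite abszM; case: sgP => ->; rewrite mul1n.
  move=> sa; apply: absz_add_le sm_le sa _.
  by move: sumM; clear; move: (b * W0) => x; lia.
split; last by move: hd; clear; lia.
  by rewrite !eqxx.
by move: hw; clear; lia.
Qed.

End Thread.

(* A stage treats blocks of b groups of sz elements: blocks of single elements in
   the first stage, and in the second stage one block whose groups are the blocks
   of the first.  A set is handled once per group, at its element with rep = 0. *)
Definition score_elem (d aRep aC aCoef : nat) : com :=
  Assign 7 (V 10 * V 16 + V 11) ;;
  (for_sets (score_body d aRep aC aCoef) ;;
  (Assign 22 (V 7) ;;
  (Assign 20 (Get 3 ((V 4 * V 3 + V 7) * V 3)) ;;
  (reduce (arr d 3) ;;
  Store (arr d 4) (V 10 * V 3 + V 11) (Get (arr d 3) (V 7 * V 3)))))).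

Definition update_elem (d aRep aC aCoef : nat) : com :=
  Assign 7 (V 10 * V 16 + V 11) ;; for_sets (update_body d aRep aC aCoef).

Definition step_group (d aRep aC aCoef : nat) : com :=
  ParFor 11 (V 16) (score_elem d aRep aC aCoef) ;;
  (Assign 22 (V 10) ;;
  (Assign 20 (V 16) ;;
  (reduce (arr d 4) ;;
  (Assign 12 (Lit 1 - Lit 2 * (Lit 1 <= Get (arr d 4) (V 10 * V 3))) ;;
  (Store (arr d 5) (V 10) (V 12) ;;
  (ParFor 11 (V 16) (update_elem d aRep aC aCoef) ;;
  Assign 10 (V 10 + Lit 1))))))).

Definition stage (d aRep aC aCoef : nat) : com :=
  ParFor 9 (V 15) (Assign 10 (V 9 * V 2) ;;
    While (V 10 + Lit 1 <= (V 9 + Lit 1) * V 2) (step_group d aRep aC aCoef)).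

Lemma absz_sum_le (F : nat -> int) (c x : nat) : (forall y, `|F y| <= c) ->
  `|(\sum_(0 <= y < x) F y)%R| <= x * c.
Proof.
move=> Fc; elim: x => [|x IH]; first by rewrite big_geq.
by rewrite big_nat_recr //=; apply: absz_add_le IH (Fc x) _; rewrite mulSn addnC.
Qed.

Lemma sum_cost (F : nat -> nat) (C k : nat) :
  \sum_(i < k) (C * (F i).+1).+1 = C * (\sum_(0 <= i < k) F i) + C.+1 * k.
Proof.
rewrite -(big_mkord xpredT (fun i => (C * (F i).+1).+1)).
elim: k => [|k IH]; first by rewrite !big_geq // !muln0.
by rewrite !big_nat_recr //= IH; nia.
Qed.

Lemma row_ge Z q k : q * Z <= k -> 0 < Z -> q <= k %/ Z.
Proof. by move=> h Z0; rewrite leq_divRL. Qed.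

Lemma digit_lt a c q r : q < a -> r < c -> q * c + r < a * c.
Proof.
move=> qa rc; apply: leq_trans (_ : q.+1 * c <= _); last by rewrite leq_mul2r qa orbT.
by rewrite mulSn addnC ltn_add2r.
Qed.

(** * One run of the greedy rule on all blocks in parallel *)

Section Stage.

Variables B Z : nat.
Local Notation M := (cap Z).
Hypotheses (Z_ge8 : 8 <= Z) (B_ge : fits B M).
Local Notation wp := (wp B M).
Local Notation M_ge8 := (M_ge8 Z_ge8).
Local Notation Z_le_M := (Z_le_M Z_ge8).
Local Notation wpA := (@wp_assign B M M_ge8 B_ge).
Local Notation wpS k := (@wp_store B M M_ge8 B_ge _ _ _ _ _ _ k).
Local Notation wpW I N wc dc := (@wp_while B M M_ge8 B_ge _ _ _ _ _ I N wc dc).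
Local Notation wpP k own Q wb db :=
  (@wp_par B M M_ge8 B_ge _ _ _ _ _ _ k own Q wb db).

Variable Lam : nat.
Hypothesis Z_lt : log_bound Z Lam.

Variable sets : seq (seq nat).
Local Notation m := (size sets).
Hypothesis m_lt : 2 * m < Z.
Hypothesis m_gt0 : 0 < m.

Variables (d aRep aC aCoef b Y sz el ell : nat).
Variables (rep : nat -> nat -> nat) (co : nat -> nat -> int) (cc : nat -> nat -> nat).
Variable h0 : loc -> int.

Let W0 := 4 * m * b.

Hypotheses (d_gt0 : 0 < d) (rep_lt : aRep < arr d 0) (c_lt : aC < arr d 0)
  (coef_lt : aCoef < arr d 0).
Hypotheses (b_gt0 : 0 < b) (sz_gt0 : 0 < sz) (sz_le : sz <= b) (el_gt0 : 0 < el).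
Hypotheses (size_lt : Y * b * sz < Z) (b_lt : 2 * b < Z) (Z4_le : 4 * Z <= M).
Hypothesis W0_le : 4 * (b * W0) * (m * b) <= M.

Hypothesis h0_count : forall j, j < Z ->
  h0 (3, (ell * Z + j) * Z) = Posz (size (sel sets j)).
Hypothesis h0_list : forall j r, j < Z -> r < size (sel sets j) ->
  h0 (5, j * Z + r) = Posz (nth 0 (sel sets j) r).
Hypothesis h0_rep : forall i j, inS sets i j -> h0 (aRep, i * Z + j) = Posz (rep i j).
Hypothesis h0_c : forall i kk, i < m -> kk < Y -> h0 (aC, kk * Z + i) = Posz (cc kk i).
Hypothesis h0_coef : forall i g, i < m -> g < Y * b -> h0 (aCoef, g * Z + i) = co g i.
Hypothesis cc_lt : forall i kk, i < m -> kk < Y -> cc kk i < Z.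
Hypothesis co_le : forall i g, `|co g i| <= b.
Hypothesis rep_uniq : forall i g t t', t < sz -> t' < sz ->
  inS sets i (g * sz + t) -> inS sets i (g * sz + t') ->
  rep i (g * sz + t) = 0 -> rep i (g * sz + t') = 0 -> t = t'.

(** Defined through representatives, because only these act in the program; that every set with an
    element in the group has one is a matter of the particular [rep]. *)
Definition in_group (i g : nat) : bool :=
  has (fun t => inS sets i (g * sz + t) && (rep i (g * sz + t) == 0)) (iota 0 sz).

Definition group_rate (i kk : nat) : nat := rate el (cc kk i).

Definition group_coef (i kk x : nat) : int := truncate (group_rate i kk) (co (kk * b + x) i).

Local Notation W := (weights m b in_group group_coef group_rate).
Local Notation sgn := (greedy_sign m b in_group group_coef group_rate).

Lemma group_coef_le i kk x : `|group_coef i kk x| * 2 <= group_rate i kk.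
Proof. by rewrite /group_coef /truncate; case: ifP. Qed.

Lemma L_gt0 i kk : 0 < group_rate i kk.
Proof. by rewrite /group_rate ltnW // rate_ge2. Qed.

Lemma W_le kk x i : i < m -> x <= b ->
  `|(W kk x).1 i| <= W0 /\ `|(W kk x).2 i| <= W0.
Proof.
move=> im xb.
have [h1 h2] := @weights_le m b in_group group_coef group_rate L_gt0 group_coef_le kk x i b_gt0 im xb.
have [h3 h4] := @weights_gt0 m b in_group group_coef group_rate L_gt0 group_coef_le kk x i b_gt0.
by move: h1 h2 h3 h4; rewrite -/W0; move: (W kk x).1 (W kk x).2 => f1 f2; lia.
Qed.

Lemma stage_facts : [/\ b <= W0, 4 * (b * W0) <= M, Y * b < Z & sz < Z].
Proof.
have h : 4 * (b * W0) <= 4 * (b * W0) * (m * b) by rewrite leq_pmulr // muln_gt0 m_gt0.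
split; last by lia.
- by rewrite /W0 leq_pmull // muln_gt0.
- exact: leq_trans h W0_le.
- by apply: leq_ltn_trans size_lt; rewrite leq_pmulr.
Qed.

(** The arrays numbered below [arr d 0] hold the input of the stage and are only read by it; [h0]
    records them once for all steps. *)
Definition ctx (kk g : nat) (s : state) : Prop :=
  [/\ [/\ reg s 2 = Posz b, reg s 3 = Posz Z & reg s 4 = Posz ell],
      [/\ reg s 9 = Posz kk, reg s 10 = Posz g, reg s 16 = Posz sz & reg s 17 = Posz el] &
      forall l, l.1 < arr d 0 -> heap s l = h0 l].

Lemma ctx_linked kk g s : ctx kk g s -> linked Z sets ell s.
Proof.
move=> [[_ r3 r4] _ hs]; split=> //.
- by move=> j jZ; rewrite hs ?h0_count // /arr /=; lia.
- by move=> j r jZ rs; rewrite hs ?h0_list // /arr /=; lia.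
Qed.

Definition ctr (kk x i : nat) : int :=
  contrib el (cc kk i) (co (kk * b + x) i) ((W kk x).1 i) ((W kk x).2 i).

Lemma ctr_le kk x i : i < m -> x <= b -> `|ctr kk x i| <= 2 * (b * W0).
Proof.
move=> im xb; have [h1 h2] := W_le kk im xb; apply: contrib_le => //.
Qed.

Definition elem_score (kk x j : nat) : int :=
  (\sum_(i <- sel sets j | rep i j == 0%N) ctr kk x i)%R.

Lemma wp_score_elem (Rd Wr : loc -> Prop) kk x t s :
  let g := kk * b + x in let j := g * sz + t in
  ctx kk g s -> reg s 11 = Posz t -> t < sz -> kk < Y -> x < b ->
  (forall i, i < m -> heap s (arr d 0, kk * Z + i) = ((W kk x).1 i - Posz b)%R) ->
  (forall i, i < m -> heap s (arr d 1, kk * Z + i) = ((W kk x).2 i - Posz b)%R) ->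
  (forall r, r < Z -> heap s (arr d 3, j * Z + r) = 0%R) ->
  (forall l, l.1 < arr d 0 -> Rd l) ->
  (forall i k, i < m -> k < 2 -> Rd (arr d k, kk * Z + i)) ->
  (forall l, row_cell Z (arr d 3) j l -> Rd l /\ Wr l) ->
  Wr (arr d 4, g * Z + t) ->
  wp Rd Wr s (score_elem d aRep aC aCoef) (fun s' w' d' =>
    [/\ heap s' (arr d 4, g * Z + t) = elem_score kk x j,
        w' <= 500 * Lam.+1 * (size (sel sets j)).+1 & d' <= 500 * Lam.+1]).
Proof.
move=> g j cx r11 tsz kkY xb hP hM hB hR hRw hRW hWr.
have [bW W4 Yb szZ] := stage_facts.
have gY : g < Y * b by exact: digit_lt.
have jZ : j < Z by apply: ltn_trans size_lt; apply: digit_lt.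
have [[r2 r3 r4] [r9 r10 r16 r17] hs] := cx.
apply: wp_seq; apply: wpA; rewrite //= ?r10 ?r16 ?r11 ?natE /= -/j.
  by apply: leq_trans Z_le_M; apply: ltnW.
set s1 := set_reg s 7 _.
have cx1 : ctx kk g s1 by [].
have row r : r < Z -> row_cell Z (arr d 3) j (arr d 3, j * Z + r).
  by move=> rZ; split=> //=; rewrite row_divE.
have idx_lt i : inS sets i j -> index i (sel sets j) < Z.
  rewrite -mem_sel -index_mem => h; apply: leq_trans h _.
  by apply: leq_trans (size_sel_le _ _) _; lia.
apply: wp_seq; apply: wp_mono.
  apply: (@wp_for_sets B Z Z_ge8 B_ge sets _ ell Rd Wr s1 _ j
    (fun i l => l = (arr d 3, j * Z + index i (sel sets j)))
    (fun i s' => heap s' (arr d 3, j * Z + index i (sel sets j))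
       = (if rep i j == 0%N then ctr kk x i else 0%R))
    (25 * Lam.+1 + 140) (25 * Lam.+1 + 140)) => //.
  - by lia.
  - exact: ctx_linked cx1.
  - by move=> l l35; apply: hR; case: l35 => ->; rewrite /arr; lia.
  - by move=> i l ->; rewrite /arr /=; lia.
  - by move=> i l ij ->; have [] := hRW _ (row _ (idx_lt i ij)).
  - move=> i i' l ij ij' -> [] /addnI e.
    by rewrite -(nth_index 0 (_ : i \in sel sets j)) ?mem_sel // e nth_index // mem_sel.
  - move=> r i rs ei ij; have im := inS_lt ij.
    have er : index i (sel sets j) = r by rewrite ei index_uniq ?sel_uniq.
    rewrite er.
    have [w1 w2] := W_le kk im (ltnW xb).
    apply: wp_mono.
      apply: (@wp_score_body B Z Z_ge8 B_ge Lam Z_lt d aRep aC aCoef b el kk g i j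
        (rep i j) (cc kk i) W0 (co g i) ((W kk x).1 i) ((W kk x).2 i)) => //.
      + exact: cc_lt.
      + by split=> //; split; rewrite /= ?hP ?hM ?hs ?h0_rep ?h0_c ?h0_coef.
      + move=> l; rewrite !inE => hl; split; last first.
          move=> i' ij' el'; rewrite el' !xpair_eqE in hl.
          by move: hl; rewrite !arr_eq /=; move: rep_lt c_lt coef_lt; rewrite /arr; lia.
        case/or4P: hl => [/eqP->|/eqP->|/eqP->|/orP[/eqP->|/eqP->]];
          by [apply: hR|apply: hRw].
    move=> s' w' d' [q hw hd]; split=> //.
    by rewrite q; case: ifP => // _; rewrite /= hB // -er idx_lt.
move=> s2 w2 d2 [er2 hth2 hun2 hw2 hd2].
set len := size (sel sets j).
have lenm : len <= m by exact: size_sel_le.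
have hs2 l : l.1 < arr d 0 -> heap s2 l = h0 l.
  move=> l0; rewrite hun2 ?hs // => i ij el'; rewrite el' /= in l0.
  by move: l0; rewrite ltnNge arr_min.
have cnt2 : heap s2 (3, (ell * Z + j) * Z) = Posz len.
  by rewrite hs2 ?h0_count // /arr /=; lia.
(* The row as seen by the summation: zero beyond the list and for sets represented at another
   element of the group. *)
pose y r : int := if r < len then
  (if rep (nth 0 (sel sets j) r) j == 0%N then ctr kk x (nth 0 (sel sets j) r) else 0%R)
  else 0%R.
have hy r : r < Z -> heap s2 (arr d 3, j * Z + r) = y r.
  move=> rZ; rewrite /y; case: ltnP => rl.
    have ij : inS sets (nth 0 (sel sets j) r) j by rewrite -mem_sel mem_nth.
    have [s3 e3 e4] := hth2 _ ij.
    by move: e3 e4; rewrite index_uniq ?sel_uniq // => e3 e4; rewrite e4.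
  rewrite hun2 ?hB // => i ij [] /addnI e; move: rl.
  by rewrite e leqNgt index_mem mem_sel ij.
have y0 r : len <= r -> y r = 0%R by move=> lr; rewrite /y ltnNge lr.
have y_le r : `|y r| <= 2 * (b * W0).
  rewrite /y; case: ltnP => rl //; case: ifP => // _; apply: ctr_le; last exact: ltnW.
  by have := mem_nth 0 rl; rewrite mem_sel => /inS_lt.
have sum_y : (\sum_(0 <= r < len) y r)%R = elem_score kk x j.
  rewrite /elem_score [RHS](big_nth 0) -/len [RHS]big_mkcond /=.
  by apply: eq_big_nat => r /andP[_ rl]; rewrite /y rl.
have sum_y_le : \sum_(0 <= r < len) `|y r| <= M.
  apply: leq_trans (_ : \sum_(0 <= r < len) 2 * (b * W0) <= _); first exact: leq_sum.
  rewrite sum_nat_const_nat subn0; apply: leq_trans W0_le.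
  apply: leq_trans (_ : m * b * (2 * (b * W0)) <= _).
    by rewrite leq_mul2r (leq_trans lenm) ?orbT // leq_pmulr.
  by move: (m * b) (b * W0) => p q; lia.
apply: wp_seq; apply: wpA; rewrite //= ?er2 /=.
  by apply: leq_trans Z_le_M; apply: ltnW.
apply: wp_seq; apply: wpA; rewrite //= ?er2 /= ?r3 ?r4 ?natE /= ?cnt2.
- by ok_split; exists ((ell * Z + j) * Z) => //; apply: hR; rewrite /arr /=; lia.
- by apply: leq_trans Z_le_M; lia.
set s3 := set_reg _ _ _.
apply: wp_seq; apply: wp_use.
  apply: (@wp_reduce B Z Z_ge8 B_ge Lam Z_lt s3 (arr d 3) j len y) => //.
  - by rewrite /= er2.
  - by rewrite /=; lia.
- by move=> l /hRW[].
- by move=> l /hRW[].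
move=> s4 w4 d4 _ [e4 hw4 hd4] hf4 hr4.
apply: (wpS (g * Z + t)); rewrite //= ?hr4 //= ?er2 /= ?r3 ?r10 ?r11 ?natE //= ?e4 ?sum_y.
- by ok_split; exists (j * Z) => //; have [] := hRW _ (row 0 (leq_trans (isT : 0 < 8) Z_ge8));
    rewrite addn0.
- by rewrite -sum_y; apply: leq_trans (sum_block_le 0 len y0) sum_y_le.
rewrite eqxx; split=> //.
- move: hw2 hw4; rewrite -/len; clear; lia.
- move: hd2 hd4; clear; lia.
Qed.

Definition upd_cell (kk j : nat) (l : loc) : Prop :=
  exists i k, [/\ inS sets i j, rep i j = 0, k < 3 & l = (arr d k, kk * Z + i)].

Lemma wp_update_elem (Rd : loc -> Prop) kk x t s (sm : nat -> int) :
  let g := kk * b + x in let j := g * sz + t in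
  ctx kk g s -> reg s 11 = Posz t -> reg s 12 = sgn kk x ->
  t < sz -> kk < Y -> x < b ->
  (forall i, i < m -> heap s (arr d 0, kk * Z + i) = ((W kk x).1 i - Posz b)%R) ->
  (forall i, i < m -> heap s (arr d 1, kk * Z + i) = ((W kk x).2 i - Posz b)%R) ->
  (forall i, i < m -> heap s (arr d 2, kk * Z + i) = sm i) ->
  (forall i, i < m -> `|sm i| <= b * W0) ->
  (forall l, l.1 < arr d 0 -> Rd l) ->
  (forall l, upd_cell kk j l -> Rd l) ->
  wp Rd (upd_cell kk j) s (update_elem d aRep aC aCoef) (fun s' w' d' =>
    [/\ forall i, inS sets i j -> rep i j = 0 ->
          [/\ heap s' (arr d 0, kk * Z + i)
                 = (step (sgn kk x * group_coef i kk x) (group_rate i kk) ((W kk x).1 i) - Posz b)%R,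
              heap s' (arr d 1, kk * Z + i)
                 = (step (- (sgn kk x * group_coef i kk x)) (group_rate i kk) ((W kk x).2 i) - Posz b)%R &
              heap s' (arr d 2, kk * Z + i) = (sm i + sgn kk x * co g i)%R],
        w' <= 300 * Lam.+1 * (size (sel sets j)).+1 & d' <= 300 * Lam.+1]).
Proof.
move=> g j cx r11 r12 tsz kkY xb hP hM hS smb hR hRU.
have [bW W4 Yb szZ] := stage_facts.
have gY : g < Y * b by exact: digit_lt.
have jZ : j < Z by apply: ltn_trans size_lt; apply: digit_lt.
have [[r2 r3 r4] [r9 r10 r16 r17] hs] := cx.
apply: wp_seq; apply: wpA; rewrite //= ?r10 ?r16 ?r11 ?natE /= -/j.
  by apply: leq_trans Z_le_M; apply: ltnW.
set s1 := set_reg s 7 _.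
have cx1 : ctx kk g s1 by [].
apply: wp_mono.
  apply: (@wp_for_sets B Z Z_ge8 B_ge sets _ ell Rd (upd_cell kk j) s1 _ j
    (fun i l => rep i j = 0 /\ exists2 k, k < 3 & l = (arr d k, kk * Z + i))
    (fun i s' => rep i j = 0 ->
          [/\ heap s' (arr d 0, kk * Z + i)
                 = (step (sgn kk x * group_coef i kk x) (group_rate i kk) ((W kk x).1 i) - Posz b)%R,
              heap s' (arr d 1, kk * Z + i)
                 = (step (- (sgn kk x * group_coef i kk x)) (group_rate i kk) ((W kk x).2 i) - Posz b)%R &
              heap s' (arr d 2, kk * Z + i) = (sm i + sgn kk x * co g i)%R])
    (25 * Lam.+1 + 200) (25 * Lam.+1 + 200)) => //.
  - by move: m_lt; clear; lia.
  - exact: ctx_linked cx1.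
  - by move=> l l35; apply: hR; case: l35 => ->; rewrite /arr; move: d_gt0; clear; lia.
  - by move=> i l [_ [k _ ->]]; rewrite /arr /=; move: d_gt0; clear; lia.
  - by move=> i l ij [r0 [k k3 ->]]; exists i, k.
  - move=> i i' l ij ij' [_ [k k3 ->]] [_ [k' k3' [_ /addnI]]] //.
  - move=> r i rs ei ij; have im := inS_lt ij.
    have [w1 w2] := W_le kk im (ltnW xb).
    apply: (@wp_update_body B Z Z_ge8 B_ge Lam Z_lt d aRep aC aCoef b el kk g i j
        (rep i j) (cc kk i) W0 (co g i) ((W kk x).1 i) ((W kk x).2 i)) => //.
    + exact: cc_lt.
    + by split=> //; split; rewrite /= ?hP ?hM ?hs ?h0_rep ?h0_c ?h0_coef.
    + exact: greedy_signP.
    + exact: hS.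
    + exact: smb.
    + move=> l; rewrite !inE => hl; split.
        by case/or3P: hl => /eqP->; apply: hR.
      move=> i' ij' [_ [k k3 el']]; rewrite el' !xpair_eqE in hl.
      by move: hl rep_lt c_lt coef_lt; rewrite /arr; clear; lia.
    + move=> r0 k k3; split; first by apply: hRU; exists i, k.
      by move=> i' ij' [_ [k' k3' [_ /addnI]]].
    + by move=> r0 k k3; split=> //; exists k.
move=> s2 w2 d2 [er2 hth2 hun2 hw2 hd2]; split.
- move=> i ij r0; have [s3 e3 e4] := hth2 i ij.
  have [e5 e6 e7] := e3 r0.
  by split; rewrite e4 //; (split=> //; by [exists 0|exists 1|exists 2]).
- by move: hw2; clear; lia.
- by move: hd2; clear; lia.
Qed.

Lemma elem_score_le kk x j : x <= b -> `|elem_score kk x j| <= m * (2 * (b * W0)).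
Proof.
move=> xb; rewrite /elem_score.
apply: leq_trans (_ : \sum_(i <- sel sets j) 2 * (b * W0) <= _); last first.
  rewrite big_const_seq count_predT iter_addn_0 mulnC leq_mul2r.
  by rewrite size_sel_le orbT.
rewrite big_mkcond /= !big_seq.
elim/big_ind2: _ => // [u1 u2 v1 v2 h1 h2|i ij]; first exact: absz_add_le h1 h2 _.
case: ifP => // _; apply: ctr_le => //.
by move: ij; rewrite mem_sel => /inS_lt.
Qed.

(** Exchange the sums over elements and sets: by [rep_uniq] a set that meets the group is counted at
    exactly one element. *)
Lemma sum_elem_score kk x :
  (\sum_(0 <= t < sz) elem_score kk x ((kk * b + x) * sz + t))%R
    = score m b in_group group_coef group_rate kk (W kk x) x.
Proof.
set g := kk * b + x.
pose c t i := inS sets i (g * sz + t) && (rep i (g * sz + t) == 0).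
have -> : (\sum_(0 <= t < sz) elem_score kk x (g * sz + t)
   = \sum_(0 <= t < sz) \sum_(0 <= i < m | c t i) ctr kk x i)%R.
  apply: eq_bigr => t _; rewrite /elem_score /sel big_filter_cond.
  by rewrite /index_iota subn0.
rewrite (exchange_big_dep predT) //= /score [RHS]big_mkcond /=.
apply: eq_big_nat => i /andP[_ im].
rewrite /in_group -/g; case: hasP => [[t]|no].
  rewrite mem_iota /= add0n => tsz ct.
  rewrite big_mkord (bigD1 (Ordinal tsz)) //= big1 ?addr0 // => t' /andP[/andP[ij' /eqP r'] nt].
  case/andP: ct => ij /eqP r0; case/eqP: nt; apply: val_inj => /=.
  exact: rep_uniq ij' ij r' r0.
rewrite big_nat_cond big1 // => t /andP[/andP[_ tsz] ct]; case: no; exists t => //.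
by rewrite mem_iota.
Qed.

(** Each element and each group sums in a row of its own, so nothing is ever cleared: the last two
    clauses say that the rows not yet reached are still zero. *)
Definition stage_state (kk x : nat) (s : state) : Prop :=
  [/\ forall i, i < m -> heap s (arr d 0, kk * Z + i) = ((W kk x).1 i - Posz b)%R,
      forall i, i < m -> heap s (arr d 1, kk * Z + i) = ((W kk x).2 i - Posz b)%R,
      forall i, i < m -> heap s (arr d 2, kk * Z + i) =
        (\sum_(0 <= y < x) sgn kk y * ((in_group i (kk * b + y))%:R
           * co (kk * b + y) i))%R,
      forall y, y < x -> heap s (arr d 5, kk * b + y) = sgn kk y &
      (forall k, (kk * b + x) * Z <= k -> heap s (arr d 4, k) = 0%R) /\
      (forall k, (kk * b + x) * sz * Z <= k -> heap s (arr d 3, k) = 0%R)].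

Definition kk_own (kk : nat) (l : loc) : Prop :=
  [\/ exists i k, [/\ i < m, k < 3 & l = (arr d k, kk * Z + i)],
      exists x t, [/\ x < b, t < sz & row_cell Z (arr d 3) ((kk * b + x) * sz + t) l],
      exists2 x, x < b & row_cell Z (arr d 4) (kk * b + x) l |
      exists2 x, x < b & l = (arr d 5, kk * b + x)].

Lemma arr_ne (k k' c c' : nat) : k != k' -> (arr d k, c) <> (arr d k', c').
Proof. by move=> kk' [] /eqP; rewrite eqn_add2l (negPf kk'). Qed.

Lemma arr_inj (k k' : nat) : arr d k = arr d k' -> k = k'.
Proof. by move/eqP; rewrite arr_eq => /eqP. Qed.

Lemma wp_step_group (Rd : loc -> Prop) kk x s :
  ctx kk (kk * b + x) s -> kk < Y -> x < b -> stage_state kk x s ->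
  (forall l, l.1 < arr d 0 -> Rd l) -> (forall l, kk_own kk l -> Rd l) ->
  wp Rd (kk_own kk) s (step_group d aRep aC aCoef) (fun s' w' d' =>
    [/\ ctx kk (kk * b + x.+1) s', stage_state kk x.+1 s',
        w' <= 1500 * Lam.+1 * ((\sum_(0 <= t < sz)
                 size (sel sets ((kk * b + x) * sz + t))) + sz + 1)
      & d' <= 1500 * Lam.+1]).
Proof.
set g := kk * b + x => cx kkY xb [hP hM hS hG [hB2 hB1]] hR hRo.
have [bW W4 Yb szZ] := stage_facts.
have gY : g < Y * b by exact: digit_lt.
have jZ t : t < sz -> g * sz + t < Z.
  by move=> tsz; apply: ltn_trans size_lt; apply: digit_lt.
have gZ : g < Z by exact: ltn_trans Yb.
have mZ : m < Z by move: m_lt; clear; lia.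
have Z0 : 0 < Z by move: Z_ge8; clear; lia.
have [[r2 r3 r4] [r9 r10 r16 r17] hs] := cx.
have own3 t l : t < sz -> row_cell Z (arr d 3) (g * sz + t) l -> kk_own kk l.
  by move=> tsz hl; apply: Or42; exists x, t.
have own4 t : t < sz -> row_cell Z (arr d 4) g (arr d 4, g * Z + t).
  by move=> tsz; split=> //=; rewrite row_divE // (ltn_trans tsz).
have own4' l : row_cell Z (arr d 4) g l -> kk_own kk l.
  by move=> hl; apply: Or43; exists x.
have own012 i k : i < m -> k < 3 -> kk_own kk (arr d k, kk * Z + i).
  by move=> im k3; apply: Or41; exists i, k.
pose own1 t l := row_cell Z (arr d 3) (g * sz + t) l \/ l = (arr d 4, g * Z + t).
have szM : sz <= M by apply: leq_trans Z_le_M; apply: ltnW.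
apply: wp_seq; apply: wp_mono.
  apply: (wpP sz own1 (fun t s' => heap s' (arr d 4, g * Z + t) = elem_score kk x (g * sz + t))
    (fun t => 500 * Lam.+1 * (size (sel sets (g * sz + t))).+1) (500 * Lam.+1)) => //.
  - move=> t l tsz [hl|->]; first exact: own3 hl.
    by apply: own4'; apply: own4.
  - move=> t t' l tsz t'sz [[e1 e2]|->] [[e1' e2']|].
    + by move: e2'; rewrite e2 => /addnI.
    + by move=> el'; rewrite el' in e1; move: e1 => /eqP; rewrite arr_eq.
    + by move: e1' => /eqP; rewrite arr_eq.
    + by case=> /addnI.
  - move=> t tsz.
    apply: wp_mono; first apply: (@wp_score_elem _ _ kk x t) => //.
    + by move=> r rZ; apply: hB1; apply: leq_trans (leq_addr _ _); rewrite leq_mul2r leq_addr orbT.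
    + move=> l l0; split; first exact: hR.
      move=> t' t'sz [[e _]|e]; first by rewrite e ltnNge arr_min in l0.
      by rewrite e /= ltnNge arr_min in l0.
    + move=> i k im k2; split; first by apply/hRo/own012 => //; move: k2; clear; lia.
      move=> t' t'sz [[/arr_inj ek]|[/arr_inj ek]]; by rewrite ek in k2.
    + move=> l hl; split; last by left.
      split; first by apply: hRo; apply: own3 hl.
      move=> t' t'sz [[_ e]|e]; first by case: hl => _; rewrite e => /addnI.
      by case: hl; rewrite e /= => /eqP; rewrite arr_eq.
    + by right.
    by [].
move=> s1 w1 d1 [er1 hth1 hun1 hw1 hd1].
have hs1 l : l.1 < arr d 0 -> heap s1 l = h0 l.
  move=> l0; rewrite hun1 ?hs // => t tsz [[e _]|e].
    by rewrite e ltnNge arr_min in l0.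
  by rewrite e /= ltnNge arr_min in l0.
have hkeep1 k c : k != 3 -> k != 4 -> heap s1 (arr d k, c) = heap s (arr d k, c).
  move=> k3 k4; rewrite hun1 // => t tsz [[/arr_inj ek]|[/arr_inj ek]].
    by rewrite ek in k3.
  by rewrite ek in k4.
apply: wp_seq; apply: wpA; rewrite //= ?er1 ?r10 //=.
  by apply: leq_trans Z_le_M; apply: ltnW.
apply: wp_seq; apply: wpA; rewrite //= ?er1 ?r16 //=.
set s2 := set_reg _ _ _.
pose y r : int := if r < sz then elem_score kk x (g * sz + r) else 0%R.
have y0 r : sz <= r -> y r = 0%R by move=> lr; rewrite /y ltnNge lr.
have y_le r : `|y r| <= m * (2 * (b * W0)).
  by rewrite /y; case: ifP => // _; apply: elem_score_le; apply: ltnW.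
have hy r : r < Z -> heap s2 (arr d 4, g * Z + r) = y r.
  move=> rZ; rewrite /y /=; case: ltnP => rs.
    by have [s3 e3 e4] := hth1 r rs; rewrite e4 //; right.
  rewrite hun1; first by apply: hB2; rewrite leq_addr.
  move=> t tsz [[/eqP]|[] /addnI e]; first by rewrite arr_eq.
  by move: rs; rewrite e leqNgt tsz.
have sum_y_le : \sum_(0 <= r < sz) `|y r| <= M.
  apply: leq_trans (_ : \sum_(0 <= r < sz) m * (2 * (b * W0)) <= _).
    exact: leq_sum.
  rewrite sum_nat_const_nat subn0; apply: leq_trans W0_le.
  apply: leq_trans (_ : b * (m * (2 * (b * W0))) <= _); first by rewrite leq_mul2r sz_le orbT.
  by rewrite mulnA (mulnC b m) mulnC leq_mul2r leq_mul2r orbT orbT.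
set D := score m b in_group group_coef group_rate kk (W kk x) x.
have sum_y : (\sum_(0 <= r < sz) y r)%R = D.
  by rewrite /D -sum_elem_score; apply: eq_big_nat => r /andP[_ rs]; rewrite /y rs.
have D_le : `|D| <= M by rewrite -sum_y; apply: leq_trans (sum_block_le 0 sz y0) sum_y_le.
apply: wp_seq; apply: wp_use.
  apply: (@wp_reduce B Z Z_ge8 B_ge Lam Z_lt s2 (arr d 4) g sz y) => //.
  - by rewrite /= er1.
  - by move: sz_le b_lt; clear; lia.
- by move=> l /own4' /hRo.
- by move=> l /own4'.
move=> s3 w3 d3 _ [e3 hw3 hd3] hf3 hr3.
have hs3 l : l.1 < arr d 0 -> heap s3 l = h0 l.
  by move=> l0; rewrite hf3 ?hs1 // => -[e _]; rewrite e ltnNge arr_min in l0.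
have hkeep3 k c : k != 3 -> k != 4 -> heap s3 (arr d k, c) = heap s (arr d k, c).
  move=> k3 k4; rewrite hf3 /= ?hkeep1 // => -[/eqP].
  by rewrite arr_eq (negPf k4).
(* Both formulas break the tie [D = 0] towards +1. *)
have sgnE : (1 - 2 * Posz (1 <= D)%R)%R = sgn kk x.
  have -> : (1 <= D)%R = ~~ (D <= 0)%R by clearbody D; clear; lia.
  by rewrite /greedy_sign /sign_of -/D; case: (D <= 0)%R.
rewrite sum_y in e3.
apply: wp_seq; apply: wpA; rewrite //= ?hr3 //= ?er1 ?r10 ?r3 ?natE /= ?e3 ?sgnE.
- ok_split; exists (g * Z) => //; apply/hRo/own4'.
  by have := own4 0 sz_gt0; rewrite addn0.
- by case: (greedy_signP m b in_group group_coef group_rate kk x) => -> /=; move: (M_gt0 Z_ge8).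
apply: wp_seq; apply: (wpS g); rewrite //= ?hr3 //= ?er1 ?r10 //=.
- by apply: Or44; exists x.
- by case: (greedy_signP m b in_group group_coef group_rate kk x) => -> /=; move: (M_gt0 Z_ge8).
set s4 := set_heap _ _ _.
have er4 z : z \notin [:: 12; 18; 20; 22] -> reg s4 z = reg s z.
  move=> nz; rewrite /s4 /= hr3; last by apply: contra nz; rewrite !inE orbb => ->; rewrite orbT.
  by move: nz; rewrite !inE !negb_or /= er1 => /and4P[/negPf-> _ /negPf-> /negPf->].
have hs4 l : l.1 < arr d 0 -> heap s4 l = h0 l.
  move=> l0; rewrite /s4 /= ifN ?hs3 //; apply/eqP => e.
  by rewrite e /= ltnNge arr_min in l0.
have hkeep4 k c : k < 3 -> heap s4 (arr d k, c) = heap s (arr d k, c).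
  move=> k3; rewrite /s4 /= ifN ?hkeep3 //; try by move: k3; clear; lia.
  by apply/eqP/arr_ne; move: k3; clear; lia.
have cx4 : ctx kk g s4 by split=> //; split; rewrite er4.
pose sm i : int := (\sum_(0 <= y < x) sgn kk y * ((in_group i (kk * b + y))%:R
           * co (kk * b + y) i))%R.
(* At most b terms of absolute value at most b, and [b <= W0]. *)
have sm_le i : `|sm i| <= b * W0.
  apply: leq_trans (_ : x * b <= _); last first.
    by apply: leq_mul; first exact: ltnW.
  apply: absz_sum_le => y'.
  case: (greedy_signP m b in_group group_coef group_rate kk y') => ->; case: (in_group _ _);
    by rewrite ?mul1r ?mulN1r ?mul0r ?abszN // co_le.
apply: wp_seq; apply: wp_mono.
  apply: (wpP sz (fun t => upd_cell kk (g * sz + t)) (fun t s' =>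
     forall i, inS sets i (g * sz + t) -> rep i (g * sz + t) = 0 ->
          [/\ heap s' (arr d 0, kk * Z + i)
                 = (step (sgn kk x * group_coef i kk x) (group_rate i kk) ((W kk x).1 i) - Posz b)%R,
              heap s' (arr d 1, kk * Z + i)
                 = (step (- (sgn kk x * group_coef i kk x)) (group_rate i kk) ((W kk x).2 i) - Posz b)%R &
              heap s' (arr d 2, kk * Z + i) = (sm i + sgn kk x * co g i)%R])
    (fun t => 300 * Lam.+1 * (size (sel sets (g * sz + t))).+1) (300 * Lam.+1)) => //.
  - exact: etrans (er4 16 isT) r16.
  - by move=> t l tsz [i [k [ij _ k3 ->]]]; apply: own012 => //; apply: inS_lt ij.
  (* Several elements of the group may lie in one set, but only one of them represents it. *)
  - move=> t t' l tsz t'sz [i [k [ij ri k3 ->]]] [i' [k' [ij' ri' k3' [/addnI ek]]]].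
    move=> /addnI ei; subst i'; exact: rep_uniq ij ij' ri ri'.
  - move=> t tsz.
    apply: (@wp_update_elem _ kk x t _ sm) => //.
    + by move=> i im; rewrite [LHS]hkeep4 // hP.
    + by move=> i im; rewrite [LHS]hkeep4 // hM.
    + by move=> i im; rewrite [LHS]hkeep4 // hS.
    + move=> l l0; split; first exact: hR.
      by move=> t' _ [i [k [_ _ _ el']]]; rewrite el' /= ltnNge arr_min in l0.
    + move=> l [i [k [ij ri k3 el']]]; split.
        by rewrite el'; apply/hRo/own012 => //; apply: inS_lt ij.
      move=> t' t'sz [i' [k' [ij' ri' _]]]; rewrite el' => -[_ /addnI ei].
      by subst i'; exact: rep_uniq ij' ij ri' ri.
move=> s5 w5 d5 [er5 hth5 hun5 hw5 hd5].
have hkeep5 k c : 3 <= k -> heap s5 (arr d k, c) = heap s4 (arr d k, c).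
  move=> k3; rewrite hun5 // => t _ [i [k' [_ _ k3' /arr_ne]]]; case.
  by move: k3 k3'; clear; lia.
apply: wpA; rewrite //= ?er5 ?er4 ?r10 //=.
  by apply: leq_trans Z_le_M; move: gZ; clear; lia.
have gE : kk * b + x.+1 = g + 1 by rewrite /g -addnA addn1.
split.
- split; rewrite ?gE /= ?er5; first by rewrite !er4.
    by rewrite !er4.
  move=> l l0; rewrite hun5 ?hs4 // => t _ [i [k' [_ _ _ e]]].
  by rewrite e /= ltnNge arr_min in l0.
(* A set that meets the group is updated by the thread of its representative; by [hout] all others
   keep their weights, as in [weights]. *)
- have hin i : i < m -> in_group i g ->
      [/\ heap s5 (arr d 0, kk * Z + i)
                 = (step (sgn kk x * group_coef i kk x) (group_rate i kk) ((W kk x).1 i) - Posz b)%R,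
              heap s5 (arr d 1, kk * Z + i)
                 = (step (- (sgn kk x * group_coef i kk x)) (group_rate i kk) ((W kk x).2 i) - Posz b)%R &
              heap s5 (arr d 2, kk * Z + i) = (sm i + sgn kk x * co g i)%R].
    move=> im /hasP[t]; rewrite mem_iota /= add0n => tsz /andP[ij /eqP r0].
    have [s6 e6 e7] := hth5 t tsz; have [h1 h2 h4] := e6 i ij r0.
    by split; rewrite e7 //; [exists i, 0|exists i, 1|exists i, 2].
  have hout i k : in_group i g = false -> k < 3 ->
      heap s5 (arr d k, kk * Z + i) = heap s (arr d k, kk * Z + i).
    move=> ig k3; rewrite hun5 ?hkeep4 // => t tsz [i' [k' [ij r0 _ [_ /addnI ei]]]].
    subst i'; move/hasP: ig; case; exists t; first by rewrite mem_iota.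
    by rewrite ij r0.
  split.
  + move=> i im; rewrite [LHS]/= /= -/g -/(sgn kk x).
    by case ig : (in_group i g); [have [] := hin i im ig|rewrite hout ?hP].
  + move=> i im; rewrite [LHS]/= /= -/g -/(sgn kk x).
    by case ig : (in_group i g); [have [] := hin i im ig|rewrite hout ?hM].
  + move=> i im; rewrite [LHS]/= big_nat_recr //= -/(sm i) -/g.
    case ig : (in_group i g); first by have [_ _ ->] := hin i im ig; rewrite mul1r.
    by rewrite hout ?hS // mul0r mulr0 addr0.
  + move=> y' y'x; rewrite [LHS]/= hkeep5 // /s4 /= xpair_eqE eqxx eqn_add2l /=.
    case: eqP => [->//|/eqP ne]; rewrite hkeep3 // hG //.
    by rewrite ltn_neqAle ne -ltnS.
  split=> k hk; rewrite [LHS]/= hkeep5 // /s4 /= ifN; try by apply/eqP/arr_ne.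
    rewrite hf3 /=; last first.
      move=> [_ /= e]; have := row_ge hk Z0; rewrite e gE; clear; lia.
    rewrite hun1; first by apply: hB2; apply: leq_trans hk; rewrite leq_mul2r gE leq_addr orbT.
    move=> t tsz [[/arr_inj //]|[e]]; have := row_ge hk Z0.
    by rewrite e row_divE ?(ltn_trans tsz) // gE; clear; lia.
  rewrite hf3 /=; last by case=> /arr_inj.
  rewrite hun1.
    apply: hB1; apply: leq_trans hk; rewrite leq_mul2r leq_mul2r gE leq_addr.
    by rewrite !orbT.
  move=> t tsz [[_ /= e]|[/arr_inj //]]; have := row_ge hk Z0.
  by rewrite e gE mulnDl mul1n leq_add2l leqNgt tsz.
- move: hw1 hw3 hw5; rewrite !(sum_cost (fun t => size (sel sets (g * sz + t)))) -/g.
  move: (\sum_(0 <= t < sz) _) => T; clear=> /= hw1 hw3 hw5; nia.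
- by move: hd1 hd3 hd5 => /=; clear; lia.
Qed.

(** Cells of different kinds lie in different arrays; within one kind the block is a digit of the
    index. *)
Lemma kk_own_inj kk kk' l : kk_own kk l -> kk_own kk' l -> kk = kk'.
Proof.
have mZ : m < Z by move: m_lt; clear; lia.
case=> [[i [k [im k3 ->]]]|[x [t [xb tsz [e1 e2]]]]|[x xb [e1 e2]]|[x xb ->]];
  case=> [[i' [k' [i'm k3']]]|[x' [t' [x'b t'sz [e1' e2']]]]|[x' x'b [e1' e2']]|[x' x'b]].
- by case=> _ /(idx_inj (ltn_trans im mZ) (ltn_trans i'm mZ))[].
- by move: e1' => /arr_inj ek; rewrite ek in k3.
- by move: e1' => /arr_inj ek; rewrite ek in k3.
- by case=> /addnI ek; rewrite ek in k3.
- by move=> e; move: e1; rewrite e /= => /arr_inj ek; rewrite ek in k3'.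
- move: e2'; rewrite e2 => e; have [e' _] := idx_inj tsz t'sz e.
  by have [] := idx_inj xb x'b e'.
- by move: e1'; rewrite e1 => /arr_inj.
- by move=> e; move: e1; rewrite e /= => /arr_inj.
- by move=> e; move: e1; rewrite e /= => /arr_inj ek; rewrite ek in k3'.
- by move: e1'; rewrite e1 => /arr_inj.
- by move: e2'; rewrite e2 => e; have [] := idx_inj xb x'b e.
- by move=> e; move: e1; rewrite e /= => /arr_inj.
- by case=> /addnI ek; rewrite -ek in k3'.
- by move: e1' => /= /arr_inj.
- by move: e1' => /= /arr_inj.
- by case=> e; have [] := idx_inj xb x'b e.
Qed.

Lemma kk_own_arr kk l : kk_own kk l -> arr d 0 <= l.1 <= arr d 5.
Proof.
have le k : k <= 5 -> arr d 0 <= arr d k <= arr d 5 by rewrite /arr !leq_add2l.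
case=> [[i [k [_ k3 ->]]]|[x [t [_ _ [-> _]]]]|[x _ [-> _]]|[x _ ->]] /=; try exact: le.
by apply: le; apply: leq_trans (ltnW k3) _.
Qed.

Lemma wp_stage s :
  [/\ reg s 2 = Posz b, reg s 3 = Posz Z & reg s 4 = Posz ell] ->
  [/\ reg s 15 = Posz Y, reg s 16 = Posz sz & reg s 17 = Posz el] ->
  (forall l, l.1 < arr d 0 -> heap s l = h0 l) ->
  (forall k c, k < 5 -> heap s (arr d k, c) = 0%R) ->
  wp any any s (stage d aRep aC aCoef) (fun s' w' d' =>
    [/\ reg s' = reg s,
        forall l, ~~ (arr d 0 <= l.1 <= arr d 5) -> heap s' l = heap s l,
        forall kk x, kk < Y -> x < b -> heap s' (arr d 5, kk * b + x) = sgn kk x,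
        forall kk i, kk < Y -> i < m -> heap s' (arr d 2, kk * Z + i) =
          (\sum_(0 <= y < b) sgn kk y * ((in_group i (kk * b + y))%:R
             * co (kk * b + y) i))%R &
        w' <= 2000 * Lam.+1 * ((\sum_(0 <= kk < Y) \sum_(0 <= x < b)
                ((\sum_(0 <= t < sz) size (sel sets ((kk * b + x) * sz + t)))
                  + sz + 1)) + Y + 1)
        /\ d' <= 2000 * Lam.+1 * b.+1]).
Proof.
move=> [r2 r3 r4] [r15 r16 r17] hs hz.
have [bW W4 Yb szZ] := stage_facts.
have YZ : Y < Z by apply: leq_ltn_trans Yb; rewrite leq_pmulr.
have bZ : b < Z by move: b_lt; clear; lia.
pose wg kk x := 1500 * Lam.+1 * ((\sum_(0 <= t < sz)
                 size (sel sets ((kk * b + x) * sz + t))) + sz + 1).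
apply: wp_mono.
  apply: (wpP Y kk_own (fun kk s' =>
    (forall x, x < b -> heap s' (arr d 5, kk * b + x) = sgn kk x) /\
    (forall i, i < m -> heap s' (arr d 2, kk * Z + i) =
          (\sum_(0 <= y < b) sgn kk y * ((in_group i (kk * b + y))%:R
             * co (kk * b + y) i))%R))
    (fun kk => \sum_(k < b) (wg kk k + 20) + 40) (b * (1500 * Lam.+1 + 20) + 40)) => //.
  - by apply: leq_trans Z_le_M; apply: ltnW.
  - by move=> kk kk' l _ _; apply: kk_own_inj.
  - move=> kk kkY.
    have kkbZ : kk * b < Z.
      by apply: leq_ltn_trans Yb; rewrite leq_mul2r ltnW ?orbT.
    apply: wp_seq; apply: wpA; rewrite //= ?r2 ?natE /=.
      by apply: leq_trans Z_le_M; apply: ltnW.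
    apply: wp_mono.
      apply: (wpW (fun k s1 => ctx kk (kk * b + k) s1 /\ stage_state kk k s1) b
        (wg kk) (1500 * Lam.+1)) => //.
      + move=> k s1 kb [cx st]; have [[e2 e3 e4] [e9 e10 e16 e17] _] := cx.
        split.
          rewrite /= e10 e9 e2 ?natE lez_nat.
          by rewrite mulnDl mul1n -addnA leq_add2l addn1 kb.
        apply: wp_mono; first apply: (@wp_step_group _ kk k s1) => //; last first.
        * by move=> s2 w2 d2 [h1 h2 h3 h4].
        * by move=> l ol; split=> // kk' _ ol'; apply: kk_own_inj ol' ol.
        * move=> l l0; split=> // kk' _ /kk_own_arr /andP[].
          by rewrite leqNgt l0.
      + move=> s1 [cx st]; have [[e2 e3 e4] [e9 e10 e16 e17] _] := cx.
        rewrite /= e10 e9 e2 ?natE lez_nat.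
        by rewrite mulnDl mul1n -addnA leq_add2l addn1 ltnn.
      (* Fresh memory encodes the initial weights: they equal b and are stored minus b. *)
      + split; first by rewrite addn0.
        split=> //= [i _|i _|i _|]; rewrite ?hz ?subrr ?big_geq //.
        by split=> k _; rewrite hz.
    move=> s' w1 d1 [[_ [_ _ h3 h4 _]] hw1 hd1]; split=> //.
    + have le : \sum_(k < b)
          (wg kk k + (expr_cost (V 10 + Lit 1 <= (V 9 + Lit 1) * V 2)%X).+1)
          <= \sum_(k < b) (wg kk k + 20) by apply: leq_sum => k _; rewrite leq_add2l.
      move: hw1 le => /=; move: (\sum_(k < b) _) (\sum_(k < b) _) => T T'.
      by clear; lia.
    + by move: hd1 => /=; clear; nia.
move=> s' w1 d1 [er hth hun hw hd]; split=> //.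
- move=> l nl; apply: hun => kk _ /kk_own_arr; exact/negP.
- move=> kk x kkY xb; have [s1 [h1 _] h2] := hth kk kkY.
  by rewrite h2 ?h1 //; apply: Or44; exists x.
- move=> kk i kkY im; have [s1 [_ h1] h2] := hth kk kkY.
  by rewrite h2 ?h1 //; apply: Or41; exists i, 2.
- split; last by move: hd => /=; clear; nia.
  apply: leq_trans hw _.
  pose S kk := \sum_(0 <= x < b) ((\sum_(0 <= t < sz)
     size (sel sets ((kk * b + x) * sz + t))) + sz + 1).
  apply: leq_trans (_ : 2 + \sum_(kk < Y) (1600 * Lam.+1 * S kk + 41) <= _).
    rewrite leq_add2l; apply: leq_sum => kk _; rewrite -addnS leq_add2r.
    rewrite /S big_mkord big_distrr /=; apply: leq_sum => x _.
    by rewrite /wg; move: (\sum_(0 <= t < sz) _) => T; clear; nia.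
  rewrite big_split sum_nat_const card_ord -big_distrr /= -(big_mkord xpredT S) -/(S _).
  by move: (\sum_(0 <= kk < Y) _) => T; clear; nia.
Qed.

End Stage.

(** * Ranks and sizes of the sets within the blocks *)

Definition count_pass : com :=
  ParFor 9 (V 2) (Assign 10 (V 9 * V 2) ;;
    While (V 10 + Lit 1 <= (V 9 + Lit 1) * V 2)
      (Assign 7 (V 10) ;;
      (for_sets (Store 6 (V 6 * V 3 + V 7) (Get 7 (V 9 * V 3 + V 6)) ;;
                 Store 7 (V 9 * V 3 + V 6) (Get 7 (V 9 * V 3 + V 6) + Lit 1)) ;;
      Assign 10 (V 10 + Lit 1)))).

Definition size_pass : com :=
  ParFor 6 (V 1) (Store 8 (V 6) (Get 0 (V 6 + Lit 1) - Get 0 (V 6))).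

Section Count.

Variables B Z : nat.
Local Notation M := (cap Z).
Hypotheses (Z_ge8 : 8 <= Z) (B_ge : fits B M).
Local Notation wp := (wp B M).
Local Notation M_ge8 := (M_ge8 Z_ge8).
Local Notation Z_le_M := (Z_le_M Z_ge8).
Local Notation wpA := (@wp_assign B M M_ge8 B_ge).
Local Notation wpS k := (@wp_store B M M_ge8 B_ge _ _ _ _ _ _ k).
Local Notation wpW I N wc dc := (@wp_while B M M_ge8 B_ge _ _ _ _ _ I N wc dc).
Local Notation wpP k own Q wb db :=
  (@wp_par B M M_ge8 B_ge _ _ _ _ _ _ k own Q wb db).

Variable sets : seq (seq nat).
Local Notation m := (size sets).
Hypothesis m_lt : 2 * m < Z.
Hypotheses (sets_size : forall i, size (nth [::] sets i) <= Z).
Variables (b ell : nat).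
Hypotheses (b_gt0 : 0 < b) (bb_lt : b * b < Z).

(** For [x = b] the size of the set in the block; for an element at position x of the block, its
    rank in the set there. *)
Definition block_count (i kk x : nat) : nat := \sum_(0 <= y < x) inS sets i (kk * b + y).

Lemma block_count_le i kk x : block_count i kk x <= x.
Proof.
elim: x => [|x IH]; first by rewrite /block_count big_geq.
by rewrite /block_count big_nat_recr //= -addn1 leq_add // leq_b1.
Qed.

Definition count_own (kk : nat) (l : loc) : Prop :=
  (exists i x, [/\ x < b, inS sets i (kk * b + x) & l = (6, i * Z + (kk * b + x))]) \/
  (exists2 i, i < m & l = (7, kk * Z + i)).

Definition count_state (kk x : nat) (s : state) : Prop :=
  [/\ linked Z sets ell s, [/\ reg s 2 = Posz b, reg s 9 = Posz kk & reg s 10 = Posz (kk * b + x)],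
      forall i, i < m -> heap s (7, kk * Z + i) = Posz (block_count i kk x) &
      forall i y, y < x -> inS sets i (kk * b + y) ->
        heap s (6, i * Z + (kk * b + y)) = Posz (block_count i kk y)].

(** Each block is scanned sequentially with one counter per set. This takes b rounds, no more than
    the greedy rule itself, so no further trees are needed. *)
Lemma wp_count s :
  linked Z sets ell s -> reg s 2 = Posz b ->
  (forall c, heap s (7, c) = 0%R) ->
  wp any any s count_pass (fun s' w' d' =>
    [/\ reg s' = reg s,
        forall l, l.1 != 6 -> l.1 != 7 -> heap s' l = heap s l,
        forall i kk, i < m -> kk < b -> heap s' (7, kk * Z + i) = Posz (block_count i kk b),
        forall i kk y, kk < b -> y < b -> inS sets i (kk * b + y) ->
          heap s' (6, i * Z + (kk * b + y)) = Posz (block_count i kk y) &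
        w' <= 100 * ((\sum_(0 <= kk < b) \sum_(0 <= x < b)
                  (size (sel sets (kk * b + x)) + 1)) + b + 1)
        /\ d' <= 200 * b.+1]).
Proof.
move=> lk r2 hz; have [r3 r4 _ _] := lk.
have bZ : b < Z by apply: leq_ltn_trans bb_lt; rewrite leq_pmulr.
have mZ : m < Z by move: m_lt; clear; lia.
have jZ kk x : kk < b -> x < b -> kk * b + x < Z.
  by move=> kkb xb; apply: ltn_trans bb_lt; apply: digit_lt.
have own_inj kk kk' l : kk < b -> kk' < b -> count_own kk l -> count_own kk' l -> kk = kk'.
  move=> kkb kk'b [[i [x [xb _ ->]]]|[i im ->]] [[i' [x' [x'b _]]]|[i' im']] // [e].
    have [_ e2] := idx_inj (jZ _ _ kkb xb) (jZ _ _ kk'b x'b) e.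
    by have [] := idx_inj xb x'b e2.
  by have [] := idx_inj (ltn_trans im mZ) (ltn_trans im' mZ) e.
have own_arr kk l : count_own kk l -> l.1 = 6 \/ l.1 = 7.
  by case=> [[i [x [_ _ ->]]]|[i _ ->]]; [left|right].
pose wg kk x := 10 + size (sel sets (kk * b + x)) * 50 + 10.
apply: wp_mono.
  apply: (wpP b count_own (fun kk s' =>
    (forall i, i < m -> heap s' (7, kk * Z + i) = Posz (block_count i kk b)) /\
    (forall i y, y < b -> inS sets i (kk * b + y) ->
        heap s' (6, i * Z + (kk * b + y)) = Posz (block_count i kk y)))
    (fun kk => \sum_(k < b) (wg kk k + 20) + 40) (b * 120 + 40)) => //.
  - by apply: leq_trans Z_le_M; apply: ltnW.
  - move=> kk kkb.
    have kkbZ : kk * b < Z by apply: leq_ltn_trans bb_lt; rewrite leq_mul2r ltnW ?orbT.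
    apply: wp_seq; apply: wpA; rewrite //= ?r2 ?natE /=.
      by apply: leq_trans Z_le_M; apply: ltnW.
    apply: wp_mono.
      apply: (wpW (count_state kk) b (wg kk) 100) => //.
      + move=> x s1 xb [lk1 [e2 e9 e10] h7 h6]; have [e3 e4 _ _] := lk1.
        split.
          rewrite /= e10 e9 e2 ?natE lez_nat.
          by rewrite mulnDl mul1n -addnA leq_add2l addn1 xb.
        set j := kk * b + x; have jlt := jZ _ _ kkb xb; rewrite -/j in jlt.
        apply: wp_seq; apply: wpA; rewrite //= ?e10 //=.
          by apply: leq_trans Z_le_M; apply: ltnW.
        apply: wp_seq; apply: wp_use.
          apply: (@wp_for_sets B Z Z_ge8 B_ge sets mZ ell
            (fun l => any l /\ (forall k, k < b -> count_own k l -> k = kk))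
            (count_own kk) _ _ j
            (fun i l => l = (6, i * Z + j) \/ l = (7, kk * Z + i))
            (fun i s' => heap s' (6, i * Z + j) = Posz (block_count i kk x) /\
               heap s' (7, kk * Z + i) = Posz (block_count i kk x.+1)) 40 40) => //=.
          * by move=> l l35; split=> // k _ /own_arr l67; case: l35 => e; case: l67; rewrite e.
          * by move=> i l [->|->].
          * move=> i l ij [->|->]; first by left; exists i, x.
            by right; exists i => //; apply: inS_lt ij.
          * move=> i i' l ij ij' [->|->] [|] // [e].
              by have [] := idx_inj jlt jlt e.
            by move/addnI: e.
          * move=> r i rs ei ij; have im := inS_lt ij.
            have c_le := block_count_le i kk x.
            have own7 : any (7, kk * Z + i) /\ (forall k, k < b -> count_own k (7, kk * Z + i) -> k = kk).
              split=> // k kb ok; apply: own_inj ok _ => //; by right; exists i.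
            have own7' i' : inS sets i' j ->
                (7, kk * Z + i) = (6, i' * Z + j) \/ (7, kk * Z + i) = (7, kk * Z + i') -> i' = i.
              by move=> _ [//|[/addnI ->]].
            apply: wp_seq; apply: (wpS (i * Z + j)); rewrite //= ?e3 ?e9 ?natE /= ?h7 //.
            -- by ok_split; exists (kk * Z + i).
            -- by left.
            -- by move: c_le xb bZ Z_le_M; rewrite /=; clear; lia.
            apply: (wpS (kk * Z + i)); rewrite //= ?e3 ?e9 ?natE /= ?h7 //.
            -- by ok_split; exists (kk * Z + i).
            -- by right.
            -- by move: c_le xb bZ Z_le_M; rewrite /=; clear; lia.
            split=> //; split; first by rewrite eqxx.
            by rewrite eqxx /block_count [in RHS]big_nat_recr //= -/j ij.
        * by move=> l hl; exact: hl.
        * by move=> l hl; exact: hl.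
        move=> s2 w2 d2 _ [er2 hth2 hun2 hw2 hd2] hf2 hr2.
        apply: wpA; rewrite //= ?er2 /= ?e10 //=.
          by apply: leq_trans Z_le_M; move: jlt; rewrite /j; clear; lia.
        split.
        -- split.
           ++ move: lk1 => [l1 l2 l3 l4]; split; rewrite /= ?er2 //=.
                by move=> j' j'Z; rewrite hun2 ?l3 // => i _ [|].
              by move=> j' r j'Z rs; rewrite hun2 ?l4 // => i _ [|].
           ++ by split; rewrite /= ?er2 //= ?natE /j ?addnS ?addn0.
           ++ move=> i im; rewrite [LHS]/= /block_count big_nat_recr //= -/(block_count _ _ _) -/j.
              case: (boolP (inS sets i j)) => ij.
                have [s3 [_ h3] e] := hth2 i ij; rewrite e; last by right.
                by rewrite h3 /block_count big_nat_recr //= -/j ij.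
              rewrite hun2 /= ?h7 ?addn0 // => i' ij' [//|[/addnI ei]].
              by rewrite ei ij' in ij.
           ++ move=> i y; rewrite ltnS leq_eqVlt => /orP[/eqP ->|yx] ij; rewrite [LHS]/=.
                by have [s3 [h3 _] e] := hth2 i ij; rewrite e //; left.
              rewrite hun2 /= ?h6 // => i' ij' [[e]|//].
              have [_ /addnI ey] := idx_inj (jZ _ _ kkb (ltn_trans yx xb)) jlt e.
              by rewrite ey ltnn in yx.
        -- by rewrite /wg; move: hw2; rewrite -/j; clear; lia.
        -- by move: hd2; clear; lia.
      + move=> s1 [_ [e2 e9 e10] _ _]; rewrite /= e10 e9 e2 ?natE lez_nat.
        by rewrite mulnDl mul1n -addnA leq_add2l addn1 ltnn.
      + split=> //=; first by rewrite addn0.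
        by move=> i _; rewrite hz /block_count big_geq.
    move=> s' w1 d1 [[_ _ h7 h6] hw1 hd1]; split=> //.
    + have le : \sum_(k < b)
          (wg kk k + (expr_cost (V 10 + Lit 1 <= (V 9 + Lit 1) * V 2)%X).+1)
          <= \sum_(k < b) (wg kk k + 20) by apply: leq_sum => k _; rewrite leq_add2l.
      move: hw1 le => /=; move: (\sum_(k < b) _) (\sum_(k < b) _) => T T'.
      by clear; lia.
    + by move: hd1 => /=; clear; lia.
move=> s' w1 d1 [er hth hun hw hd]; split=> //.
- by move=> l l6 l7; apply: hun => kk _ /own_arr[] e; [rewrite e in l6|rewrite e in l7].
- move=> i kk im kkb; have [s1 [h7 _] e] := hth kk kkb.
  by rewrite e ?h7 //; right; exists i.
- move=> i kk y kkb yb ij; have [s1 [_ h6] e] := hth kk kkb.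
  by rewrite e ?h6 //; left; exists i, y.
- split; last by move: hd => /=; clear; lia.
  apply: leq_trans hw _.
  pose S kk := \sum_(0 <= x < b) (size (sel sets (kk * b + x)) + 1).
  apply: leq_trans (_ : 2 + \sum_(kk < b) (60 * S kk + 41) <= _).
    rewrite leq_add2l; apply: leq_sum => kk _; rewrite -addnS leq_add2r.
    rewrite /S big_mkord big_distrr /=; apply: leq_sum => x _.
    by rewrite /wg; move: (size _) => T; clear; lia.
  rewrite big_split sum_nat_const card_ord -big_distrr /= -(big_mkord xpredT S) -/(S _).
  by move: (\sum_(0 <= kk < b) _) => T; clear; lia.
Qed.

Lemma wp_size s : has_input sets s ->
  wp any any s size_pass (fun s' w' d' =>
    [/\ reg s' = reg s,
        forall l, l.1 != 8 -> heap s' l = heap s l,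
        forall i, i < m -> heap s' (8, i) = Posz (size (nth [::] sets i)) &
        w' <= 40 * m.+1 /\ d' <= 40]).
Proof.
move=> [r1 h0 h1].
apply: wp_mono.
  apply: (wpP m (fun i l => l = (8, i))
    (fun i s' => heap s' (8, i) = Posz (size (nth [::] sets i))) (fun _ => 30) 30) => //.
  - by apply: leq_trans Z_le_M; move: m_lt; clear; lia.
  - by move=> i i' l _ _ -> [].
  - move=> i im; have dE : (Posz (offset sets (i + 1)) - Posz (offset sets i))%R
        = Posz (size (nth [::] sets i)).
      by rewrite addn1 offsetS PoszD addrC addKr.
    apply: (wpS i); rewrite //= ?h0 ?addn1 //; try exact: ltnW.
    + by ok_split; [exists i.+1 => //; rewrite -[in RHS]addn1|exists i].
    + by rewrite -addn1 dE; apply: leq_trans Z_le_M; apply: sets_size.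
    + by split=> //; rewrite eqxx -addn1 dE.
move=> s' w1 d1 [er hth hun hw hd]; split=> //.
- by move=> l l8; apply: hun => i _ e; rewrite e in l8.
- by move=> i im; have [s1 e1 e2] := hth i im; rewrite e2.
- by move: hw hd; rewrite sum_nat_const card_ord /=; clear; lia.
Qed.

End Count.

(** * The whole program and its parameters *)

Definition prelude : com :=
  Assign 2 (Lit 1) ;;
  (While (V 2 * V 2 + Lit 1 <= V 0) (Assign 2 (V 2 + Lit 1)) ;;
   Assign 3 (Lit 8 * (V 0 + Lit 1) * (V 1 + Lit 1))).

(** Array 9 is never written, so every element is a representative. The coefficients are the leaf
    level of array 3, and the height in register 4 stands for log m in the rate. *)
Definition first_stage : com :=
  Assign 15 (V 2) ;; (Assign 16 (Lit 1) ;; (Assign 17 (V 4) ;; stage 1 9 7 3)).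

(** Array 6 marks the first element of a set in a block by rank 0; array 12 is [arr 1 2], the block
    discrepancies left by the first stage. The value 1 in register 17 makes the rate of order
    [sqrt |S_i|]. *)
Definition second_stage : com :=
  Assign 15 (Lit 1) ;; (Assign 16 (V 2) ;; (Assign 17 (Lit 1) ;; stage 2 6 8 12)).

Definition combine : com :=
  ParFor 7 (V 0) (Store 2 (V 7) (Get (arr 1 5) (V 7) * Get (arr 2 5) (V 7 / V 2))).

Definition main : com :=
  prelude ;; (transpose ;; (count_pass ;; (size_pass ;;
  (first_stage ;; (second_stage ;; combine))))).

(** The successor keeps the side positive when [n = 0]. *)
Definition side (n : nat) : nat :=
  (find (fun k => n <= k.+1 * k.+1) (iota 0 n.+1)).+1.

Lemma side_ge n : n <= side n * side n.
Proof.
rewrite /side; set p := fun k => _; set s := iota _ _.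
have hs : has p s.
  by apply/hasP; exists n; [rewrite /s mem_iota add0n leqnn|rewrite /p; lia].
have f_lt : find p s < n.+1 by rewrite -[n.+1](size_iota 0) -has_find.
by have := nth_find 0 hs; rewrite nth_iota // add0n.
Qed.

Lemma side_lt n k : k.+1 < side n -> k.+1 * k.+1 < n.
Proof.
rewrite /side ltnS => kN; have := before_find 0 kN; rewrite nth_iota ?add0n.
  by rewrite ltnNge => ->.
by apply: leq_trans kN _; rewrite -[X in _ <= X](size_iota 0) find_size.
Qed.

(** A side of at least 2 is at most twice its predecessor, whose square is below n by minimality. *)
Lemma side_le n : side n * side n <= 4 * n.+1.
Proof.
case E : (side n) => [|[|k]] //.
by have := @side_lt n k; rewrite E => /(_ (leqnn _)); nia.
Qed.

(** * The two colourings as instances of the greedy rule *)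

Section Data.

Variables (n : nat) (sets : seq (seq nat)) (ell : nat).
Local Notation m := (size sets).
Local Notation b := (side n).

Definition rep1 (i j : nat) : nat := 0.
Definition coef1 (g i : nat) : int := Posz (inS sets i g).
Definition count1 (kk i : nat) : nat := block_count sets b i kk b.
Definition sign1 : nat -> nat -> int :=
  greedy_sign m b (in_group sets 1 rep1) (group_coef b ell coef1 count1) (group_rate ell count1).
(** For an element of the set i this is its rank in the set within its block, hence 0 only at the
    first one. *)
Definition rep2 (i j : nat) : nat := block_count sets b i (j %/ b) (j %% b).
Definition coef2 (g i : nat) : int :=
  (\sum_(0 <= y < b) sign1 g y * ((in_group sets 1 rep1 i (g * b + y))%:R
           * coef1 (g * b + y) i))%R.
Definition count2 (kk i : nat) : nat := size (nth [::] sets i).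
Definition sign2 : nat -> nat -> int :=
  greedy_sign m b (in_group sets b rep2) (group_coef b 1 coef2 count2) (group_rate 1 count2).

Lemma sign1P g y : sign1 g y = 1%R \/ sign1 g y = (- 1)%R.
Proof. exact: greedy_signP. Qed.

Lemma sign2P g y : sign2 g y = 1%R \/ sign2 g y = (- 1)%R.
Proof. exact: greedy_signP. Qed.

Lemma in_group1 i g : in_group sets 1 rep1 i g = inS sets i g.
Proof. by rewrite /in_group /= muln1 addn0 eqxx andbT orbF. Qed.

Lemma coef2E g i :
  coef2 g i = (\sum_(0 <= y < b) sign1 g y * Posz (inS sets i (g * b + y)))%R.
Proof.
rewrite /coef2; apply: eq_bigr => y _; rewrite in_group1 /coef1.
by case: inS; rewrite ?mulr1 ?mulr0.
Qed.

Lemma coef2_le g i : `|coef2 g i| <= b.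
Proof.
rewrite coef2E -[X in _ <= X]muln1; apply: (@absz_sum_le (fun y => sign1 g y * Posz (inS sets i (g * b + y)))%R 1) => y.
by case: (sign1P g y) => ->; case: inS.
Qed.

Lemma block_count_pos i kk x y : y < x -> inS sets i (kk * b + y) ->
  0 < block_count sets b i kk x.
Proof.
move=> yx iy; rewrite /block_count big_mkord (bigD1 (Ordinal yx)) //= iy.
by rewrite addn_gt0.
Qed.

Lemma rep2E i g t : t < b -> rep2 i (g * b + t) = block_count sets b i g t.
Proof.
by move=> tb; rewrite /rep2 divnMDl // divn_small // addn0 modnMDl modn_small.
Qed.

Lemma rep2_uniq i g t t' : t < b -> t' < b ->
  inS sets i (g * b + t) -> inS sets i (g * b + t') ->
  rep2 i (g * b + t) = 0 -> rep2 i (g * b + t') = 0 -> t = t'.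
Proof.
wlog tt' : t t' / t <= t'.
  move=> W tb t'b it it' rt rt'; case: (leqP t t') => [|/ltnW] le; first exact: W.
  by apply/esym; apply: W.
move=> tb t'b it it' _; rewrite rep2E // => r0.
case: (ltngtP t t') tt' => // lt _.
by have := block_count_pos lt it; rewrite r0.
Qed.

End Data.

Section Main.

Variables B n : nat.
Variable sets : seq (seq nat).
Local Notation m := (size sets).
Local Notation b := (side n).
Hypothesis m_gt1 : 1 < m.
Hypothesis sets_uniq : forall i, uniq (nth [::] sets i).
Hypothesis sets_lt : forall i j, inS sets i j -> j < n.

Definition span : nat := 8 * n.+1 * m.+1.
Local Notation Z := span.
Local Notation M := (cap Z).
Hypothesis B_ge : fits B M.
Variable Lam : nat.
Hypothesis Z_lt : log_bound Z Lam.
Local Notation wp := (wp B M).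

(** The last bound is the tight one: [b^3 <= b^4 <= 16 (n + 1)^2], so [16 m^2 b^3] is at most
    [256 (m + 1)^2 (n + 1)^2 = 4 Z^2], and [4 <= Z]. *)
Lemma span_facts : [/\ 8 <= Z, 2 * m < Z, b * b < Z & 2 * b < Z] /\
  [/\ n < Z, 4 * Z <= M & 4 * (b * (4 * m * b)) * (m * b) <= M].
Proof.
have bb := side_le n; have b0 : 0 < b by [].
have zE : Z = 8 * (n.+1 * m.+1) by rewrite /span mulnA.
have nm : 2 * n.+1 <= n.+1 * m.+1 by move: m_gt1; clear; move: (n.+1) (m) => x y; nia.
have mn : m.+1 <= n.+1 * m.+1 by rewrite leq_pmull.
have Z8 : 8 <= Z by rewrite zE leq_pmulr.
have bb1 : b <= b * b by rewrite leq_pmulr.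
split; first by split=> //; rewrite zE; lia.
split; first by rewrite zE; lia.
  by rewrite /cap !expnS expn0 muln1; move: Z8; clear; move: Z => z; nia.
have h1 : b * b * (b * b) <= 16 * (n.+1 * n.+1).
  by apply: leq_trans (leq_mul bb bb) _; rewrite mulnACA.
have h2 : m * m <= m.+1 * m.+1 by apply: leq_mul.
have h3 : b * b * b <= b * b * (b * b) by rewrite leq_mul2l bb1 orbT.
apply: leq_trans (_ : 16 * (m * m) * (b * b * b) <= _).
  by move: (b) => x; clear; lia.
apply: leq_trans (_ : 16 * (m.+1 * m.+1) * (16 * (n.+1 * n.+1)) <= _).
  by apply: leq_mul; [rewrite leq_mul2l h2 orbT|apply: leq_trans h3 h1].
have -> : 16 * (m.+1 * m.+1) * (16 * (n.+1 * n.+1)) = 4 * (Z * Z).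
  by rewrite zE; move: (n.+1) (m.+1) => x y; clear; lia.
by rewrite /cap !expnS expn0 muln1 leq_mul2r; apply/orP; right; move: Z8; clear; lia.
Qed.

Let Z_ge8 : 8 <= Z. Proof. by case: span_facts => [[]]. Qed.
Let m_lt : 2 * m < Z. Proof. by case: span_facts => [[]]. Qed.
Let bb_lt : b * b < Z. Proof. by case: span_facts => [[]]. Qed.
Let b_lt : 2 * b < Z. Proof. by case: span_facts => [[]]. Qed.
Let n_lt : n < Z. Proof. by case: span_facts => _ []. Qed.
Let Z4_le : 4 * Z <= M. Proof. by case: span_facts => _ []. Qed.
Let W0_le : 4 * (b * (4 * m * b)) * (m * b) <= M. Proof. by case: span_facts => _ []. Qed.
Let m_gt0 : 0 < m. Proof. exact: ltnW. Qed.

Local Notation M_ge8 := (M_ge8 Z_ge8).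
Local Notation Z_le_M := (Z_le_M Z_ge8).
Local Notation wpA := (@wp_assign B M M_ge8 B_ge).
Local Notation wpS k := (@wp_store B M M_ge8 B_ge _ _ _ _ _ _ k).
Local Notation wpW I N wc dc := (@wp_while B M M_ge8 B_ge _ _ _ _ _ I N wc dc).
Local Notation wpP k own Q wb db :=
  (@wp_par B M M_ge8 B_ge _ _ _ _ _ _ k own Q wb db).

Lemma size_set_le i : size (nth [::] sets i) <= n.
Proof.
rewrite -[X in _ <= X](size_iota 0); apply: uniq_leq_size (sets_uniq i) _ => j ij.
by rewrite mem_iota /= add0n (sets_lt ij).
Qed.

Let sets_ltZ i j : inS sets i j -> j < Z.
Proof. by move=> /sets_lt h; apply: ltn_trans h n_lt. Qed.

Let sets_sizeZ i : size (nth [::] sets i) <= Z.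
Proof. exact: leq_trans (size_set_le i) (ltnW n_lt). Qed.

(** The side is found by linear search; its b sequential rounds fit into the depth that the stages
    need anyway. *)
Lemma wp_prelude s : reg s 0 = Posz n -> reg s 1 = Posz m ->
  wp any (fun _ => False) s prelude (fun s' w d =>
    [/\ reg s' 2 = Posz b, reg s' 3 = Posz Z, w <= 30 * b + 30 & d <= 30 * b + 30]).
Proof.
move=> r0 r1; have [b' eb] : exists b', b = b'.+1 by eexists.
have b_ltZ := b_lt; have lt_n := @side_lt n; have n_le := side_ge n.
rewrite eb in b_ltZ lt_n n_le *; clear eb.
apply: wp_seq; apply: wpA; rewrite //=.
apply: wp_seq; apply: wp_mono.
  apply: (wpW (fun k s1 => [/\ reg s1 2 = Posz k.+1, reg s1 0 = Posz n & reg s1 1 = Posz m])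
    b' (fun _ => 10) 10) => //.
  - move=> k s1 kb [e2 e0 e1]; split.
      rewrite /= e2 e0 ?natE lez_nat addn1.
      by rewrite (lt_n k).
    apply: wpA; rewrite //= e2 ?natE /=.
      by apply: leq_trans Z_le_M; move: kb b_ltZ; clear; lia.
    by split; rewrite //= addn1.
  - move=> s1 [e2 e0 e1]; rewrite /= e2 e0 ?natE lez_nat addn1.
    by rewrite ltnNge n_le.
move=> s1 w1 d1 [[e2 e0 e1] hw hd].
apply: wpA; rewrite //= ?e0 ?e1 ?natE /= ?addn1 -?/Z.
  exact: Z_le_M.
split=> //.
- by move: hw; rewrite sum_nat_const card_ord /=; clear; lia.
- by move: hd => /=; clear; lia.
Qed.

Lemma wp_first_stage s ell : 0 < ell -> linked Z sets ell s -> reg s 2 = Posz b ->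
  (forall j v, j < Z -> v < Z -> heap s (3, j * Z + v) = Posz (inS sets v j)) ->
  (forall i kk, i < m -> kk < b -> heap s (7, kk * Z + i) = Posz (count1 n sets kk i)) ->
  (forall c, heap s (9, c) = 0%R) ->
  (forall k c, k < 5 -> heap s (arr 1 k, c) = 0%R) ->
  wp any any s first_stage (fun s' w d =>
    [/\ forall l, ~~ (10 <= l.1 <= 15) -> heap s' l = heap s l,
        forall kk x, kk < b -> x < b ->
          heap s' (arr 1 5, kk * b + x) = sign1 n sets ell kk x,
        forall kk i, kk < b -> i < m ->
          heap s' (arr 1 2, kk * Z + i) = coef2 n sets ell kk i &
        w <= 2000 * Lam.+1 * ((\sum_(0 <= kk < b) \sum_(0 <= x < b)
                (size (sel sets (kk * b + x)) + 2)) + b + 1) + 20 /\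
        d <= 2000 * Lam.+1 * b.+1 + 20]).
Proof.
move=> ell0 [r3 r4 hcnt hlst] r2 hT hc h9 hz.
have bM : b <= M by apply: leq_trans Z_le_M; move: b_lt; clear; lia.
have ellM : `|reg s 4| <= M -> ell <= M by rewrite r4.
apply: wp_small => -[sr _]; have {}ellM := ellM (sr 4).
apply: wp_seq; apply: wpA; rewrite //= ?r2 //=.
apply: wp_seq; apply: wpA; rewrite //=.
apply: wp_seq; apply: wpA; rewrite //= ?r4 //=.
apply: wp_mono.
  apply: (@wp_stage B Z Z_ge8 B_ge Lam Z_lt sets m_lt m_gt0 1 9 7 3 b b 1 ell ell
    rep1 (coef1 sets) (count1 n sets) (heap s)) => //=; rewrite ?muln1 //.
  - by move=> i g im gb; rewrite hT //; [apply: ltn_trans gb bb_lt|move: im m_lt; clear; lia].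
  - move=> i kk im kkb; apply: leq_ltn_trans (block_count_le _ _ _ _ _) _.
    by move: b_lt; clear; lia.
  - by move=> i g; rewrite /coef1; case: inS.
  - by move=> i g [|t] [|t'].
move=> s' w d [er hf hG hS [hw hd]]; split=> //.
have e : \sum_(0 <= kk < b) \sum_(0 <= x < b)
      (\sum_(0 <= t < 1) size (sel sets ((kk * b + x) * 1 + t)) + 1 + 1)
   = \sum_(0 <= kk < b) \sum_(0 <= x < b) (size (sel sets (kk * b + x)) + 2).
  apply: eq_bigr => kk _; apply: eq_bigr => x _.
  by rewrite big_nat1 muln1 addn0 -addnA.
rewrite e in hw; split; last by move: hd; clear; lia.
by move: hw; move: (\sum_(0 <= kk < b) _) => T; clear; lia.
Qed.

Lemma wp_second_stage s ell : linked Z sets ell s -> reg s 2 = Posz b ->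
  (forall i j, inS sets i j -> heap s (6, i * Z + j) = Posz (rep2 n sets i j)) ->
  (forall i, i < m -> heap s (8, i) = Posz (size (nth [::] sets i))) ->
  (forall kk i, kk < b -> i < m -> heap s (12, kk * Z + i) = coef2 n sets ell kk i) ->
  (forall k c, k < 5 -> heap s (arr 2 k, c) = 0%R) ->
  wp any any s second_stage (fun s' w d =>
    [/\ forall l, ~~ (20 <= l.1 <= 25) -> heap s' l = heap s l,
        forall x, x < b -> heap s' (arr 2 5, x) = sign2 n sets ell 0 x &
        w <= 2000 * Lam.+1 * ((\sum_(0 <= x < b)
           ((\sum_(0 <= t < b) size (sel sets (x * b + t))) + b + 1)) + 2) + 20 /\
        d <= 2000 * Lam.+1 * b.+1 + 20]).
Proof.
move=> [r3 r4 hcnt hlst] r2 hX hC hS1 hz.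
have bM : b <= M by apply: leq_trans Z_le_M; move: b_lt; clear; lia.
apply: wp_seq; apply: wpA; rewrite //=.
apply: wp_seq; apply: wpA; rewrite //= ?r2 //=.
apply: wp_seq; apply: wpA; rewrite //=.
apply: wp_mono.
  apply: (@wp_stage B Z Z_ge8 B_ge Lam Z_lt sets m_lt m_gt0 2 6 8 12 b 1 b 1 ell
    (rep2 n sets) (coef2 n sets ell) (count2 sets) (heap s)) => //=; rewrite ?mul1n //.
  - by move=> i [|kk] // im _; rewrite hC.
  - by move=> i g im gb; rewrite hS1.
  - by move=> i kk _ _; apply: leq_ltn_trans (size_set_le i) n_lt.
  - by move=> i g; apply: coef2_le.
  - by move=> i g t t'; apply: rep2_uniq.
move=> s' w d [er hf hG hS [hw hd]]; split=> //.
- by move=> x xb; have := hG 0 x; rewrite mul0n => ->.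
rewrite big_nat1 in hw.
have e : \sum_(0 <= x < b) (\sum_(0 <= t < b) size (sel sets ((0 * b + x) * b + t)) + b + 1)
   = \sum_(0 <= x < b) (\sum_(0 <= t < b) size (sel sets (x * b + t)) + b + 1).
  by apply: eq_bigr => x _; rewrite mul0n.
rewrite e in hw; split; last by move: hd; clear; lia.
by move: hw; move: (\sum_(0 <= x < b) _) => T; clear; lia.
Qed.

Lemma wp_combine s (f g : nat -> int) : reg s 0 = Posz n -> reg s 2 = Posz b ->
  (forall j, j < n -> heap s (arr 1 5, j) = f j) ->
  (forall j, j < n -> heap s (arr 2 5, j %/ b) = g j) ->
  (forall j, absz (f j * g j)%R <= 1) ->
  wp any any s combine (fun s' w d =>
    [/\ forall j, j < n -> heap s' (2, j) = (f j * g j)%R,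
        w <= 30 * n + 30 & d <= 60]).
Proof.
move=> r0 r2 hf hg fg.
apply: wp_mono.
  apply: (wpP n (fun j l => l = (2, j)) (fun j s' => heap s' (2, j) = (f j * g j)%R)
    (fun _ => 20) 20) => //.
  - exact: leq_trans (ltnW n_lt) Z_le_M.
  - by move=> i i' l _ _ -> [].
  - move=> j jn; apply: (wpS j); rewrite //= ?r2 ?divz_nat /= ?hf ?hg //.
    + by ok_split; [exists j|exists (j %/ b)].
    + exact: leq_trans (fg j) (leq_trans _ M_ge8).
    + by split=> //; rewrite eqxx.
move=> s' w d [er hth _ hw hd]; split=> //.
- by move=> j jn; have [s1 e1 e2] := hth j jn; rewrite e2.
- by move: hw; rewrite sum_nat_const card_ord /=; clear; lia.
- by move: hd => /=; clear; lia.
Qed.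

End Main.

Lemma big_nat_mul (R : Type) (idx : R) (op : Monoid.law idx) (F : nat -> R) (a c : nat) :
  \big[op/idx]_(0 <= k < a) \big[op/idx]_(0 <= x < c) F (k * c + x)
    = \big[op/idx]_(0 <= j < a * c) F j.
Proof.
elim: a => [|a IH]; first by rewrite !big_geq.
rewrite big_nat_recr //= IH (@big_cat_nat _ _ _ (a * c) 0 (a.+1 * c)) //=; last first.
  by rewrite leq_mul2r leqnSn orbT.
congr (op _ _); rewrite mulSn; have := big_addn 0 (c + a * c) (a * c) xpredT F.
by rewrite add0n addnK => ->; apply: eq_bigr => x _; rewrite addnC.
Qed.

Lemma sum_mem (s : seq nat) (K : nat) : uniq s -> (forall j, j \in s -> j < K) ->
  \sum_(0 <= j < K) (j \in s) = size s.
Proof.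
move=> us sK; have p : perm_eq [seq j <- iota 0 K | j \in s] s.
  apply: uniq_perm => //; first by rewrite filter_uniq ?iota_uniq.
  move=> j; rewrite mem_filter mem_iota /= add0n.
  by case: (boolP (j \in s)) => // /sK ->.
rewrite -(perm_size p) size_filter -sum1_count /index_iota subn0 [RHS]big_mkcond.
by apply: eq_bigr => j _; case: (j \in s).
Qed.

Section Main.

Variables B n : nat.
Variable sets : seq (seq nat).
Local Notation m := (size sets).
Local Notation b := (side n).
Hypothesis m_gt1 : 1 < m.
Hypothesis sets_uniq : forall i, uniq (nth [::] sets i).
Hypothesis sets_lt : forall i j, inS sets i j -> j < n.
Local Notation Z := (span n sets).
Local Notation M := (cap Z).
Hypothesis B_ge : fits B M.
Variable Lam : nat.
Hypothesis Z_lt : log_bound Z Lam.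
Local Notation wp := (wp B M).

Let facts := span_facts n m_gt1.
Let Z_ge8 : 8 <= Z. Proof. by case: facts => [[]]. Qed.
Let m_lt : 2 * m < Z. Proof. by case: facts => [[]]. Qed.
Let bb_lt : b * b < Z. Proof. by case: facts => [[]]. Qed.
Let n_lt : n < Z. Proof. by case: facts => _ []. Qed.
Let sets_ltZ i j : inS sets i j -> j < Z.
Proof. by move=> /sets_lt h; apply: ltn_trans h n_lt. Qed.
Let sets_sizeZ i : size (nth [::] sets i) <= Z.
Proof. exact: leq_trans (size_set_le sets_uniq sets_lt i) (ltnW n_lt). Qed.

Lemma sumn_shape : sumn (shape sets) = \sum_(0 <= i < m) size (nth [::] sets i).
Proof. by rewrite sumnE big_map (big_nth [::]). Qed.

(** Double counting of the incidences; indices from n on lie in no set. *)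
Lemma sum_sel : \sum_(0 <= j < b * b) size (sel sets j) = sumn (shape sets).
Proof.
rewrite sumn_shape.
have -> : \sum_(0 <= j < b * b) size (sel sets j)
   = \sum_(0 <= j < b * b) \sum_(0 <= i < m) inS sets i j.
  apply: eq_bigr => j _; rewrite size_filter -sum1_count /index_iota subn0 big_mkcond.
  by apply: eq_bigr => i _; case: (inS sets i j).
rewrite exchange_big; apply: eq_bigr => i _; apply: sum_mem => // j ij.
exact: leq_trans (sets_lt ij) (side_ge n).
Qed.

Lemma has_input_state : has_input sets (input_state n sets).
Proof.
split=> // [i im|i r im rs]; first by rewrite /= [nth _ _ _]nth_offset.
by rewrite /= nth_flatten_offset.
Qed.

Lemma sumn_shape_le : sumn (shape sets) <= n * m.
Proof.
rewrite sumn_shape -[X in n * X]subn0 mulnC -sum_nat_const_nat; apply: leq_sum => i _.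
exact: size_set_le.
Qed.

Lemma offset_le i : offset sets i <= sumn (shape sets).
Proof.
by rewrite /offset -[in X in _ <= X](cat_take_drop i (shape sets)) sumn_cat leq_addr.
Qed.

Lemma small_input : small M (input_state n sets).
Proof.
have ZM := Z_le_M Z_ge8.
split=> [[|[|x]] //=|[[|[|a]] k] //=].
- exact: leq_trans (ltnW n_lt) ZM.
- by apply: leq_trans ZM; move: m_lt; clear; lia.
- case: (leqP k m) => km; last by rewrite nth_default //= size_scanl size_map.
  rewrite [nth _ _ _]nth_offset //; apply: leq_trans (offset_le k) _.
  apply: leq_trans sumn_shape_le _; rewrite /cap !expnS expn0 muln1.
  have : n * m <= Z by rewrite /span -mulnA; move: (m) => x; clear; nia.
  by move=> h; apply: leq_trans h _; rewrite leq_pmulr // muln_gt0; move: Z_ge8; clear; lia.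
- case: (ltnP k (size (flatten sets))) => ks; last by rewrite nth_default.
  have /flattenP[s ss ks'] := mem_nth 0 ks.
  apply: leq_trans ZM; apply/ltnW/(@sets_ltZ (index s sets)).
  by rewrite /inS nth_index.
Qed.

Lemma wp_main :
  wp any any (input_state n sets) main (fun s' w d => exists ell,
    [/\ 0 < ell, m < 2 ^ ell /\ (forall k, k < ell -> 2 ^ k <= m),
        forall j, j < n -> heap s' (2, j) =
          (sign1 n sets ell (j %/ b) (j %% b) * sign2 n sets ell 0 (j %/ b))%R,
        w <= 200 * 100 * Lam.+1 * (b * b + sumn (shape sets) + m)
      & d <= 200 * 100 * Lam.+1 * b]).
Proof.
have b0 : 0 < b by [].
have hi := has_input_state.
apply: wp_seq; apply: wp_use.
  exact: (@wp_prelude B n sets m_gt1 B_ge (input_state n sets)).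
- by [].
- by [].
move=> s1 w1 d1 _ [e2 e3 hw1 hd1] hf1 hr1.
have h1 l : heap s1 l = heap (input_state n sets) l by exact: hf1.
have hi1 : has_input sets s1 by apply: has_input_frame hi => //; rewrite hr1.
apply: wp_seq; apply: wp_use.
  apply: (@wp_transpose B Z Z_ge8 B_ge sets sets_uniq sets_ltZ sets_sizeZ m_lt Lam Z_lt s1) => //.
  by move=> [a k]; rewrite h1 !inE /= => /or3P[] /eqP ->.
- by [].
- by [].
move=> s2 w2 d2 _ [ell [lk2 [mell ellm] hT2 hf2 [hw2 hd2]]] _ hr2.
have ell0 : 0 < ell by case: ell mell {ellm lk2} => //; move: m_gt1; clear; lia.
have fr2 a c : a \notin [:: 0; 1; 3; 4; 5] -> heap s2 (a, c) = 0%R.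
  move=> na; rewrite hf2 ?h1; last by apply: contra na => /=; rewrite !inE => /or3P[]->; rewrite ?orbT.
  by case: a na => [|[|a]].
have e22 : reg s2 2 = Posz b by rewrite hr2.
have hi2 : has_input sets s2.
  apply: has_input_frame hi1; first by rewrite hr2.
  by move=> [[|[|a]] c] // _; apply: hf2.
apply: wp_seq; apply: wp_mono.
  apply: (@wp_count B Z Z_ge8 B_ge sets m_lt b ell b0 bb_lt s2) => //.
  by move=> c; apply: fr2.
move=> s3 w3 d3 [er3 hf3 hC3 hX3 [hw3 hd3]].
have hi3 : has_input sets s3.
  apply: has_input_frame hi2; first by rewrite er3.
  by move=> [[|[|a]] c] // _; apply: hf3.
apply: wp_seq; apply: wp_mono.
  exact: (@wp_size B Z Z_ge8 B_ge sets m_lt sets_sizeZ s3).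
move=> s4 w4 d4 [er4 hf4 hS4 [hw4 hd4]].
have f42 a c : a \notin [:: 6; 7; 8] -> heap s4 (a, c) = heap s2 (a, c).
  by rewrite !inE !negb_or => /and3P[a6 a7 a8]; rewrite hf4 // hf3.
have lk4 : linked Z sets ell s4.
  case: lk2 => l1 l2 l3 l4; split; rewrite ?er4 ?er3 //.
    by move=> j jZ; rewrite f42 // l3.
  by move=> j r jZ rs; rewrite f42 // l4.
have z4 a c : 9 <= a -> heap s4 (a, c) = 0%R.
  by move=> a9; rewrite f42 ?fr2 //; move: a9; rewrite !inE; clear; lia.
apply: wp_seq; apply: wp_use.
  apply: (@wp_first_stage B n sets m_gt1 B_ge Lam Z_lt s4 ell) => //.
  - by rewrite er4 er3.
  - by move=> j v jZ vZ; rewrite f42 // hT2.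
  - by move=> i kk im kkb; rewrite hf4 // hC3.
  - by move=> c; apply: z4.
  - by move=> k c _; apply: z4.
- by [].
- by [].
move=> s5 w5 d5 _ [hf5 hG5 hS5 [hw5 hd5]] _ hr5.
have lk5 : linked Z sets ell s5.
  case: lk4 => l1 l2 l3 l4; split; rewrite ?hr5 //.
    by move=> j jZ; rewrite hf5 // l3.
  by move=> j r jZ rs; rewrite hf5 // l4.
apply: wp_seq; apply: wp_use.
  apply: (@wp_second_stage B n sets m_gt1 sets_uniq sets_lt B_ge Lam Z_lt s5 ell) => //.
  - by rewrite hr5 // er4 er3.
  - move=> i j ij; rewrite hf5 // hf4 //.
    have jb : j %/ b < b.
      by rewrite ltn_divLR //; apply: leq_trans (sets_lt ij) (side_ge n).
    have := hX3 i (j %/ b) (j %% b) jb; rewrite -divn_eq; apply=> //.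
    by rewrite ltn_mod.
  - by move=> i im; rewrite hf5 // hS4.
  - by move=> k c k5; rewrite hf5 ?z4 // /arr; move: k5; clear; lia.
- by [].
- by [].
move=> s6 w6 d6 _ [hf6 hG6 [hw6 hd6]] _ hr6.
have jb j : j < n -> j %/ b < b.
  by move=> jn; rewrite ltn_divLR //; apply: leq_trans jn (side_ge n).
apply: wp_mono.
  apply: (@wp_combine B n sets m_gt1 B_ge s6
    (fun j => sign1 n sets ell (j %/ b) (j %% b)) (fun j => sign2 n sets ell 0 (j %/ b))) => //.
  - by rewrite hr6 // hr5 // er4 er3 hr2 // hr1.
  - by rewrite hr6 // hr5 // er4 er3.
  - by move=> j jn; rewrite hf6 // -hG5 ?ltn_mod ?jb // -divn_eq.
  - by move=> j jn; rewrite hG6 ?jb.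
  - move=> j; case: (sign1P n sets ell (j %/ b) (j %% b)) => ->;
      by case: (sign2P n sets ell 0 (j %/ b)) => ->.
move=> s7 w7 d7 [hO hw7 hd7]; exists ell; split=> //.
- have bb1 : b <= b * b by rewrite leq_pmulr.
  have sumc c : \sum_(0 <= kk < b) \sum_(0 <= x < b) (size (sel sets (kk * b + x)) + c)
      = sumn (shape sets) + b * b * c.
    rewrite (big_nat_mul addn (fun j => size (sel sets j) + c)) big_split /= sum_sel.
    by rewrite sum_nat_const_nat subn0.
  have sum2 : \sum_(0 <= x < b) (\sum_(0 <= t < b) size (sel sets (x * b + t)) + b + 1)
      = sumn (shape sets) + b * (b + 1).
    rewrite -sum_sel -(big_nat_mul addn).
    under eq_bigr do rewrite -addnA.
    by rewrite big_split /= sum_nat_const_nat subn0.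
  move: hw1 hw2 hw3 hw4 hw5 hw6 hw7 (side_ge n) bb1 b0 m_gt1.
  rewrite !sumc sum2; clear; move: (b) (sumn _) (m) Lam.+1 (ltn0Sn Lam) => x N y k k0.
  move=> hw1 hw2 hw3 hw4 hw5 hw6 hw7 nx bb1 b0 m_gt1.
  (* Every phase costs [O(S)] or [O(k S)], where k is the logarithmic factor; the products are made
     atoms before the linear arithmetic. *)
  set S := x * x + N + y.
  have Sk : S <= k * S by rewrite leq_pmull.
  have le c e : e <= c * S -> k * e <= c * (k * S).
    by move=> h; rewrite mulnCA leq_mul2l h orbT.
  have {}hw2 : w2 <= 1000 * (2 * (k * S)).
    by apply: leq_trans hw2 _; rewrite -mulnA leq_mul2l le //; rewrite /S; lia.
  have {}hw5 : w5 <= 2000 * (3 * (k * S)) + 20.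
    by apply: leq_trans hw5 _; rewrite leq_add2r -mulnA leq_mul2l le //; rewrite /S; lia.
  have {}hw6 : w6 <= 2000 * (2 * (k * S)) + 20.
    apply: leq_trans hw6 _; rewrite leq_add2r -mulnA leq_mul2l le //.
    by rewrite mulnDr muln1 /S; lia.
  have hs : w1 + w3 + w4 + w7 <= 900 * S by move: hw1 hw3 hw4 hw7; rewrite /S; clear -nx bb1 b0 m_gt1; lia.
  have S1 : 1 <= S by rewrite /S; lia.
  rewrite -[200 * 100 * k * S]mulnA; move: (k * S) Sk hw2 hw5 hw6 hs S1; clear; move: S => S T; lia.
- move: hd1 hd2 hd3 hd4 hd5 hd6 hd7 b0; clear.
  move: (b) Lam.+1 (ltn0Sn Lam) => x k k0 hd1 hd2 hd3 hd4 hd5 hd6 hd7 x0.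
  have h1 : k <= k * x by rewrite leq_pmulr.
  have h2 : x <= k * x by rewrite leq_pmull.
  have e : k * x.+1 = k * x + k by rewrite mulnS addnC.
  rewrite -[200 * 100 * k * x]mulnA -[2000 * k * _]mulnA e in hd5 hd6 *; move: (k * x) h1 h2 hd1 hd2 hd3 hd4 hd5 hd6 hd7.
  by move=> T; clear -x0; lia.
Qed.

End Main.

(** * The discrepancy bound *)

Section Discrepancy.

Variable R : realType.
Local Open Scope ring_scope.

(** Apply [ln (1 + x) <= x] at [x = - 1/2]. *)
Lemma ln2_ge : 2^-1 <= ln 2 :> R.
Proof.
have := @le_ln1Dx R (- 2^-1) ltac:(lra).
have -> : 1 + - 2^-1 = 2^-1 :> R by lra.
by rewrite lnV ?posrE // lerN2.
Qed.

Lemma ln2_le : ln 2 <= 1 :> R.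
Proof. by have := @le_ln1Dx R 1 ltac:(lra). Qed.

Variables (n : nat) (sets : seq (seq nat)) (ell : nat).
Local Notation m := (size sets).
Local Notation b := (side n).
Hypothesis sets_uniq : forall i, uniq (nth [::] sets i).
Hypothesis sets_lt : forall i j, inS sets i j -> (j < n)%N.
Hypothesis m_gt1 : (1 < m)%N.
Hypothesis ell_gt0 : (0 < ell)%N.
Hypothesis m_lt : (m < 2 ^ ell)%N.

Let b_gt0 : (0 < b)%N. Proof. by []. Qed.

(** [4 m <= 2 ^ (ell + 2)], [ln 2 <= 1], and [ell + 2 <= 3 ell] as the height is positive. *)
Lemma ln4m_le : ln (4 * m)%:R <= 3 * ell%:R :> R.
Proof.
have h : (4 * m)%:R <= 2 ^+ (ell + 2) :> R.
  by rewrite -natrX ler_nat expnD mulnC leq_mul2r ltnW.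
have m4 : 0 < (4 * m)%:R :> R by rewrite ltr0n muln_gt0 /= ltnW.
apply: le_trans (_ : ln (2 ^+ (ell + 2)) <= _).
  by rewrite ler_ln ?posrE // exprn_gt0.
rewrite lnXn // -[ln 2 *+ _]mulr_natl natrD.
have e1 : 1 <= ell%:R :> R by rewrite ler1n.
have := ln2_le; have := ln2_ge; nra.
Qed.

Lemma rate_gt_real el c : (0 < el)%N ->
  c%:R <= (rate el c)%:R ^+ 2 * el%:R :> R.
Proof.
by move=> el0; rewrite -natrX -natrM ler_nat ltnW // rate_gt.
Qed.

Lemma rate_sq_real el c : rate el c = 2 \/ (rate el c)%:R ^+ 2 * el%:R <= 4 * c%:R :> R.
Proof.
case: (rate_sq el c) => [->|h]; [by left|right].
by rewrite -natrX -!natrM ler_nat.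
Qed.

(** The coefficients are 0 or 1 and the rate is at least 2, so nothing is truncated in the first
    run. *)
Lemma block_disc kk i : (i < m)%N ->
  (coef2 n sets ell kk i)%:~R ^+ 2 <= 100 * ell%:R * (count1 n sets kk i)%:R :> R.
Proof.
move=> im; set c := count1 n sets kk i; set L := rate ell c.
set D : R := (coef2 n sets ell kk i)%:~R.
have L2 : (2 <= L)%N by exact: rate_ge2.
have coefE y : coef b (in_group sets 1 (rep1)) (group_coef b ell (coef1 sets) (count1 n sets)) kk i y
    = Posz (inS sets i (kk * b + y)).
  rewrite /coef in_group1 /group_coef /truncate /coef1 /group_rate -/c -/L.
  by case: inS; rewrite ?mul0r // mul1r /= mul1n L2.
have hD : `|D| <= L%:R * ln (4 * m)%:R + 2 * c%:R / L%:R.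
  have := greedy_disc (in_group sets 1 (rep1)) (L_gt0 ell (count1 n sets))
    (group_coef_le b ell (coef1 sets) (count1 n sets)) R kk im b_gt0.
  have -> : \sum_(0 <= y < b) greedy_sign m b (in_group sets 1 rep1)
      (group_coef b ell (coef1 sets) (count1 n sets)) (group_rate ell (count1 n sets)) kk y *
      coef b (in_group sets 1 rep1) (group_coef b ell (coef1 sets) (count1 n sets)) kk i y
      = coef2 n sets ell kk i.
    by rewrite coef2E; apply: eq_bigr => y _; rewrite coefE.
  have -> : \sum_(0 <= y < b)
      coef b (in_group sets 1 rep1) (group_coef b ell (coef1 sets) (count1 n sets)) kk i y ^+ 2
      = Posz c.
    rewrite /c /count1 /block_count (big_morph Posz PoszD (erefl _)).
    by apply: eq_bigr => y _; rewrite coefE; case: inS.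
  by rewrite /group_rate -/c -/L -pmulrn.
have Dc : `|D| <= c%:R.
  rewrite /D -intr_norm [X in _ <= X]pmulrn ler_int /c /count1 /block_count coef2E.
  rewrite (big_morph Posz PoszD (erefl _)); apply: le_trans (ler_norm_sum _ _ _) _.
  apply: ler_sum => y _; rewrite normrM.
  by case: (sign1P n sets ell kk y) => ->; case: inS.
have Lp : 0 < L%:R :> R by rewrite ltr0n ltnW.
have c0 : 0 <= c%:R :> R by rewrite ler0n.
have e1 : 1 <= ell%:R :> R by rewrite ler1n.
have D0 : 0 <= `|D| by exact: normr_ge0.
rewrite -(ger0_norm (sqr_ge0 D)) normrX.
(* If the rate is already its minimum 2, then [c <= 4 ell] and the trivial bound [|D| <= c]
   suffices. *)
case: (rate_sq_real ell c) => [L_eq2|L_sq].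
  have := rate_gt_real c ell_gt0; rewrite L_eq2 => c_le.
  by apply: le_trans (_ : c%:R * c%:R <= _); nra.
have cL : c%:R / L%:R <= L%:R * ell%:R :> R.
  by rewrite ler_pdivrMr // mulrAC -expr2 rate_gt_real.
(* 5 = 3 + 2, from [ln (4 m) <= 3 ell] and [2 c / L <= 2 ell L]; squaring and [L^2 ell <= 4 c] give
   [25 * 4 = 100]. *)
have D_le : `|D| <= 5 * ell%:R * L%:R.
  apply: le_trans hD _; have := ln4m_le; rewrite -mulrA => h.
  by have := ler_wpM2l (ltW Lp) h; nra.
apply: le_trans (_ : (5 * ell%:R * L%:R) ^+ 2 <= _).
  by rewrite ler_sqr // nnegrE mulr_ge0 // ?mulr_ge0 // ltW.
rewrite -/L in L_sq; move: (L%:R : R) (ell%:R : R) (c%:R : R) L_sq e1 => x y z h y1.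
have -> : (5 * y * x) ^+ 2 = 25 * y * (x ^+ 2 * y) by ring.
by have := ler_wpM2l (_ : 0 <= 25 * y) h => /(_ ltac:(nra)); nra.
Qed.

Lemma sum_block_count i : (\sum_(0 <= kk < b) count1 n sets kk i)%N = size (nth [::] sets i).
Proof.
rewrite /count1 /block_count (big_nat_mul addn (fun j => inS sets i j : nat)).
apply: sum_mem => // j ij; exact: leq_trans (sets_lt ij) (side_ge n).
Qed.

(** The first element of the set in the block has rank 0 and represents it. *)
Lemma in_group2 i k : (0 < count1 n sets k i)%N -> in_group sets b (rep2 n sets) i k.
Proof.
move=> c0; have exP : exists t, (t < b)%N && inS sets i (k * b + t).
  apply: contrapT => no; move: c0; rewrite /count1 /block_count big_nat big1 // => t /andP[_ tb].
  by case: (boolP (inS sets i (k * b + t))) => // it; case: no; exists t; rewrite tb it.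
case: (ex_minnP exP) => t /andP[tb it] tmin.
apply/hasP; exists t; first by rewrite mem_iota.
rewrite it /= rep2E // /block_count big_nat big1 // => y /andP[_ yt].
case: (boolP (inS sets i (k * b + y))) => // iy.
by have := tmin y; rewrite iy (ltn_trans yt tb) leqNgt yt => /(_ isT).
Qed.

(** The greedy bound controls the sum with truncated coefficients; what truncation removes is
    estimated separately and costs as much as the quadratic term again. *)
Lemma total_disc i : (i < m)%N ->
  (\sum_(0 <= k < b) sign2 n sets ell 0 k * coef2 n sets ell k i)%:~R ^+ 2
    <= (4 * 403 ^+ 2) * ell%:R ^+ 2 * (size (nth [::] sets i))%:R :> R.
Proof.
move=> im; set c := size _; set L := rate 1 c.
pose a k : int := coef2 n sets ell k i.
pose f k : int := coef b (in_group sets b (rep2 n sets)) (group_coef b 1 (coef2 n sets ell) (count2 sets)) 0 i k.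
set T : R := (_)%:~R.
have L2 : (2 <= L)%N by exact: rate_ge2.
have Lp : 0 < L%:R :> R by rewrite ltr0n ltnW.
have fE k : f k = (in_group sets b (rep2 n sets) i k)%:R * truncate L (a k).
  by rewrite /f /coef /group_coef /group_rate /count2 -/c -/L mul0n add0n.
pose Q : R := \sum_(0 <= k < b) (a k)%:~R ^+ 2.
have Q_le : Q <= 100 * ell%:R * c%:R.
  rewrite /c -sum_block_count natr_sum mulr_sumr; apply: ler_sum => k _.
  exact: block_disc.
have a_sq k : `|a k|%:~R ^+ 2 = (a k)%:~R ^+ 2 :> R.
  by rewrite intr_norm -normrX ger0_norm // sqr_ge0.
have f_le k : (f k)%:~R ^+ 2 <= (a k)%:~R ^+ 2 :> R.
  rewrite fE /truncate; case: in_group; case: ifP => _;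
    by rewrite ?mul1r ?mul0r ?rmorph0 ?expr0n ?sqr_ge0.
have a0 k : count1 n sets k i = 0%N -> a k = 0.
  move=> c0; have := block_disc k im; rewrite c0 mulr0 => a_le0.
  by apply/eqP; rewrite -(intr_eq0 R) -sqrf_eq0 eq_le a_le0 sqr_ge0.
(* A coefficient replaced by 0 has [2 |a| > L], hence [|a| <= 2 a^2 / L]; a set that misses the
   group has [a = 0]. *)
have af k : `|(a k - f k)%:~R| <= 2 / L%:R * (a k)%:~R ^+ 2 :> R.
  have r0 : 0 <= 2 / L%:R * (a k)%:~R ^+ 2 :> R.
    by rewrite mulr_ge0 ?sqr_ge0 // divr_ge0 // ltW.
  rewrite fE; case: (boolP (in_group _ _ _ _ _)) => [_|ng]; last first.
    have -> : a k = 0.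
      by apply: a0; apply/eqP; rewrite -leqn0 leqNgt; apply: contra ng; apply: in_group2.
    by rewrite mul0r subrr rmorph0 normr0 expr0n mulr0.
  rewrite mul1r /truncate; case: leqP => hL; first by rewrite subrr rmorph0 normr0.
  rewrite subr0 -a_sq -intr_norm mulrAC ler_pdivlMr //.
  have : L%:R <= 2 * `|a k|%:~R :> R.
    by rewrite -[2]/(2%:~R) -intrM [X in X <= _]pmulrn ler_int; lia.
  have : 0 <= `|a k|%:~R :> R by rewrite ler0z.
  move: (`|a k|%:~R : R) => x x0 hx.
  by rewrite mulrC expr2 mulrA ler_wpM2r.
have hF : `|(\sum_(0 <= k < b) sign2 n sets ell 0 k * f k)%:~R|
   <= L%:R * ln (4 * m)%:R + 2 * Q / L%:R :> R.
  have h := greedy_disc (in_group sets b (rep2 n sets)) (L_gt0 1 (count2 sets))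
    (group_coef_le b 1 (coef2 n sets ell) (count2 sets)) R 0 im b_gt0.
  apply: le_trans h _; rewrite lerD2l /group_rate /count2 -/c -/L.
  apply: ler_wpM2r; first by rewrite invr_ge0 ltW.
  apply: ler_wpM2l => //; rewrite rmorph_sum.
  by apply: ler_sum => k _; rewrite rmorphXn; exact: f_le.
have e1 : 1 <= ell%:R :> R by rewrite ler1n.
have Q0 : 0 <= Q by apply: sumr_ge0 => k _; apply: sqr_ge0.
have T_le : `|T| <= L%:R * ln (4 * m)%:R + 4 * Q / L%:R.
  have -> : T = (\sum_(0 <= k < b) sign2 n sets ell 0 k * f k)%:~R
      + (\sum_(0 <= k < b) sign2 n sets ell 0 k * (a k - f k))%:~R.
    rewrite -rmorphD -big_split; congr (_%:~R); apply: eq_bigr => k _ /=.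
    by rewrite -mulrDr addrC subrK.
  have h2 : `|(\sum_(0 <= k < b) sign2 n sets ell 0 k * (a k - f k))%:~R|
      <= 2 / L%:R * Q :> R.
    rewrite rmorph_sum /Q mulr_sumr; apply: le_trans (ler_norm_sum _ _ _) _.
    apply: ler_sum => k _; apply: le_trans (af k).
    by case: (sign2P n sets ell 0 k) => ->; rewrite ?mul1r // mulN1r rmorphN normrN.
  apply: le_trans (ler_normD _ _) _; apply: le_trans (lerD hF h2) _.
  by rewrite -addrA lerD2l le_eqVlt; apply/orP; left; apply/eqP; field; rewrite gt_eqF.
(* An empty set has rate 2, for which [L^2 <= 4 c] fails, so it is treated apart; its discrepancy is
   0. *)
have [c0|c_gt0] := posnP c.
  have T0 : T = 0.
    rewrite /T big1_seq ?rmorph0 // => k _; rewrite -/(a k) a0 ?mulr0 //.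
    rewrite /count1 /block_count big1 // => y _.
    by rewrite /inS (size0nil c0).
  by rewrite T0 c0 mulr0 expr0n.
have c1 : 1 <= c%:R :> R by rewrite ler1n.
have cL : c%:R / L%:R <= L%:R :> R.
  rewrite ler_pdivrMr // -expr2; have := @rate_gt_real 1 c isT.
  by rewrite mulr1.
have QL : Q / L%:R <= 100 * ell%:R * L%:R.
  apply: le_trans (_ : 100 * ell%:R * (c%:R / L%:R) <= _).
    by rewrite mulrA ler_wpM2r // invr_ge0 ltW.
  by rewrite ler_wpM2l // mulr_ge0.
have T_le2 : `|T| <= 403 * ell%:R * L%:R.
  apply: le_trans T_le _; have := ler_wpM2l (ltW Lp) ln4m_le.
  by rewrite -mulrA; nra.
have L_sq : L%:R ^+ 2 <= 4 * c%:R :> R.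
  case: (rate_sq_real 1 c) => [L_eq2|]; last by rewrite mulr1.
  by rewrite /L L_eq2; nra.
rewrite -(ger0_norm (sqr_ge0 T)) normrX.
apply: le_trans (_ : (403 * ell%:R * L%:R) ^+ 2 <= _).
  by rewrite ler_sqr // nnegrE mulr_ge0 // ?mulr_ge0 // ltW.
rewrite !exprMn -[X in _ <= X]mulrA [X in _ <= X]mulrAC; move: L_sq.
move: (L%:R ^+ 2 : R) (ell%:R ^+ 2 : R) (c%:R : R) (sqr_ge0 (ell%:R : R)) => x y z.
by move=> y0 h; nra.
Qed.

End Discrepancy.

(** * Logarithms and square roots in the final bounds *)

Section Asymptotics.

Variable R : realType.
Local Open Scope ring_scope.

(** [(ell - 1) ln 2 <= ln m] with [ln 2 >= 1/2] gives [ell <= 2 ln m + 1], and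
    [1 <= 2 ln 2 <= 2 ln m]. *)
Lemma ell_le_ln (m ell : nat) : (1 < m)%N -> (forall k, (k < ell)%N -> (2 ^ k <= m)%N) ->
  (0 < ell)%N -> ell%:R <= 4 * ln m%:R :> R.
Proof.
case: ell => // k m1 h _; have le := h k (leqnn _).
have h1 : k%:R * ln 2 <= ln m%:R :> R.
  rewrite mulr_natl -lnXn // ler_ln ?posrE ?exprn_gt0 ?ltr0n 1?ltnW //.
  by rewrite -natrX ler_nat.
have h2 : ln 2 <= ln m%:R :> R by rewrite ler_ln ?posrE ?ltr0n ?ler_nat // ltnW.
have l2 := ln2_ge R; have k0 : 0 <= k%:R :> R by rewrite ler0n.
by rewrite -[k.+1]addn1 natrD; nra.
Qed.

Definition log_span (n m : nat) : nat := (trunc_log 2 (8 * n.+1 * m.+1)).+1.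

Lemma log_span_lt (n m : nat) : (8 * n.+1 * m.+1 < 2 ^ log_span n m)%N.
Proof. exact: trunc_log_ltn. Qed.

(** As [n m >= 2], [8 (n + 1) (m + 1) <= 32 n m <= (n m)^6], so the logarithm to base 2 is at most
    [12 ln (n m)]; the two successors cost another [4 ln (n m)]. *)
Lemma log_span_le (n m : nat) : (0 < n)%N -> (1 < m)%N ->
  (log_span n m).+1%:R <= 16 * ln (n * m)%:R :> R.
Proof.
move=> n0 m1; rewrite /log_span; set k := trunc_log _ _.
have k_le : (2 ^ k <= (n * m) ^ 6)%N.
  apply: leq_trans (trunc_logP _ _) _ => //.
  have nm2 : (2 <= n * m)%N by apply: leq_trans m1 _; rewrite leq_pmull.
  apply: leq_trans (_ : 32 * (n * m) <= _)%N; first by nia.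
  by rewrite expnS mulnC leq_mul2l -[32%N]/(2 ^ 5)%N leq_exp2r // nm2 orbT.
have nm2 : (2 <= n * m)%N by apply: leq_trans m1 _; rewrite leq_pmull.
have nm_gt0 : 0 < (n * m)%:R :> R by rewrite ltr0n ltnW.
have h1 : k%:R * ln 2 <= 6 * ln (n * m)%:R :> R.
  rewrite [X in X <= _]mulr_natl [X in _ <= X]mulr_natl -!lnXn //.
  by rewrite ler_ln ?posrE ?exprn_gt0 // -!natrX ler_nat.
have h2 : ln 2 <= ln (n * m)%:R :> R by rewrite ler_ln ?posrE // ler_nat.
have l2 := ln2_ge R; have k0 : 0 <= k%:R :> R by rewrite ler0n.
by rewrite -addn2 -addn1 !natrD; nra.
Qed.

(** [4 (n + 1) <= 8 n <= 9 n]. *)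
Lemma side_le_sqrt n : (0 < n)%N -> (side n)%:R <= 3 * Num.sqrt n%:R :> R.
Proof.
move=> n0; rewrite -(@ler_sqr R) ?nnegrE ?ler0n ?mulr_ge0 ?sqrtr_ge0 //.
rewrite exprMn sqr_sqrtr ?ler0n // -!natrX -natrM ler_nat.
by have := side_le n; rewrite -mulnn; lia.
Qed.

End Asymptotics.

(** As [m >= 2], [8 <= ((n + 1) (m + 1))^2], so [Z] is at most the third power of [(n + 1) (m + 1)];
    then [(Z ^ 3) ^ 50] is at most its power 450. *)
Lemma fits_word_bound (n m : nat) (sets : seq (seq nat)) : size sets = m -> 1 < m ->
  fits (word_bound 450 n m) (cap (span n sets)).
Proof.
move=> em m1; rewrite /fits /cap /word_bound /span em -expnM.
rewrite (_ : 450 = 3 * (3 * 50)) // [X in _ <= X]expnM leq_exp2r //.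
have : 8 <= (n.+1 * m.+1) ^ 2 by rewrite -mulnn; nia.
by move=> h; rewrite expnSr -mulnA leq_mul2r h orbT.
Qed.

Local Open Scope ring_scope.

Theorem theorem3p1 (R : realType) :
  exists (prog : com) (K c : nat) (A C : R),
  forall (n m : nat) (S : 'I_m -> {set 'I_n}) (sets : seq (seq nat)),
    (2 <= m)%N -> lists_of S sets ->
    exists (s : state) (t : effect) (chi : 'I_n -> int),
      [/\ exec (word_bound K n m) prog (input_state n sets) s t,
          output s =1 chi /\ (forall j : 'I_n, chi j = 1 \/ chi j = - 1),
          forall i : 'I_m,
            ((\sum_(j in S i) chi j) ^+ 2)%:~R
              <= C * #|S i|%:R * ln (m%:R : R) ^+ 2
        & (0 < n)%N ->
            (work t)%:R <= A * (n + m + \sum_(i < m) #|S i|)%N%:R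
                             * ln ((n * m)%N%:R : R) ^+ c
            /\ (depth t)%:R <= A * Num.sqrt (n%:R : R)
                             * ln ((n * m)%N%:R : R) ^+ c].
Proof.
(* In A, 200 * 100 comes from [wp_main], 16 from [log_span_le] and 8 from
   [side n * side n <= 8 * n]; the depth needs only 3 in place of 8. In C, the factor 16 is the
   square of the 4 in [ell <= 4 ln m]. *)
exists main, 450%N, 1%N, (200 * 100 * 16 * 8), (4 * 403 ^+ 2 * 16).
move=> n m S sets m1 [em hS]; subst m.
have inSE (i : 'I_(size sets)) (j : 'I_n) : inS sets i j = (j \in S i).
  rewrite /inS (perm_mem (hS i)); apply/mapP/idP => [[j' j'S /val_inj ->]|jS].
    by rewrite mem_enum in j'S.
  by exists j; rewrite ?mem_enum.
have sets_lt i j : inS sets i j -> (j < n)%N.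
  move=> ij; move: (ij); rewrite /inS (perm_mem (hS (Ordinal (inS_lt ij)))).
  by case/mapP => j' _ ->; exact: ltn_ord j'.
have sets_uniq i : uniq (nth [::] sets i).
  case: (ltnP i (size sets)) => im; last by rewrite nth_default.
  by rewrite (perm_uniq (hS (Ordinal im))) map_inj_uniq ?enum_uniq //; apply: val_inj.
have cardS (i : 'I_(size sets)) : size (nth [::] sets i) = #|S i|.
  by rewrite (perm_size (hS i)) size_map cardE.
set Lam := log_span n (size sets).
have [s [t [ex _ _ _ [ell [ell0 [mell ellm] hO hw hd]]]]] :=
  @wp_main (word_bound 450 n (size sets)) n sets m1 sets_uniq sets_lt
    (fits_word_bound n erefl m1) Lam (log_span_lt n _) (small_input m1 sets_uniq sets_lt).
have outE (j : 'I_n) : output s j = sign1 n sets ell (j %/ side n) (j %% side n)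
    * sign2 n sets ell 0 (j %/ side n) by exact: hO (ltn_ord j).
exists s, t, (output s); split=> //.
- split=> // j; rewrite outE.
  case: (sign1P n sets ell (j %/ side n) (j %% side n)) => ->;
    case: (sign2P n sets ell 0 (j %/ side n)) => ->;
    by rewrite ?mul1r ?mulN1r ?opprK; auto.
- move=> i; have im : (i < size sets)%N by [].
  pose F j := (inS sets i j)%:R * (sign1 n sets ell (j %/ side n) (j %% side n)
    * sign2 n sets ell 0 (j %/ side n)) : int.
  (* Pad the sum to all indices below [b * b], those from n on being in no set, and write
     [j = k * b + y]. *)
  have -> : \sum_(j in S i) output s j
      = \sum_(0 <= k < side n) sign2 n sets ell 0 k * coef2 n sets ell k i.
    transitivity (\sum_(0 <= j < n) F j).
      rewrite big_mkcond big_mkord; apply: eq_bigr => j _.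
      by rewrite /F outE inSE; case: (j \in S i); rewrite ?mul1r ?mul0r.
    transitivity (\sum_(0 <= j < side n * side n) F j).
      rewrite [RHS](@big_cat_nat _ _ _ n) //=; last exact: side_ge.
      rewrite [X in _ = _ + X]big1_seq ?addr0 // => j /andP[_].
      rewrite mem_index_iota => /andP[nj _]; rewrite /F.
      case: (boolP (inS sets i j)) => [/sets_lt|]; rewrite ?mul0r //.
      by rewrite ltnNge nj.
    rewrite -(big_nat_mul +%R); apply: eq_big_nat => k _.
    rewrite coef2E mulr_sumr; apply: eq_big_nat => y /andP[_ yb].
    rewrite /F divnMDl // divn_small // addn0 modnMDl modn_small //.
    by case: inS; rewrite ?mul1r ?mul0r ?mulr1 ?mulr0 // mulrC.
  rewrite -cardS rmorphXn.
  apply: le_trans (total_disc R sets_uniq sets_lt m1 ell0 mell im) _.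
  have := ell_le_ln R m1 ellm ell0; set l := ln _ => el.
  have e0 : 0 <= ell%:R :> R by rewrite ler0n.
  have l_sq : ell%:R ^+ 2 <= 16 * l ^+ 2 by nra.
  have := ler_wpM2r (ler0n R (size (nth [::] sets i))) l_sq.
  move: (_%:R : R) (ell%:R ^+ 2 : R) (l ^+ 2) => x y z h; nra.
move=> n0.
have logs := log_span_le R n0 m1; rewrite -/Lam in logs.
have card_sum : sumn (shape sets) = (\sum_(i < size sets) #|S i|)%N.
  by rewrite sumn_shape big_mkord; apply: eq_bigr => i _; rewrite cardS.
have sq := side_le_sqrt R n0.
split.
- apply: le_trans (_ : (200 * 100 * Lam.+1 * (side n * side n + sumn (shape sets)
      + size sets))%N%:R <= _); first by rewrite ler_nat.
  have b2 : (side n * side n <= 8 * n)%N by apply: leq_trans (side_le n) _; lia.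
  apply: le_trans (_ : (200 * 100 * Lam.+1 * (8 * (n + size sets
      + sumn (shape sets))))%N%:R <= _).
    by rewrite ler_nat leq_mul2l; apply/orP; right; lia.
  rewrite card_sum expr1 !natrM -(natrM _ n); set X := (n + _ + _)%:R.
  have X0 : 0 <= X by exact: ler0n.
  by have := ler_wpM2r X0 logs; move: (Lam.+1%:R : R) (ln _) => y z; lra.
- apply: le_trans (_ : (200 * 100 * Lam.+1 * side n)%N%:R <= _); first by rewrite ler_nat.
  rewrite expr1 !natrM -(natrM _ n); have r0 := sqrtr_ge0 (n%:R : R).
  have L0 : 0 <= Lam.+1%:R :> R by rewrite ler0n.
  apply: le_trans (_ : 200%:R * 100%:R * (16 * ln (n * size sets)%:R)
     * (3 * Num.sqrt n%:R) <= _).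
    apply: ler_pM => //; rewrite ?mulr_ge0 ?ler0n //.
    by apply: ler_wpM2l logs; rewrite mulr_ge0 ?ler0n.
  have z0 : 0 <= ln (n * size sets)%:R :> R by rewrite -(pmulr_rge0 _ (_ : 0 < 16)) // (le_trans L0).
  have := mulr_ge0 r0 z0.
  by move: (Num.sqrt _) (ln _) => x z h; lra.
Qed.
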